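(* Let $S,S^{-1}:[0,\infty)\to[0,\infty)$ be such that one of the two functions is subexponentially admissible and the other is its left-continuous inverse (that is, $S$ or $S^{-1}$ is subexponentially admissible). Then there exist $d,\tilde d\in\mathbb{R}$ such that the following holds. If $\Lambda=(\lambda_j)_{j\in\mathbb{Z}}$ and $M=(\mu_j)_{j\in\mathbb{Z}}$ are real sequences with $\lambda_j<\lambda_{j+1}$ and $\mu_j<\mu_{j+1}$ for all $j\in\mathbb{Z}$, $\lim_{j\to\pm\infty}\lambda_j=\pm\infty$, $\lim_{j\to\pm\infty}\mu_j=\pm\infty$, and $$\sup_{j\in\mathbb{Z}}S(|\lambda_j|+\tilde d)(\lambda_{j+1}-\lambda_j)\le\tfrac12\quad\text{and}\quad\sup_{j\in\mathbb{Z}}S^{-1}(|\mu_j|+d)(\mu_{j+1}-\mu_j)\le\tfrac12,$$ then $(\Lambda,M)$ is a Fourier uniqueness pair for $\mathcal{H}$.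
   Context: Fourier transform: $\hat f(\xi)=\int_{\mathbb{R}}f(x)e^{-2\pi ix\xi}\,dx$. $\mathcal{H}:=\{f\in L^2(\mathbb{R}):\int_{\mathbb{R}}(1+x^2)|f(x)|^2\,dx+\int_{\mathbb{R}}(1+\xi^2)|\hat f(\xi)|^2\,d\xi<\infty\}$; for $f\in\mathcal{H}$, both $f$ and $\hat f$ are identified with their continuous representatives. A pair $(\Lambda,M)$ of subsets of $\mathbb{R}$ (sequences being identified with their sets of values) is a Fourier uniqueness pair for $\mathcal{H}$ if $f\in\mathcal{H}$, $f|_\Lambda=0$ and $\hat f|_M=0$ imply $f\equiv0$. A $C^1$-function $S:[0,\infty)\to[0,\infty)$ is subexponentially admissible if it is convex, increasing and satisfies: (i) there exists $T_0>0$ such that $S\in C^3([T_0,\infty))$ and the function $t\mapsto\frac{d}{dt}S^2(t)$ is log-concave for all $t\ge T_0$, where $S^2(t)=(S(t))^2$; (ii) $\int_{\mathbb{R}}\frac{|\log\max\{S^2(t),1\}|}{1+t^2}\,dt<\infty$, where $S^2(t)$ is read as $S^2(|t|)$ for $t<0$. The (left-continuous) inverse of $S$ is $S^{-1}(y):=\inf\{x\ge0:S(x)\ge y\}$. *)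

(* Defs.v *)
From HB Require Import structures.
From mathcomp Require Import all_boot all_order all_algebra.
From mathcomp Require Import complex.
From mathcomp Require Import all_classical all_reals all_analysis.

Set Implicit Arguments.
Unset Strict Implicit.
Unset Printing Implicit Defensive.

Import Order.TTheory GRing.Theory Num.Theory.
Import numFieldNormedType.Exports.

Local Open Scope classical_set_scope.
Local Open Scope complex_scope.
Local Open Scope ring_scope.

Local Notation leb R := (@lebesgue_measure R).

Definition Cintegral (R : realType) (f : R -> R[i]) : R[i] :=
  Rintegral (leb R) setT (fun x => complex.Re (f x))
  +i* Rintegral (leb R) setT (fun x => complex.Im (f x)).

Definition expi (R : realType) (t : R) : R[i] := cos t +i* sin t.

(* Only used for f with \int (1 + x^2) |f|^2 < +oo. Such an f is integrable, so
   this is an absolutely convergent integral and a continuous function of xi,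
   which is the continuous representative of the L^2 Fourier transform. *)
Definition fourier (R : realType) (f : R -> R[i]) (xi : R) : R[i] :=
  Cintegral (fun x => f x * expi (- (2 * pi * x * xi))).

Definition abs2 (R : realType) (z : R[i]) : R := ComplexField.Normc.normc z ^+ 2.

Definition Cmeasurable (R : realType) (f : R -> R[i]) : Prop :=
  measurable_fun [set: R] (fun x => complex.Re (f x)) /\
  measurable_fun [set: R] (fun x => complex.Im (f x)).

Definition L2 (R : realType) (f : R -> R[i]) : Prop :=
  Cmeasurable f /\ (\int[leb R]_x (abs2 (f x))%:E < +oo)%E.

Definition in_H (R : realType) (f : R -> R[i]) : Prop :=
  L2 f /\
  (\int[leb R]_x ((1 + x ^+ 2) * abs2 (f x))%:E
   + \int[leb R]_xi ((1 + xi ^+ 2) * abs2 (fourier f xi))%:E < +oo)%E.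

(* Every class in H has exactly one continuous representative f; the quantifier
   ranges over these. *)
Definition fourier_uniqueness_pair (R : realType) (Lambda M : set R) : Prop :=
  forall f : R -> R[i], in_H f -> continuous (f : R -> (R[i])^o) ->
    (forall x, Lambda x -> f x = 0) ->
    (forall xi, M xi -> fourier f xi = 0) ->
    forall x, f x = 0.

(* The derivative is one-sided at the end point a. *)
Definition is_derive_from (R : realType) (a : R) (f : R -> R) (x l : R) : Prop :=
  (fun y => (f y - f x) / (y - x)) @ within `[a, +oo[ x^' --> l.

Fixpoint Ck_from (R : realType) (n : nat) (a : R) (f : R -> R) : Prop :=
  if n is m.+1 then
    exists g : R -> R,
      (forall x, a <= x -> is_derive_from a f x (g x)) /\ Ck_from m a g
  else {within `[a, +oo[, continuous f}.

(* Zero values are allowed (log 0 = -oo). *)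
Definition log_concave_from (R : realType) (a : R) (g : R -> R) : Prop :=
  (forall t, a <= t -> 0 <= g t) /\
  (forall t u th, a <= t -> a <= u -> 0 <= th <= 1 ->
     g t `^ th * g u `^ (1 - th) <= g (th * t + (1 - th) * u)).

(* A function on [0, +oo) is represented by a total function R -> R, whose values
   on the negative half-line are arbitrary. "Increasing" is not meant strictly. *)
Definition subexp_admissible (R : realType) (S : R -> R) : Prop :=
  [/\ forall x, 0 <= x -> 0 <= S x,
      Ck_from 1 0 S,
      @convex_function R R^o `[0, +oo[ S,
      {in `[0, +oo[ &, {homo S : x y / x <= y}} &
      (exists T0 : R, [/\ 0 < T0,
         Ck_from 3 T0 S &
         log_concave_from T0 (derive1 (fun t => S t ^+ 2))]) /\
      (\int[leb R]_t
         (`|ln (Num.max (S `|t| ^+ 2) 1)| / (1 + t ^+ 2))%:E < +oo)%E].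

(* The infimum is taken in the extended reals, so it is +oo for the empty set:
   the equation forces S to be unbounded. *)
Definition left_cont_inverse (R : realType) (S T : R -> R) : Prop :=
  forall y, 0 <= y ->
    (T y)%:E = ereal_inf [set x%:E | x in [set x | 0 <= x /\ y <= S x]].

Definition bi_infinite_increasing (R : realType) (l : int -> R) : Prop :=
  [/\ forall j : int, l j < l (j + 1),
      (fun n : nat => l n%:Z) @ \oo --> +oo &
      (fun n : nat => l (- n%:Z)) @ \oo --> -oo].

(* S carries no constraint at negative arguments, so a value of c for which
   `|l j| + c can be negative brings in arbitrary values of S; as S and its
   inverse are nondecreasing, the condition gets stronger as c >= 0 grows. *)
Definition gap_condition (R : realType) (S : R -> R) (l : int -> R) (c : R) :
    Prop :=
  (ereal_sup [set (S (`|l j| + c) * (l (j + 1) - l j))%:E | j in [set: int]]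
   <= (1 / 2)%:E)%E.

(* Main.v *)
From HB Require Import structures.
Require Import Defs.
From mathcomp Require Import all_boot all_order all_algebra.
From mathcomp Require Import complex.
From mathcomp Require Import all_classical all_reals all_analysis.
From mathcomp Require Import measurable_realfun zify ring lra.

(** Exchanging the roles of a function and its transform reduces the theorem to
    the case where S is admissible. Past a suitable point, convexity and the
    log-concavity of (S^2)' make S, translated to the origin, a convex function s
    with s(0) = 0, with slopes bounded below by a positive number and growing at
    most exponentially; the inverse of S becomes the inverse t of s. Write h for
    the transform of f, and let d be a large constant.

    The analytic tool is a Wirtinger inequality ([wirtinger]): if the transform m
    of g vanishes at the points of a sequence, and V(x) times the length of any
    gap containing x is at most 1/2, then the integral of V^2 |m|^2 is at most
    that of x^2 |g|^2. Indeed the first Dirichlet eigenvalue of a gap is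
    (pi / length)^2 >= (2 pi V)^2, and m' is the transform of -2 i pi x g. The
    zeros of f give ([weighted_f])

      int s(|x|+d)^2 |f(x)|^2 dx <= H := int xi^2 |h(xi)|^2 dxi.

    If s(x) = x, the same inequality at the zeros of h would bound
    int (|xi|+d)^2 |h|^2 by int x^2 |f|^2 <= H, whence h = 0. A general s is
    reduced to this case by linearising it in phase space. Multiply h by a
    Gaussian window centred at a and let q_a be the corresponding piece of f.
    Since s is convex with s(0) = 0, s^2 is a convex function of the square of its
    argument and lies above a tangent ([profile_sqr_tangent]): for A = |a| + d,
    b = t(A) and the slope B of this tangent, s(x)^2 >= A^2 + B (x^2 - b^2). The
    windowed h still has the zeros of h, so Wirtinger's inequality with weight
    t(|xi|+d) bounds the integral of x^2 |q_a|^2 from below. As t inverts s, the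
    resulting weight A^2 + B (t(|xi|+d)^2 - b^2) is (|xi|+d)^2 up to an error
    linear in |xi| + d and exponential in |xi - a| ([profile_bracket]), which the
    window absorbs ([packet_energy]).

    Integrating over a, the pieces q_a reassemble to |f|^2 with the weight s^2
    averaged over the window, and the average is at most s(|x|+d)^2
    ([weight_average]). Altogether, with N an exponential moment of the window,

      int (|xi|+d)^2 |h|^2 <= H + N int (4 (|xi|+d) + 12) |h|^2,

    and for d = 8 N the quadratic on the left exceeds the total weight on the
    right by at least 1, which forces h = 0 ([core_integral]).

    The supporting facts on the Fourier transform (Bessel's inequality and
    inversion) are obtained by Gaussian summability ([gauss_inversion]). *)

Set Implicit Arguments.
Unset Strict Implicit.
Unset Printing Implicit Defensive.

Import Order.TTheory GRing.Theory Num.Theory.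
Import numFieldNormedType.Exports.

Local Open Scope classical_set_scope.
Local Open Scope complex_scope.
Local Open Scope ring_scope.

Local Notation leb R := (@lebesgue_measure R).
Local Notation normc := (ComplexField.Normc.normc).
Local Notation Re := complex.Re.
Local Notation Im := complex.Im.

(** * Integrable real functions *)

Section RealIntegral.
Variable R : realType.
Implicit Types f g : R -> R.

Definition intg f := (leb R).-integrable setT (EFin \o f).

Lemma intg_meas f : intg f -> measurable_fun setT f.
Proof. by move=> /integrableP[/measurable_EFinP]. Qed.

Lemma intg_dom f g : measurable_fun setT f -> intg g ->
  (forall x, `|f x| <= g x) -> intg f.
Proof.
move=> mf ig fg; apply: (le_integrable _ _ _ ig) => //.
  exact/measurable_EFinP.
move=> x _; rewrite /= lee_fin (le_trans (fg x))// ler_norm //.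
Qed.

Lemma intgP f : measurable_fun setT f ->
  (\int[leb R]_x `|f x|%:E < +oo)%E -> intg f.
Proof. by move=> mf If; apply/integrableP; split=> //; exact/measurable_EFinP. Qed.

Lemma intg_lty f : intg f -> (\int[leb R]_x `|f x|%:E < +oo)%E.
Proof. by move=> /integrableP[_]. Qed.

Lemma intgD f g : intg f -> intg g -> intg (fun x => f x + g x).
Proof. by move=> If Ig; have := integrableD measurableT If Ig. Qed.

Lemma intgB f g : intg f -> intg g -> intg (fun x => f x - g x).
Proof. by move=> If Ig; have := integrableB measurableT If Ig. Qed.

Lemma intgZ c f : intg f -> intg (fun x => c * f x).
Proof. by move=> If; have := integrableZl measurableT c If. Qed.

Lemma intg_norm f : intg f -> intg (fun x => `|f x|).
Proof. by move=> If; have := integrable_norm If. Qed.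

Lemma intgM_bounded f g (C : R) : intg f -> measurable_fun setT g ->
  (forall x, `|g x| <= C) -> intg (fun x => f x * g x).
Proof.
move=> If mg gC; apply: (intg_dom _ (intgZ C (intg_norm If))).
  by apply: measurable_funM => //; exact: intg_meas.
by move=> x; rewrite normrM mulrC ler_wpM2r.
Qed.

Lemma intg_integralE f : intg f ->
  ((Rintegral (leb R) setT f)%:E = \int[leb R]_x (f x)%:E)%E.
Proof. by move=> If; rewrite /Rintegral fineK//; exact: integrable_fin_num. Qed.

Lemma ge0_intgE f : measurable_fun setT f -> (forall x, 0 <= f x) ->
  (\int[leb R]_x (f x)%:E < +oo)%E -> intg f.
Proof.
move=> mf f0 If; apply: intgP => //.
by under eq_integral do rewrite ger0_norm//.
Qed.

Definition translation (a : R) : measurableTypeR R -> measurableTypeR R :=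
  fun x => x + a.

Lemma measurable_translation (a : R) : measurable_fun setT (translation a).
Proof. by apply: measurable_funD. Qed.

HB.instance Definition _ (a : R) := isMeasurableFun.Build _ _ _ _
  (translation a) (measurable_translation a).

Lemma pushforward_translation (a : R) (A : set R) : measurable A ->
  pushforward (leb R) (translation a) A = leb R A.
Proof.
move=> mA; apply/esym/lebesgue_measure_unique => //= _ [[b c]] _ <-.
rewrite /pushforward/=.
have -> : translation a @^-1` `]b, c]%classic = `](b - a), (c - a)]%classic.
  by apply/seteqP; split=> x /=; rewrite !in_itv/= ltrBlDr lerBrDr.
rewrite !lebesgue_measure_itv/= !lte_fin ltrD2r; case: ifPn => // _.
by rewrite -!EFinB; congr EFin; ring.
Qed.

Lemma ge0_integral_shift (a : R) (f : R -> \bar R) : measurable_fun setT f ->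
  (forall x, 0 <= f x)%E ->
  (\int[leb R]_x f (x + a)%R = \int[leb R]_x f x)%E.
Proof.
move=> mf f0.
transitivity (\int[pushforward (leb R)
    (translation a)]_x f x)%E; last first.
  by apply: eq_measure_integral => A; move=> mA _; exact: pushforward_translation.
by rewrite ge0_integral_pushforward//; exact: measurable_translation.
Qed.

Lemma intg_shift (a : R) f : intg f -> intg (fun x => f (x + a)).
Proof.
move=> If; apply: intgP.
  exact: measurableT_comp (intg_meas If) (@measurable_translation a).
rewrite (@ge0_integral_shift a (fun x => `|f x|%:E)).
- exact: intg_lty.
- by apply/measurable_EFinP; apply: measurableT_comp => //; exact: intg_meas.
- by move=> x; rewrite lee_fin.
Qed.

Lemma Rintegral_shift (a : R) f : intg f ->
  Rintegral (leb R) setT (fun x => f (x + a)) = Rintegral (leb R) setT f.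
Proof.
move=> If; rewrite /Rintegral; congr fine.
transitivity (\int[pushforward (leb R)
    (translation a)]_x (f x)%:E)%E; last first.
  by apply: eq_measure_integral => A; move=> mA _; exact: pushforward_translation.
apply/esym; apply: (etrans (integral_pushforward (measurable_translation a)
  (_ : measurable_fun setT (EFin \o f)) _ measurableT)) => //.
- by apply/measurable_EFinP; exact: intg_meas.
- exact: intg_shift.
Qed.

End RealIntegral.

(** * Fubini and Tonelli on the plane *)

Section Fubini.
Variable R : realType.

Lemma tonelli (f : R * R -> R) : measurable_fun setT f -> (forall p, 0 <= f p) ->
  (\int[leb R]_x \int[leb R]_y (f (x, y))%:E =
   \int[leb R]_y \int[leb R]_x (f (x, y))%:E)%E.
Proof.
move=> mf f0.
apply: (@fubini_tonelli _ _ _ _ _ (leb R) (leb R) (fun p => (f p)%:E)) => //=.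
exact/measurable_EFinP.
Qed.

Lemma measurable_tonelli (f : R * R -> R) :
  measurable_fun setT f -> (forall p, 0 <= f p) ->
  measurable_fun setT (fun x => \int[leb R]_y (f (x, y))%:E)%E.
Proof.
move=> mf f0; apply: (@measurable_fun_fubini_tonelli_F _ _ _ _ _ (leb R)
  (fun p => (f p)%:E)) => //=.
exact/measurable_EFinP.
Qed.

Lemma measurable_slice (f : R * R -> R) x : measurable_fun setT f ->
  measurable_fun setT (fun y => f (x, y)).
Proof. by move=> mf; apply: measurableT_comp => //. Qed.

Lemma measurable_slice_l (f : R * R -> R) y : measurable_fun setT f ->
  measurable_fun setT (fun x => f (x, y)).
Proof. by move=> mf; apply: measurableT_comp => //. Qed.

Section Dominated.
Variables (f : R * R -> R) (G H : R -> R).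
Hypotheses (mf : measurable_fun setT f) (IG : intg G) (IH : intg H)
  (fGH : forall x y, `|f (x, y)| <= G x * H y).

Lemma slice_intg x : intg (fun y => f (x, y)).
Proof. exact: intg_dom (measurable_slice x mf) (intgZ (G x) IH) (fGH x). Qed.

Lemma slice_intg_l y : intg (fun x => f (x, y)).
Proof.
apply: intg_dom (measurable_slice_l y mf) (intgZ (H y) IG) _.
by move=> x; rewrite mulrC.
Qed.

Lemma dominated_prod_integrable :
  (leb R \x leb R)%E.-integrable setT (EFin \o f).
Proof.
apply/integrable12ltyP; first exact/measurable_EFinP.
have IHn : (\int[leb R]_y `|H y|%:E < +oo)%E by exact: intg_lty.
apply: (@le_lt_trans _ _ (\int[leb R]_x (`|G x|%:E *
   \int[leb R]_y `|H y|%:E))%E).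
  apply: ge0_le_integral => //.
  - by move=> x _; exact: integral_ge0.
  - apply: (@measurable_fun_fubini_tonelli_F _ _ _ _ _ (leb R)
      (fun p => `|(f p)%:E|%E)) => //=.
    by apply/measurable_EFinP; exact: measurableT_comp.
  - apply: emeasurable_funM => //; apply/measurable_EFinP.
    by apply: measurableT_comp => //; exact: intg_meas IG.
  - move=> x _; rewrite -ge0_integralZl//=; last first.
      by apply/measurable_EFinP; apply: measurableT_comp => //; exact: intg_meas.
    apply: ge0_le_integral => //.
    + apply/measurable_EFinP; apply: measurableT_comp => //.
      exact: measurable_slice.
    + apply/measurable_EFinP; apply: measurable_funM => //.
      by apply: measurableT_comp => //; exact: intg_meas.
    + move=> y _; rewrite lee_fin (le_trans (fGH x y))//.
      by rewrite -normrM ler_norm.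
have -> : (\int[leb R]_y `|H y|%:E)%E = (fine (\int[leb R]_y `|H y|%:E))%:E.
  by rewrite fineK// ge0_fin_numE// integral_ge0.
under eq_integral do rewrite muleC.
rewrite ge0_integralZl//; last 2 first.
- by apply/measurable_EFinP; apply: measurableT_comp => //; exact: intg_meas.
- by rewrite lee_fin fine_ge0// integral_ge0.
by apply: lte_mul_pinfty; [rewrite lee_fin fine_ge0// integral_ge0| |exact: intg_lty].
Qed.

Lemma dominated_Fubini :
  Rintegral (leb R) setT (fun x => Rintegral (leb R) setT (fun y => f (x, y))) =
  Rintegral (leb R) setT (fun y => Rintegral (leb R) setT (fun x => f (x, y))).
Proof.
rewrite /Rintegral; congr fine.
under eq_integral do rewrite (intg_integralE (slice_intg _)).
under [RHS]eq_integral do rewrite (intg_integralE (slice_intg_l _)).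
exact: (Fubini dominated_prod_integrable).
Qed.

End Dominated.
End Fubini.

(** * Complex numbers and complex integrals *)

Section ComplexNumbers.
Variable R : realType.
Implicit Types z w : R[i].

Lemma complexP z w : Re z = Re w -> Im z = Im w -> z = w.
Proof. by case: z => a b; case: w => c d /= -> ->. Qed.

Lemma CReM z w : Re (z * w) = Re z * Re w - Im z * Im w.
Proof. by case: z => a b; case: w. Qed.

Lemma CImM z w : Im (z * w) = Re z * Im w + Im z * Re w.
Proof. by case: z => a b; case: w. Qed.

Lemma CReD z w : Re (z + w) = Re z + Re w.
Proof. by case: z => a b; case: w. Qed.

Lemma CImD z w : Im (z + w) = Im z + Im w.
Proof. by case: z => a b; case: w. Qed.

Lemma CReN z : Re (- z) = - Re z. Proof. by case: z. Qed.
Lemma CImN z : Im (- z) = - Im z. Proof. by case: z. Qed.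
Lemma CReJ z : Re (conjc z) = Re z. Proof. by case: z. Qed.
Lemma CImJ z : Im (conjc z) = - Im z. Proof. by case: z. Qed.

Lemma Cconj_mul z w : conjc (z * w) = conjc z * conjc w.
Proof. by case: z => a b; case: w => c d; apply: complexP => /=; ring. Qed.

Lemma Cconj_conj z : conjc (conjc z) = z.
Proof. by case: z => a b; apply: complexP => //=; rewrite opprK. Qed.

Definition RIE := (CReM, CImM, CReD, CImD, CReN, CImN, CReJ, CImJ).

Lemma abs2E z : abs2 z = Re z ^+ 2 + Im z ^+ 2.
Proof.
by case: z => a b; rewrite /abs2 /= sqr_sqrtr// addr_ge0// sqr_ge0.
Qed.

Lemma normc_ge0 z : 0 <= normc z.
Proof. by case: z => a b /=; rewrite sqrtr_ge0. Qed.

Lemma normc_sqrtE z : normc z = Num.sqrt (Re z ^+ 2 + Im z ^+ 2).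
Proof. by case: z. Qed.

Lemma Re_le_normc z : `|Re z| <= normc z.
Proof.
rewrite normc_sqrtE -sqrtr_sqr ler_sqrt ?lerDl ?sqr_ge0//.
by rewrite addr_ge0 ?sqr_ge0.
Qed.

Lemma Im_le_normc z : `|Im z| <= normc z.
Proof.
rewrite normc_sqrtE -sqrtr_sqr ler_sqrt ?lerDr ?sqr_ge0//.
by rewrite addr_ge0 ?sqr_ge0.
Qed.

Lemma normc_le z : normc z <= `|Re z| + `|Im z|.
Proof.
rewrite normc_sqrtE -[leRHS]ger0_norm ?addr_ge0// -sqrtr_sqr.
rewrite ler_sqrt ?sqr_ge0// sqrrD !real_normK ?num_real//.
by rewrite -addrA lerD2l lerDr mulrn_wge0 ?mulr_ge0.
Qed.

Lemma Cnormc_conj z : normc (conjc z) = normc z.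
Proof. by rewrite !normc_sqrtE !RIE sqrrN. Qed.

Lemma normc_real (x : R) : normc (x%:C) = `|x|.
Proof. by rewrite normc_sqrtE /= expr0n addr0 sqrtr_sqr. Qed.

Lemma abs2_ge0 z : 0 <= abs2 z. Proof. exact: sqr_ge0. Qed.

Lemma abs2M z w : abs2 (z * w) = abs2 z * abs2 w.
Proof. by rewrite /abs2 ComplexField.Normc.normcM exprMn. Qed.

Lemma abs2_conj z : abs2 (conjc z) = abs2 z.
Proof. by rewrite /abs2 Cnormc_conj. Qed.

Lemma abs2_eq0 z : abs2 z = 0 -> z = 0.
Proof.
rewrite abs2E => /eqP; rewrite paddr_eq0 ?sqr_ge0// !sqrf_eq0.
by move=> /andP[/eqP a /eqP b]; exact: complexP.
Qed.

Lemma mulcJ z : z * conjc z = (abs2 z)%:C.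
Proof. by apply: complexP; rewrite !RIE ?abs2E /= ; ring. Qed.

Lemma normc_expi t : normc (expi t : R[i]) = 1.
Proof. by rewrite normc_sqrtE /= cos2Dsin2 sqrtr1. Qed.

Lemma expiD (s t : R) : expi (s + t) = expi s * expi t.
Proof. by apply: complexP; rewrite !RIE /= ?cosD ?sinD; ring. Qed.

Lemma expiJ (t : R) : conjc (expi t) = expi (- t).
Proof. by apply: complexP; rewrite !RIE /= ?cosN ?sinN. Qed.

Lemma expi0 : expi 0 = 1 :> R[i].
Proof. by apply: complexP; rewrite /= ?cos0 ?sin0. Qed.

End ComplexNumbers.

Section ComplexIntegral.
Variable R : realType.
Implicit Types f g : R -> R[i].

Definition Cintg f := intg (fun x => Re (f x)) /\ intg (fun x => Im (f x)).

Lemma CmeasM f g : Cmeasurable f -> Cmeasurable g -> Cmeasurable (fun x => f x * g x).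
Proof.
move=> [fr fi] [gr gi]; split.
- under eq_fun do rewrite CReM.
  by apply: measurable_funB; apply: measurable_funM.
- under eq_fun do rewrite CImM.
  by apply: measurable_funD; apply: measurable_funM.
Qed.

Lemma CmeasB f g : Cmeasurable f -> Cmeasurable g -> Cmeasurable (fun x => f x - g x).
Proof.
move=> [fr fi] [gr gi]; split.
- by under eq_fun do rewrite CReD CReN; apply: measurable_funB.
- by under eq_fun do rewrite CImD CImN; apply: measurable_funB.
Qed.

Lemma CmeasJ f : Cmeasurable f -> Cmeasurable (fun x => conjc (f x)).
Proof.
move=> [fr fi]; split; first by under eq_fun do rewrite CReJ.
by under eq_fun do rewrite CImJ; apply: measurableT_comp.
Qed.

Lemma Cmeas_cst (c : R[i]) : Cmeasurable (fun=> c : R[i]).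
Proof. by split; exact: measurable_cst. Qed.

Lemma Cmeas_real (u : R -> R) : measurable_fun setT u -> Cmeasurable (fun x => (u x)%:C).
Proof. by move=> mu; split => //=; exact: measurable_cst. Qed.

Lemma Cmeas_expi (u : R -> R) : measurable_fun setT u -> Cmeasurable (fun x => expi (u x)).
Proof.
move=> mu; split => /=.
- by apply: measurableT_comp => //; apply: continuous_measurable_fun; exact: continuous_cos.
- by apply: measurableT_comp => //; apply: continuous_measurable_fun; exact: continuous_sin.
Qed.

Lemma Cmeas_normc f : Cmeasurable f -> measurable_fun setT (fun x => normc (f x)).
Proof.
move=> [fr fi]; under eq_fun do rewrite normc_sqrtE.
apply: measurableT_comp; first by apply: continuous_measurable_fun; exact: sqrt_continuous.
by apply: measurable_funD; apply: measurable_funX.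
Qed.

Lemma Cmeas_abs2 f : Cmeasurable f -> measurable_fun setT (fun x => abs2 (f x)).
Proof. by move=> mf; apply: measurable_funX; exact: Cmeas_normc. Qed.

Lemma Cintg_meas f : Cintg f -> Cmeasurable f.
Proof. by move=> [/intg_meas ? /intg_meas ?]. Qed.

Lemma Cintg_dom f (G : R -> R) : Cmeasurable f -> intg G ->
  (forall x, normc (f x) <= G x) -> Cintg f.
Proof.
move=> [fr fi] IG fG; split; apply: (intg_dom _ IG) => // x.
- exact: le_trans (Re_le_normc _) (fG x).
- exact: le_trans (Im_le_normc _) (fG x).
Qed.

Lemma Cintg_normc f : Cintg f -> intg (fun x => normc (f x)).
Proof.
move=> If; have [Ir Ii] := If.
apply: (intg_dom _ (intgD (intg_norm Ir) (intg_norm Ii))).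
  by apply: Cmeas_normc; exact: Cintg_meas.
by move=> x; rewrite ger0_norm ?normc_ge0// normc_le.
Qed.

Lemma CintgM_bounded f g (C : R) : Cintg f -> Cmeasurable g ->
  (forall x, normc (g x) <= C) -> Cintg (fun x => f x * g x).
Proof.
move=> If mg gC; apply: (Cintg_dom _ (intgZ C (Cintg_normc If))).
  by apply: CmeasM => //; exact: Cintg_meas.
by move=> x; rewrite ComplexField.Normc.normcM mulrC ler_wpM2r// normc_ge0.
Qed.

Lemma CintgZ (c : R[i]) f : Cintg f -> Cintg (fun x => c * f x).
Proof.
move=> If; under eq_fun do rewrite mulrC.
exact: CintgM_bounded If (Cmeas_cst c) (fun=> lexx _).
Qed.

Lemma CintgJ f : Cintg f -> Cintg (fun x => conjc (f x)).
Proof.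
move=> [Ir Ii]; split; first by under eq_fun do rewrite CReJ.
by under eq_fun do rewrite CImJ -mulN1r; exact: intgZ.
Qed.

Lemma CintegralJ f : Cintg f ->
  Cintegral (fun x => conjc (f x)) = conjc (Cintegral f).
Proof.
move=> [Ir Ii]; apply: complexP; rewrite RIE /=.
- by under eq_Rintegral do rewrite CReJ.
- under eq_Rintegral do rewrite CImJ -mulN1r.
  by rewrite RintegralZl// mulN1r.
Qed.

Lemma CintegralZ (c : R[i]) f : Cintg f ->
  Cintegral (fun x => c * f x) = c * Cintegral f.
Proof.
move=> [Ir Ii]; apply: complexP; rewrite RIE /=.
- under eq_Rintegral do rewrite CReM.
  by rewrite RintegralB// ?RintegralZl//; exact: intgZ.
- under eq_Rintegral do rewrite CImM.
  by rewrite RintegralD// ?RintegralZl//; exact: intgZ.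
Qed.

Lemma CintegralB f g : Cintg f -> Cintg g ->
  Cintegral (fun x => f x - g x) = Cintegral f - Cintegral g.
Proof.
move=> [fr fi] [gr gi]; apply: complexP; rewrite !RIE /=.
- by under eq_Rintegral do rewrite CReD CReN; rewrite RintegralB.
- by under eq_Rintegral do rewrite CImD CImN; rewrite RintegralB.
Qed.

Lemma Cintegral_shift (a : R) f : Cintg f ->
  Cintegral (fun x => f (x + a)) = Cintegral f.
Proof.
by move=> [fr fi]; apply: complexP => /=;
  [rewrite (Rintegral_shift a fr)|rewrite (Rintegral_shift a fi)].
Qed.

Lemma eq_Cintegral f g : (forall x, f x = g x) -> Cintegral f = Cintegral g.
Proof. by move=> /funext ->. Qed.

(** Rotating by the phase of the integral makes it real, so the bound reduces
    to the real triangle inequality. *)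
Lemma normc_Cintegral f : Cintg f ->
  normc (Cintegral f) <= Rintegral (leb R) setT (fun x => normc (f x)).
Proof.
move=> If; set z := Cintegral f.
have In := Cintg_normc If.
have [z0|z0] := eqVneq (normc z) 0.
  by rewrite z0; apply: Rintegral_ge0 => x _; exact: normc_ge0.
have zp : 0 < normc z by rewrite lt_def z0 normc_ge0.
rewrite -(ler_pM2l zp) -expr2 -/(abs2 z).
have -> : abs2 z = Re (conjc z * z) by rewrite mulrC mulcJ.
rewrite -CintegralZ// -RintegralZl//.
have [IR _] := CintgZ (conjc z) If.
rewrite [leLHS](_ : _ = Rintegral (leb R) setT (fun x => Re (conjc z * f x)))//.
apply: le_Rintegral => //; first exact: intgZ.
move=> x _; apply: le_trans (ler_norm _) _; apply: le_trans (Re_le_normc _) _.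
by rewrite ComplexField.Normc.normcM Cnormc_conj.
Qed.

Section Fubini.
Variables (K : R -> R -> R[i]) (G H : R -> R).
Hypotheses (mr : measurable_fun setT (fun p : R * R => Re (K p.1 p.2)))
  (mi : measurable_fun setT (fun p : R * R => Im (K p.1 p.2)))
  (IG : intg G) (IH : intg H)
  (KGH : forall x y, normc (K x y) <= G x * H y).

Let rGH x y : `|Re (K (x, y).1 (x, y).2)| <= G x * H y.
Proof. exact: le_trans (Re_le_normc _) (KGH x y). Qed.

Let iGH x y : `|Im (K (x, y).1 (x, y).2)| <= G x * H y.
Proof. exact: le_trans (Im_le_normc _) (KGH x y). Qed.

Lemma CFubini : Cintegral (fun x => Cintegral (K x)) =
  Cintegral (fun y => Cintegral (fun x => K x y)).
Proof.
apply: complexP => /=.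
- exact: (dominated_Fubini mr IG IH rGH).
- exact: (dominated_Fubini mi IG IH iGH).
Qed.

End Fubini.

End ComplexIntegral.

(** * Gaussians *)

Section Gaussian.
Variable R : realType.

Definition gaussian (c t : R) := expR (- (pi * c * t ^+ 2)).

Lemma gaussian_ge0 c t : 0 <= gaussian c t. Proof. exact: expR_ge0. Qed.

Lemma gaussian0 c : gaussian c 0 = 1.
Proof. by rewrite /gaussian expr0n/= mulr0 oppr0 expR0. Qed.

Lemma gaussianN c t : gaussian c (- t) = gaussian c t.
Proof. by rewrite /gaussian sqrrN. Qed.

Lemma is_derive_gaussian c (t : R) :
  is_derive t 1 (gaussian c) (- (2 * pi * c * t) * gaussian c t).
Proof.
have dq : is_derive t 1 (fun t : R => - (pi * c * t ^+ 2)) (- (2 * pi * c * t)).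
  have -> : (fun t : R => - (pi * c * t ^+ 2)) = (- (pi * c)) \*: ((@id R) ^+ 2).
    by apply/funext => u /=; rewrite !fctE /GRing.scale /=; ring.
  by apply: is_derive_eq; rewrite /GRing.scale /=; ring.
have := @is_derive1_comp _ expR (fun t : R => - (pi * c * t ^+ 2)) t _ _
  (is_derive_expR (- (pi * c * t ^+ 2))) dq.
by move=> h; apply: is_derive_eq; rewrite mulrC.
Qed.

Lemma is_derive_cos_affine (a b t : R) :
  is_derive t 1 (fun t => cos (a * t + b)) (- a * sin (a * t + b)).
Proof.
have da : is_derive t 1 (fun t : R => a * t + b) a.
  have -> : (fun t : R => a * t + b) = (a \*: (@id R)) + cst b by [].
  by apply: is_derive_eq; rewrite /GRing.scale /= mulr1 addr0.
have := @is_derive1_comp _ cos (fun t : R => a * t + b) t _ _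
  (is_derive_cos (a * t + b)) da.
by move=> h; apply: is_derive_eq; rewrite mulrC mulrN mulNr.
Qed.

Lemma is_derive_sin_affine (a b t : R) :
  is_derive t 1 (fun t => sin (a * t + b)) (a * cos (a * t + b)).
Proof.
have da : is_derive t 1 (fun t : R => a * t + b) a.
  have -> : (fun t : R => a * t + b) = (a \*: (@id R)) + cst b by [].
  by apply: is_derive_eq; rewrite /GRing.scale /= mulr1 addr0.
have := @is_derive1_comp _ sin (fun t : R => a * t + b) t _ _
  (is_derive_sin (a * t + b)) da.
by move=> h; apply: is_derive_eq; rewrite mulrC.
Qed.

Lemma continuous_is_derive (f f' : R -> R) :
  (forall x : R, is_derive x 1 f (f' x)) -> continuous f.
Proof.
move=> df x; apply/differentiable_continuous/derivable1_diffP.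
by have := df x => -[].
Qed.

Lemma continuous_gaussian c : continuous (gaussian c).
Proof. exact: continuous_is_derive (is_derive_gaussian c). Qed.

Lemma measurable_gaussian c : measurable_fun setT (gaussian c).
Proof. by apply: continuous_measurable_fun; exact: continuous_gaussian. Qed.

Lemma integral_gaussian c : 0 < c ->
  (\int[leb R]_t (gaussian c t)%:E)%E = ((Num.sqrt c)^-1)%:E.
Proof.
move=> c0; pose s : R := Num.sqrt (pi * c).
have pc0 : 0 < pi * c by rewrite mulr_gt0// pi_gt0.
have s0 : 0 < s by rewrite sqrtr_gt0.
pose F : R -> R := s \*: (@id R).
have dF (x : R) : is_derive x 1 F s by apply: is_derive_eq; rewrite /GRing.scale /= mulr1.
have F'E : (F^`())%classic = cst s by apply/funext => x; rewrite derive1E; exact: derive_val.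
have := @increasing_ge0_integration_by_substitutionT R F (@gauss_fun R).
rewrite integralT_gauss F'E => H.
have {H} : ((Num.sqrt pi)%:E = \int[leb R]_x ((gauss_fun (F x) * s))%:E)%E.
  apply: H => //.
  - by move=> x y xy; rewrite /F /= /GRing.scale/= ltr_pM2l.
  - by move=> x; exact: cvg_cst.
  - by apply/cvg_ex; exists s; exact: cvg_cst.
  - by apply/cvg_ex; exists s; exact: cvg_cst.
  - by apply: (gt0_cvgMrNy s0); exact: cvg_id.
  - by apply: (gt0_cvgMry s0); exact: cvg_id.
  - exact: continuous_gauss_fun.
  - by move=> x; exact: gauss_fun_ge0.
under eq_integral => x _.
  have -> : gauss_fun (F x) * s = s * gaussian c x.
    rewrite mulrC /gaussian /gauss_fun /F /= /GRing.scale /= exprMn.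
    by rewrite sqr_sqrtr// ltW.
  rewrite EFinM; over.
rewrite ge0_integralZl//; last 3 first.
- by apply/measurable_EFinP; exact: measurable_gaussian.
- by move=> x _; rewrite lee_fin gaussian_ge0.
- by rewrite lee_fin ltW.
move=> /(congr1 (fun e => s^-1%:E * e)%E).
rewrite muleA -!EFinM mulVf ?gt_eqF// mul1e => <-; congr EFin.
rewrite /s sqrtrM ?pi_ge0// invfM -mulrA [_^-1 * Num.sqrt pi]mulrC mulrA.
by rewrite mulVf ?mul1r// gt_eqF// sqrtr_gt0 pi_gt0.
Qed.

Lemma intg_gaussian c : 0 < c -> intg (gaussian c).
Proof.
move=> c0; apply: ge0_intgE; first exact: measurable_gaussian.
  by move=> t; exact: gaussian_ge0.
by rewrite integral_gaussian// ltry.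
Qed.

(** Completing the square in the exponent. *)
Lemma exp_gaussian_le c k (t : R) : 0 < c -> expR (k * `|t|) * gaussian c t <=
  expR (k ^+ 2 / (2 * pi * c)) * gaussian (c / 2) t.
Proof.
move=> c0; rewrite -!expRD ler_expR.
have pc0 : 0 < pi * c by rewrite mulr_gt0// pi_gt0.
rewrite -subr_ge0.
have -> : k ^+ 2 / (2 * pi * c) - pi * (c / 2) * t ^+ 2 -
  (k * `|t| - pi * c * t ^+ 2) = (k - pi * c * `|t|) ^+ 2 / (2 * (pi * c)).
  rewrite -[t ^+ 2](real_normK (num_real t)).
  move: (pi : R) (pi_gt0 R) => p p0.
  by field; rewrite (gt_eqF c0) (gt_eqF p0).
by rewrite divr_ge0 ?sqr_ge0// mulr_ge0// ltW.
Qed.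

Lemma measurable_expabs (k : R) : measurable_fun setT (fun t : R => expR (k * `|t|)).
Proof.
by apply: measurableT_comp => //; apply: measurable_funM => //; exact: measurableT_comp.
Qed.

Lemma intg_exp_gaussian c k : 0 < c -> intg (fun t => expR (k * `|t|) * gaussian c t).
Proof.
move=> c0; have c20 : 0 < c / 2 by rewrite divr_gt0.
apply: intg_dom (intgZ (expR (k ^+ 2 / (2 * pi * c))) (intg_gaussian c20)) _.
  by apply: measurable_funM; [exact: measurable_expabs|exact: measurable_gaussian].
by move=> t; rewrite ger0_norm ?exp_gaussian_le// mulr_ge0 ?expR_ge0.
Qed.

Lemma intg_abs_gaussian c : 0 < c -> intg (fun t => `|t| * gaussian c t).
Proof.
move=> c0; apply: intg_dom (intg_exp_gaussian 1 c0) _.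
  by apply: measurable_funM; [exact: normr_measurable|exact: measurable_gaussian].
move=> t; rewrite ger0_norm ?mulr_ge0 ?gaussian_ge0// ler_wpM2r ?gaussian_ge0//.
by rewrite mul1r (le_trans _ (expR_ge1Dx _))// lerDr.
Qed.

End Gaussian.

(** * The Fourier transform of a Gaussian *)

Section GaussianFourier.
Variable R : realType.

(** The integrals over [[-n, n]] are increments of [F]. *)
Lemma Rintegral_derive0 (F f : R -> R) : (forall x : R, is_derive x 1 F (f x)) ->
  continuous f -> intg f ->
  F n%:R @[n --> \oo] --> (0 : R) -> F (- n%:R) @[n --> \oo] --> (0 : R) ->
  Rintegral (leb R) setT f = 0.
Proof.
move=> dF cf If Fy FNy.
have cF := continuous_is_derive dF.
pose fn n := f \_ `[(- n.+1%:R), n.+1%:R].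
have Ifn n : (\int[leb R]_x (fn n x)%:E = (F n.+1%:R - F (- n.+1%:R))%:E)%E.
  transitivity (\int[leb R]_(x in `[(- n.+1%:R)%R, n.+1%:R%R]) (f x)%:E)%E.
    rewrite [RHS]integral_mkcond; apply: eq_integral => x _.
    by rewrite /fn !patchE; case: ifP.
  rewrite EFinB.
  apply: (@continuous_FTC2 _ f F).
  - by rewrite gtrN.
  - exact: continuous_subspaceT.
  - split=> [x _||].
    + by have := dF x => -[].
    + by apply: cvg_at_right_filter; exact: cF.
    + by apply: cvg_at_left_filter; exact: cF.
  - by move=> x _; rewrite derive1E; exact: derive_val.
have l1 : (fun n => \int[leb R]_x (fn n x)%:E)%E @ \oo --> (\int[leb R]_x (f x)%:E)%E.
  apply: (@dominated_cvg _ _ _ (leb R) setT _ (fun n x => (fn n x)%:E) (EFin \o f)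
     (fun x => `|f x|%:E)) => //.
  - move=> n; apply/measurable_EFinP; rewrite /fn.
    by apply/measurable_restrict => //; apply: measurable_funTS; exact: intg_meas If.
  - move=> x _; apply: cvg_EFin; first exact: nearW.
    apply: cvg_near_cst; near=> n.
    rewrite /fn/= /patch ifT// inE /= in_itv /= -ler_norml.
    rewrite (@le_trans _ _ n%:R)//; last by rewrite ler_nat.
    by near: n; exact: nbhs_infty_ger.
  - exact: intg_norm.
  - by move=> n x _; rewrite lee_fin /fn patchE; case: ifP => // _; rewrite normr0.
have l2 : (fun n => \int[leb R]_x (fn n x)%:E)%E @ \oo --> 0%E.
  under eq_fun do rewrite Ifn.
  apply: cvg_EFin; first exact: nearW.
  rewrite -[X in _ --> X](subr0 (0 : R)).
  apply: cvgB.
  - by rewrite (cvg_shiftS (fun n => F n%:R)).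
  - by rewrite (cvg_shiftS (fun n => F (- n%:R))).
by rewrite /Rintegral (cvg_unique _ l1 l2).
Unshelve. all: by end_near. Qed.

Lemma gaussian_cvg0 c : 0 < c ->
  gaussian c n%:R @[n --> \oo] --> (0 : R).
Proof.
move=> c0; have pc0 : 0 < pi * c by rewrite mulr_gt0// pi_gt0.
apply: (@squeeze_cvgr _ _ _ _ (cst 0) (fun n => (pi * c)^-1 * n%:R^-1)).
- near=> n; rewrite gaussian_ge0/=.
  have n0 : 0 < n%:R :> R by near: n; exact: nbhs_infty_gtr.
  have q0 : 0 < pi * c * n%:R by rewrite mulr_gt0.
  rewrite /gaussian expRN -invfM lef_pV2 ?posrE ?expR_gt0//.
  rewrite (le_trans _ (expR_ge1Dx _))// (@le_trans _ _ (pi * c * n%:R ^+ 2))//.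
    rewrite ler_pM2l// -natrX ler_nat expnS expn1 leq_pmulr//.
    by rewrite -(ltr_nat R).
  by rewrite lerDr.
- exact: cvg_cst.
- rewrite -[X in _ --> X](mulr0 (pi * c)^-1).
  apply: cvgM; first exact: cvg_cst.
  apply/gtr0_cvgV0; last exact: cvgr_idn.
  by near=> n; near: n; exact: nbhs_infty_gtr.
Unshelve. all: by end_near. Qed.

Section ODE.
Variables (c : R) (th : R).
Hypothesis c0 : 0 < c.

Let k (xi t : R) := gaussian c t * cos (2 * pi * t * xi + th).
Let k1 (xi t : R) := - (2 * pi * t) * gaussian c t * sin (2 * pi * t * xi + th).
Let J xi := Rintegral (leb R) setT (k xi).

Let measurable_trig (f : R -> R) xi : continuous f ->
  measurable_fun setT (fun t : R => f (2 * pi * t * xi + th)).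
Proof.
move=> cf; apply: measurableT_comp; first exact: continuous_measurable_fun.
by apply: measurable_funD => //; apply: measurable_funM => //; apply: measurable_funM.
Qed.

Let Ik xi : intg (k xi).
Proof.
apply: (intgM_bounded (C := 1) (intg_gaussian c0)); last by move=> t; exact: cos_max.
exact: (measurable_trig xi (@continuous_cos R)).
Qed.

Let Ik1 xi : intg (k1 xi).
Proof.
have := intgM_bounded (C := 1) (intgZ (2 * pi) (intg_abs_gaussian c0))
  (measurable_trig xi (@continuous_sin R)) (fun=> sin_max _).
move=> /intg_norm Ih; apply: (intg_dom _ Ih).
  apply: measurable_funM; last exact: (measurable_trig xi (@continuous_sin R)).
  apply: measurable_funM; last exact: measurable_gaussian.
  by apply: measurableT_comp => //; apply: measurable_funM.
move=> t; rewrite /k1 !normrM normrN !normrM !normr_id.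
by rewrite !mulrA.
Qed.

Let dk (xi t : R) : is_derive xi 1 (k ^~ t) (k1 xi t).
Proof.
have := is_derive_cos_affine (2 * pi * t) th xi => h.
have -> : k ^~ t = gaussian c t \*: (fun xi => cos (2 * pi * t * xi + th)) by [].
by apply: is_derive_eq; rewrite /GRing.scale /= /k1; ring.
Qed.

Let dJ (xi : R) : is_derive xi 1 J (Rintegral (leb R) setT (k1 xi)).
Proof.
have d1E x t : partial1of2 k x t = k1 x t.
  by rewrite partial1of2E; exact: derive_val.
pose G t : R := 2 * pi * (`|t| * gaussian c t).
have G0 t : 0 <= G t by rewrite /G !mulr_ge0 ?pi_ge0// gaussian_ge0.
have IG : intg G by exact: intgZ (intg_abs_gaussian c0).
have Gub x t : `|partial1of2 k x t| <= G t.
  rewrite d1E /k1 !normrM normrN !normrM (ger0_norm (pi_ge0 R)) ger0_norm//.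
  rewrite (ger0_norm (gaussian_ge0 _ _)) /G !mulrA.
  by rewrite ler_piMr ?sin_max// !mulr_ge0 ?pi_ge0// gaussian_ge0.
have Ixi : (`](xi - 1), (xi + 1)[%classic : set R) xi.
  by rewrite /= in_itv /= ltrBlDr !ltrDl ltr01.
have dk' x t : derivable (k ^~ t) x 1 by have := dk x t => -[].
apply: DeriveDef.
- apply: (@derivable_under_integral _ _ _ (leb R) k setT measurableT xi (xi - 1) (xi + 1) Ixi _ _ G) => //.
  by move=> x _; exact: Ik.
- transitivity ((J^`())%classic xi); first by rewrite derive1E.
  rewrite (@differentiation_under_integral _ _ _ (leb R) k setT measurableT xi (xi - 1) (xi + 1) Ixi _ _ G)//; last by move=> x _; exact: Ik.
  by apply: eq_Rintegral => t _; exact: d1E.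
Qed.

(** Integrating the derivative in [t] of [gaussian c t * sin (2 * pi * t * xi + th)]
    turns the formula for the derivative of [J] into the differential equation
    [c * J' = - 2 * pi * xi * J], which [gaussian c^-1] also satisfies. *)
Let JE xi : c * Rintegral (leb R) setT (k1 xi) = - (2 * pi * xi) * J xi.
Proof.
pose F t : R := gaussian c t * sin (2 * pi * t * xi + th).
pose f t : R := c * k1 xi t + 2 * pi * xi * k xi t.
have dF (t : R) : is_derive t 1 F (f t).
  have h1 := is_derive_gaussian c t.
  have h2 := is_derive_sin_affine (2 * pi * xi) th t.
  have -> : F = gaussian c * (fun t => sin (2 * pi * xi * t + th)).
    by apply/funext => u; rewrite /F fctE mulrAC.
  by apply: is_derive_eq; rewrite /GRing.scale /= /f /k1 /k [2 * pi * xi * t]mulrAC; ring.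
have If : intg f by apply: intgD; exact: intgZ.
have cf : continuous f.
  move=> t; rewrite /f /k1 /k.
  have cA : {for t, continuous (fun t : R => 2 * pi * t * xi + th)}.
    apply: cvgD; last exact: cvg_cst.
    apply: cvgM; last exact: cvg_cst.
    by apply: cvgM; [exact: cvg_cst|exact: cvg_id].
  have cg := @continuous_gaussian R c t.
  have cs : {for t, continuous (fun t : R => sin (2 * pi * t * xi + th))}.
    by apply: continuous_comp => //; exact: continuous_sin.
  have cc : {for t, continuous (fun t : R => cos (2 * pi * t * xi + th))}.
    by apply: continuous_comp => //; exact: continuous_cos.
  apply: cvgD; (apply: cvgM; first exact: cvg_cst).
  - apply: cvgM; last exact: cs.
    apply: cvgM; last exact: cg.
    apply: cvgN; apply: cvgM; first exact: cvg_cst.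
    exact: cvg_id.
  - apply: cvgM; [exact: cg|exact: cc].
have lim0 (u : nat -> R) : (forall n, gaussian c (u n) = gaussian c n%:R) ->
    F (u n) @[n --> \oo] --> (0 : R).
  move=> ug; apply: norm_cvg0.
  apply: (@squeeze_cvgr _ _ _ _ (cst 0) (fun n => gaussian c n%:R)).
  - near=> n; rewrite normr_ge0/= /F ug normrM (ger0_norm (gaussian_ge0 _ _)).
    by rewrite ler_piMr ?sin_max// gaussian_ge0.
  - exact: cvg_cst.
  - exact: gaussian_cvg0.
have := Rintegral_derive0 dF cf If (lim0 (fun n => n%:R) (fun=> erefl))
  (lim0 (fun n => - n%:R) (fun=> gaussianN _ _)).
rewrite /f RintegralD//; last 2 first.
- exact: intgZ.
- exact: intgZ.
rewrite !RintegralZl//; [|exact: Ik|exact: Ik1].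
by move=> /eqP; rewrite addr_eq0 => /eqP ->; rewrite mulNr.
Unshelve. all: by end_near. Qed.

(** The phase [th] covers the real part ([th = 0]) and the imaginary part
    ([th = pi / 2]) of the transform in one computation. *)
Lemma gaussian_cos_integral xi :
  Rintegral (leb R) setT (fun t => gaussian c t * cos (2 * pi * t * xi + th)) =
  cos th * (Num.sqrt c)^-1 * gaussian c^-1 xi.
Proof.
have c0' := gt_eqF c0.
pose Q x : R := J x * gaussian (- c^-1) x.
have dQ (x : R) : is_derive x 1 Q 0.
  have h1 := dJ x; have h2 := is_derive_gaussian (- c^-1) x.
  have -> : Q = J * gaussian (- c^-1) by [].
  apply: is_derive_eq; rewrite /GRing.scale /=.
  have -> : Rintegral (leb R) setT (k1 x) = c^-1 * (- (2 * pi * x) * J x).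
    by rewrite -JE mulrA mulVf ?c0'// mul1r.
  ring.
have Q0 : Q xi = Q 0 by apply: is_derive_0_is_cst.
have J0 : J 0 = cos th * (Num.sqrt c)^-1.
  rewrite /J /k; under eq_Rintegral do rewrite mulr0 add0r mulrC.
  rewrite RintegralZl//; last exact: intg_gaussian.
  by congr (_ * _); rewrite /Rintegral integral_gaussian.
have : J xi = Q xi * gaussian c^-1 xi.
  rewrite /Q -mulrA /gaussian -expRD (_ : _ + _ = 0) ?expR0 ?mulr1//; ring.
by rewrite Q0 /Q gaussian0 mulr1 J0.
Qed.

End ODE.

Lemma fourierE (f : R -> R[i]) (xi : R) :
  fourier f xi = Cintegral (fun x => f x * expi (- (2 * pi * x * xi))).
Proof. by []. Qed.

Lemma fourier_gaussian (c xi : R) : 0 < c ->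
  fourier (fun t => (gaussian c t)%:C) xi =
  ((Num.sqrt c)^-1 * gaussian c^-1 xi)%:C.
Proof.
move=> c0; apply: complexP.
- transitivity (Rintegral (leb R) setT
    (fun t => gaussian c t * cos (2 * pi * t * xi + 0))).
    by apply: eq_Rintegral => t _; rewrite CReM /= mul0r subr0 addr0 cosN.
  by rewrite gaussian_cos_integral// cos0 mul1r.
- transitivity (Rintegral (leb R) setT
    (fun t => gaussian c t * cos (2 * pi * t * xi + pi / 2))).
    by apply: eq_Rintegral => t _; rewrite CImM /= mul0r addr0 sinN cosDpihalf.
  by rewrite gaussian_cos_integral// cos_pihalf !mul0r.
Qed.

End GaussianFourier.

(** * The Fourier transform of an integrable function *)

Section FourierBasics.
Variable R : realType.
Implicit Types f g w : R -> R[i].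

Lemma measurable_phase (xi : R) : measurable_fun setT (fun x : R => - (2 * pi * x * xi)).
Proof.
by apply: measurableT_comp => //; apply: measurable_funM => //; apply: measurable_funM.
Qed.

Lemma Cintg_phase f (u : R -> R) : Cintg f -> measurable_fun setT u ->
  Cintg (fun x => f x * expi (u x)).
Proof.
move=> If mu; apply: (CintgM_bounded (C := 1) If); first exact: Cmeas_expi.
by move=> x; rewrite normc_expi.
Qed.

Lemma fourier_Cintg f xi : Cintg f ->
  Cintg (fun x => f x * expi (- (2 * pi * x * xi))).
Proof. by move=> If; apply: Cintg_phase => //; exact: measurable_phase. Qed.

Lemma normc_fourier f xi : Cintg f ->
  normc (fourier f xi) <= Rintegral (leb R) setT (fun x => normc (f x)).
Proof.
move=> If; apply: le_trans (normc_Cintegral (fourier_Cintg xi If)) _.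
rewrite le_eqVlt; apply/orP; left; apply/eqP.
by apply: eq_Rintegral => x _; rewrite ComplexField.Normc.normcM normc_expi mulr1.
Qed.

Lemma continuous_Rintegral_param (k : R -> R -> R) (G : R -> R) :
  (forall xi, measurable_fun setT (k xi)) -> intg G ->
  (forall xi x, `|k xi x| <= G x) -> (forall x, continuous (k ^~ x)) ->
  continuous (fun xi => Rintegral (leb R) setT (k xi)).
Proof.
move=> mk IG kG ck xi.
have Ixi : (`](xi - 1), (xi + 1)[%classic : set R) xi.
  by rewrite /= in_itv /= ltrBlDr !ltrDl ltr01.
have := @continuity_under_integral R _ _ (leb R) k setT measurableT (xi - 1) (xi + 1) _ _ G IG.
apply.
- by move=> x _; exact: intg_dom (mk x) IG (kG x).
- by apply/aeW => y _ x _; exact: ck.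
- by move=> x _; apply/aeW => y _; exact: kG.
- exact/mem_set.
Qed.

Lemma continuous_phase (f : R -> R) (x : R) : continuous f ->
  continuous (fun xi : R => f (- (2 * pi * x * xi))).
Proof.
move=> cf xi; apply: continuous_comp; last exact: cf.
by apply: cvgN; apply: cvgM; [exact: cvg_cst|exact: cvg_id].
Qed.

Lemma continuous_fourier_Re f : Cintg f -> continuous (fun xi => Re (fourier f xi)).
Proof.
move=> If; apply: (continuous_Rintegral_param (k := fun xi x =>
  Re (f x * expi (- (2 * pi * x * xi)))) (G := fun x => normc (f x))).
- by move=> xi; have [/intg_meas] := fourier_Cintg xi If.
- exact: Cintg_normc.
- move=> xi x; apply: le_trans (Re_le_normc _) _.
  by rewrite ComplexField.Normc.normcM normc_expi mulr1.
- move=> x xi; under eq_fun do rewrite CReM.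
  by apply: cvgB; (apply: cvgM; first exact: cvg_cst);
    apply: continuous_phase; [exact: continuous_cos|exact: continuous_sin].
Qed.

Lemma continuous_fourier_Im f : Cintg f -> continuous (fun xi => Im (fourier f xi)).
Proof.
move=> If; apply: (continuous_Rintegral_param (k := fun xi x =>
  Im (f x * expi (- (2 * pi * x * xi)))) (G := fun x => normc (f x))).
- by move=> xi; have [_ /intg_meas] := fourier_Cintg xi If.
- exact: Cintg_normc.
- move=> xi x; apply: le_trans (Im_le_normc _) _.
  by rewrite ComplexField.Normc.normcM normc_expi mulr1.
- move=> x xi; under eq_fun do rewrite CImM.
  by apply: cvgD; (apply: cvgM; first exact: cvg_cst);
    apply: continuous_phase; [exact: continuous_sin|exact: continuous_cos].
Qed.

Lemma Cmeas_fourier f : Cintg f -> Cmeasurable (fourier f).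
Proof.
move=> If; split; apply: continuous_measurable_fun.
- exact: continuous_fourier_Re.
- exact: continuous_fourier_Im.
Qed.

Lemma measurable_fst_comp (u : R -> R) : measurable_fun setT u ->
  measurable_fun setT (fun p : R * R => u p.1).
Proof. by move=> mu; apply: measurableT_comp. Qed.

Lemma measurable_snd_comp (u : R -> R) : measurable_fun setT u ->
  measurable_fun setT (fun p : R * R => u p.2).
Proof. by move=> mu; apply: measurableT_comp. Qed.

(** The kernel exp (-2 i pi x xi) is symmetric in its two variables, so this is
    Fubini's theorem. *)
Lemma fourier_multiplication g w : Cintg g -> Cintg w ->
  Cintegral (fun xi => fourier g xi * w xi) =
  Cintegral (fun x => g x * fourier w x).
Proof.
move=> Ig Iw.
pose K xi x := w xi * (g x * expi (- (2 * pi * x * xi))).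
have [gr gi] := Cintg_meas Ig; have [wr wi] := Cintg_meas Iw.
have mph : measurable_fun setT (fun p : R * R => - (2 * pi * p.2 * p.1)).
  apply: measurableT_comp => //; apply: measurable_funM; last exact: measurable_fst.
  by apply: measurable_funM => //; exact: measurable_snd.
have mc : measurable_fun setT (fun p : R * R => cos (- (2 * pi * p.2 * p.1))).
  by apply: measurableT_comp mph; apply: continuous_measurable_fun; exact: continuous_cos.
have ms : measurable_fun setT (fun p : R * R => sin (- (2 * pi * p.2 * p.1))).
  by apply: measurableT_comp mph; apply: continuous_measurable_fun; exact: continuous_sin.
have wr1 := measurable_fst_comp wr; have wi1 := measurable_fst_comp wi.
have gr2 := measurable_snd_comp gr; have gi2 := measurable_snd_comp gi.
have mr : measurable_fun setT (fun p : R * R => Re (K p.1 p.2)).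
  rewrite /K; under eq_fun do rewrite CReM CReM CImM.
  apply: measurable_funB; apply: measurable_funM => //.
  - by apply: measurable_funB; exact: measurable_funM.
  - by apply: measurable_funD; exact: measurable_funM.
have mi : measurable_fun setT (fun p : R * R => Im (K p.1 p.2)).
  rewrite /K; under eq_fun do rewrite CImM CReM CImM.
  apply: measurable_funD; apply: measurable_funM => //.
  - by apply: measurable_funD; exact: measurable_funM.
  - by apply: measurable_funB; exact: measurable_funM.
have KGH xi x : normc (K xi x) <= normc (w xi) * normc (g x).
  by rewrite /K !ComplexField.Normc.normcM normc_expi mulr1.
have -> : (fun xi => fourier g xi * w xi) = (fun xi => Cintegral (K xi)).
  by apply/funext => xi; rewrite mulrC -CintegralZ//; exact: fourier_Cintg.
rewrite (CFubini mr mi (Cintg_normc Iw) (Cintg_normc Ig) KGH).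
congr Cintegral; apply/funext => x.
rewrite -CintegralZ; last exact: fourier_Cintg.
by apply: eq_Cintegral => xi; rewrite /K mulrCA [in RHS]mulrAC mulrA [2 * pi * x * xi]mulrAC.
Qed.

Lemma fourier_translate_modulate g (a b y : R) : Cintg g ->
  fourier (fun t => g (t - a) * expi (2 * pi * t * b)) y =
  expi (- (2 * pi * a * (y - b))) * fourier g (y - b).
Proof.
move=> Ig; rewrite !fourierE -CintegralZ; last exact: fourier_Cintg.
rewrite -[RHS](@Cintegral_shift _ (- a)); last exact/CintgZ/fourier_Cintg.
apply: eq_Cintegral => t; rewrite -mulrA -expiD mulrCA -expiD.
by congr (_ * expi _); ring.
Qed.

Lemma Cintg_real (u : R -> R) : intg u -> Cintg (fun x => (u x)%:C).
Proof.
move=> Iu; apply: (Cintg_dom _ (intg_norm Iu)) => [|x].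
  exact: Cmeas_real (intg_meas Iu).
by rewrite normc_real.
Qed.

End FourierBasics.

Section Heat.
Variable R : realType.

(** The Gauss kernel of mass one, which is the transform of [gaussian c]. *)
Definition heat (c t : R) := (Num.sqrt c)^-1 * gaussian c^-1 t.

Lemma heat_ge0 c t : 0 <= heat c t.
Proof. by rewrite mulr_ge0 ?gaussian_ge0// invr_ge0 sqrtr_ge0. Qed.

Lemma measurable_heat c : measurable_fun setT (heat c).
Proof. by apply: measurable_funM => //; exact: measurable_gaussian. Qed.

Lemma heatN c t : heat c (- t) = heat c t.
Proof. by rewrite /heat gaussianN. Qed.

Lemma integral_heat c : 0 < c -> (\int[leb R]_t (heat c t)%:E = 1)%E.
Proof.
move=> c0; rewrite /heat; under eq_integral do rewrite EFinM.
rewrite ge0_integralZl//; last 2 first.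
- by apply/measurable_EFinP; exact: measurable_gaussian.
- by move=> t _; rewrite lee_fin gaussian_ge0.
rewrite integral_gaussian ?invr_gt0// -EFinM sqrtrV ?ltW// invrK mulVf//.
by rewrite gt_eqF// sqrtr_gt0.
Qed.

Lemma intg_heat c : 0 < c -> intg (heat c).
Proof. by move=> c0; apply: intgZ; apply: intg_gaussian; rewrite invr_gt0. Qed.

Lemma integral_heat_shift c x : 0 < c -> (\int[leb R]_y (heat c (y - x))%:E = 1)%E.
Proof.
move=> c0; rewrite -[RHS](integral_heat c0).
apply: (@ge0_integral_shift _ (- x) (fun y => (heat c y)%:E)).
- by apply/measurable_EFinP; exact: measurable_heat.
- by move=> y; rewrite lee_fin heat_ge0.
Qed.

Lemma measurable_heat_diff c :
  measurable_fun setT (fun p : R * R => heat c (p.2 - p.1)).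
Proof.
apply: measurableT_comp; first exact: measurable_heat.
by apply: measurable_funB; [exact: measurable_snd|exact: measurable_fst].
Qed.

(** Gaussian summability: inserting a Gaussian factor in the inversion integral
    amounts to mollifying the original function. *)
Lemma gauss_inversion (g : R -> R[i]) (c x : R) : 0 < c -> Cintg g ->
  Cintegral (fun xi => fourier g xi * ((gaussian c xi)%:C * expi (2 * pi * xi * x))) =
  Cintegral (fun y => g y * (heat c (y - x))%:C).
Proof.
move=> c0 Ig.
have Igs : Cintg (fun t => (gaussian c t)%:C).
  exact: Cintg_real (intg_gaussian c0).
rewrite fourier_multiplication//; last first.
  apply: Cintg_phase => //.
  by apply: measurable_funM => //; apply: measurable_funM.
congr Cintegral; apply/funext => y; congr (_ * _).
have := @fourier_translate_modulate _ _ 0 x y Igs.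
rewrite mulr0 mul0r oppr0 expi0 mul1r fourier_gaussian// => E.
apply: etrans E; congr (fourier _ y); apply/funext => t.
by rewrite addr0.
Qed.

End Heat.

(** * Bessel's inequality *)

Section Bessel.
Variable R : realType.
Implicit Types g : R -> R[i].

Lemma gaussian_le1 (c t : R) : 0 <= c -> gaussian c t <= 1.
Proof.
move=> c0; rewrite /gaussian -expR0 ler_expR oppr_le0.
exact: mulr_ge0 (mulr_ge0 (pi_ge0 _) c0) (sqr_ge0 _).
Qed.

Lemma heat_le (c t : R) : 0 < c -> heat c t <= (Num.sqrt c)^-1.
Proof.
by move=> c0; rewrite /heat ler_piMr ?invr_ge0 ?sqrtr_ge0// gaussian_le1// invr_ge0 ltW.
Qed.

(** Schur's test: [u x * u y] is at most the mean of the two squares, and the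
    kernel has mass one in each variable. *)
Lemma schur_heat (u : R -> R) (c : R) : 0 < c -> measurable_fun setT u ->
  (forall x, 0 <= u x) ->
  (\int[leb R]_x \int[leb R]_y (u x * u y * heat c (y - x))%:E <=
   \int[leb R]_x (u x ^+ 2)%:E)%E.
Proof.
move=> c0 mu u0.
pose k (p : R * R) := heat c (p.2 - p.1).
have mk : measurable_fun setT k by exact: measurable_heat_diff.
have k0 p : 0 <= k p by exact: heat_ge0.
have mx : measurable_fun setT (fun p : R * R => u p.1 ^+ 2 * k p).
  by apply: measurable_funM => //; apply: measurable_funX; exact: measurable_fst_comp.
have my : measurable_fun setT (fun p : R * R => u p.2 ^+ 2 * k p).
  by apply: measurable_funM => //; apply: measurable_funX; exact: measurable_snd_comp.
have Ix : (\int[leb R]_x \int[leb R]_y (u x ^+ 2 * k (x, y))%:E =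
   \int[leb R]_x (u x ^+ 2)%:E)%E.
  apply: eq_integral => x _; under eq_integral do rewrite EFinM.
  rewrite ge0_integralZl ?lee_fin ?sqr_ge0//; last 2 first.
  - by apply/measurable_EFinP; exact: (measurable_slice x mk).
  - by move=> y _; rewrite lee_fin.
  by rewrite [X in (_ * X)%E]integral_heat_shift// mule1.
have Iy : (\int[leb R]_x \int[leb R]_y (u y ^+ 2 * k (x, y))%:E =
   \int[leb R]_x (u x ^+ 2)%:E)%E.
  rewrite (tonelli my) => [|p]; last by rewrite mulr_ge0 ?sqr_ge0.
  apply: eq_integral => y _ /=; under eq_integral do rewrite EFinM.
  rewrite ge0_integralZl ?lee_fin ?sqr_ge0//; last 2 first.
  - by apply/measurable_EFinP; exact: (measurable_slice_l y mk).
  - by move=> x _; rewrite lee_fin.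
  rewrite [X in (_ * X)%E](_ : _ = 1)%E ?mule1// -[RHS](integral_heat_shift y c0).
  by apply: eq_integral => x _; rewrite /k /= -heatN opprB.
apply: (@le_trans _ _ (\int[leb R]_x \int[leb R]_y
  (2^-1 * (u x ^+ 2 * k (x, y) + u y ^+ 2 * k (x, y)))%:E)%E).
  apply: ge0_le_integral => //.
  - by move=> x _; apply: integral_ge0 => y _; rewrite lee_fin (mulr_ge0 (mulr_ge0 (u0 _) (u0 _)) (heat_ge0 _ _)).
  - apply: (@measurable_tonelli _ (fun p => u p.1 * u p.2 * k p)).
    + apply: measurable_funM => //; apply: measurable_funM.
        exact: measurable_fst_comp.
      exact: measurable_snd_comp.
    + by move=> p; rewrite (mulr_ge0 (mulr_ge0 (u0 _) (u0 _)) (k0 _)).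
  - apply: (@measurable_tonelli _ (fun p => 2^-1 * (u p.1 ^+ 2 * k p + u p.2 ^+ 2 * k p))).
    + by apply: measurable_funM => //; apply: measurable_funD.
    + by move=> p; rewrite mulr_ge0 ?invr_ge0// addr_ge0// mulr_ge0 ?sqr_ge0.
  move=> x _; apply: ge0_le_integral => //.
  - by move=> y _; rewrite lee_fin (mulr_ge0 (mulr_ge0 (u0 _) (u0 _)) (heat_ge0 _ _)).
  - apply/measurable_EFinP; apply: measurable_funM; first by apply: measurable_funM.
    exact: (measurable_slice x mk).
  - apply/measurable_EFinP; apply: measurable_funM => //; apply: measurable_funD.
      exact: (measurable_slice x mx).
    exact: (measurable_slice x my).
  - move=> y _; rewrite lee_fin -mulrDl [leRHS]mulrA ler_wpM2r ?heat_ge0//.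
    by rewrite -subr_ge0; have := sqr_ge0 (u x - u y); nra.
have E x : (\int[leb R]_y (2^-1 * (u x ^+ 2 * k (x, y) + u y ^+ 2 * k (x, y)))%:E =
  2^-1%:E * (\int[leb R]_y (u x ^+ 2 * k (x, y))%:E + \int[leb R]_y (u y ^+ 2 * k (x, y))%:E))%E.
  under eq_integral do rewrite EFinM EFinD.
  rewrite ge0_integralZl//; last 2 first.
  - by apply: emeasurable_funD; apply/measurable_EFinP;
      [exact: (measurable_slice x mx)|exact: (measurable_slice x my)].
  - by move=> y _; rewrite -EFinD lee_fin addr_ge0// mulr_ge0// sqr_ge0.
  rewrite ge0_integralD//.
  - by move=> y _; rewrite lee_fin mulr_ge0// sqr_ge0.
  - by apply/measurable_EFinP; exact: (measurable_slice x mx).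
  - by move=> y _; rewrite lee_fin mulr_ge0// sqr_ge0.
  - by apply/measurable_EFinP; exact: (measurable_slice x my).
under eq_integral do rewrite E.
have mX := measurable_tonelli mx (fun p => mulr_ge0 (sqr_ge0 _) (k0 p)).
have mY := measurable_tonelli my (fun p => mulr_ge0 (sqr_ge0 _) (k0 p)).
have X0 x : (0 <= \int[leb R]_y (u x ^+ 2 * k (x, y))%:E)%E.
  by apply: integral_ge0 => y _; rewrite lee_fin mulr_ge0// sqr_ge0.
have Y0 x : (0 <= \int[leb R]_y (u y ^+ 2 * k (x, y))%:E)%E.
  by apply: integral_ge0 => y _; rewrite lee_fin mulr_ge0// sqr_ge0.
rewrite ge0_integralZl//; last 2 first.
- exact: emeasurable_funD.
- by move=> x _; rewrite adde_ge0.
rewrite ge0_integralD// Ix Iy -mule2n -mule_natl muleA -EFinM.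
by rewrite mulVf// mul1e.
Qed.

(** With [w := gaussian c * conjc (fourier g)], the left-hand side is the integral
    of [g * fourier w], and [gauss_inversion] says that [fourier w] is the conjugate
    of [g] mollified by [heat c]; so the bound is an instance of Schur's test. *)
Lemma bessel_gauss g (c : R) : 0 < c -> Cintg g ->
  (\int[leb R]_xi (abs2 (fourier g xi) * gaussian c xi)%:E <=
   \int[leb R]_x (abs2 (g x))%:E)%E.
Proof.
move=> c0 Ig; have mg := Cintg_meas Ig; have mgh := Cmeas_fourier Ig.
pose M := Rintegral (leb R) setT (fun x => normc (g x)).
have Igs := Cintg_real (intg_gaussian c0).
pose w xi := (gaussian c xi)%:C * conjc (fourier g xi).
have Iw : Cintg w.
  apply: (CintgM_bounded (C := M) Igs); first exact: CmeasJ.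
  by move=> xi; rewrite Cnormc_conj; exact: normc_fourier.
have Igw : Cintg (fun xi => fourier g xi * w xi).
  under eq_fun do rewrite mulrC.
  apply: (CintgM_bounded (C := M) Iw) => // xi; exact: normc_fourier.
have fw x : normc (fourier w x) <=
    Rintegral (leb R) setT (fun y => normc (g y) * heat c (y - x)).
  have -> : fourier w x = conjc (Cintegral (fun y => g y * (heat c (y - x))%:C)).
    rewrite -gauss_inversion// -CintegralJ; last first.
      have Iph : Cintg (fun xi => (gaussian c xi)%:C * expi (2 * pi * xi * x)).
        apply: Cintg_phase => //.
        by apply: measurable_funM => //; apply: measurable_funM.
      rewrite (_ : (fun=> _) = (fun xi => (gaussian c xi)%:C * expi (2 * pi * xi * x) *
        fourier g xi)); last by apply/funext => xi; rewrite mulrC.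
      exact: CintgM_bounded Iph mgh (fun xi => normc_fourier xi Ig).
    apply: eq_Cintegral => xi; rewrite !Cconj_mul expiJ /w.
    have -> : conjc (gaussian c xi)%:C = (gaussian c xi)%:C :> R[i].
      by apply: complexP => //=; rewrite oppr0.
    by rewrite mulrCA mulrA.
  rewrite Cnormc_conj; apply: le_trans (normc_Cintegral _) _.
    apply: (CintgM_bounded (C := (Num.sqrt c)^-1) Ig).
      apply: Cmeas_real; apply: measurableT_comp; first exact: measurable_heat.
      exact: measurable_funB.
    by move=> y; rewrite normc_real ger0_norm ?heat_ge0// heat_le.
  rewrite le_eqVlt; apply/orP; left; apply/eqP; apply: eq_Rintegral => y _.
  by rewrite ComplexField.Normc.normcM normc_real (ger0_norm (heat_ge0 _ _)).
have Igh x : intg (fun y => normc (g y) * heat c (y - x)).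
  apply: (intgM_bounded (C := (Num.sqrt c)^-1) (Cintg_normc Ig)).
    by apply: measurableT_comp; [exact: measurable_heat|exact: measurable_funB].
  by move=> y; rewrite ger0_norm ?heat_ge0// heat_le.
have E xi : abs2 (fourier g xi) * gaussian c xi = Re (fourier g xi * w xi).
  by rewrite /w mulrCA mulcJ CReM /= mul0r subr0 mulrC.
under eq_integral do rewrite E.
rewrite -(intg_integralE (proj1 Igw)).
have -> : Rintegral (leb R) setT (fun xi => Re (fourier g xi * w xi)) =
   Re (Cintegral (fun x => g x * fourier w x)) by rewrite -fourier_multiplication.
have Mw : exists C, forall x, normc (fourier w x) <= C.
  by exists (Rintegral (leb R) setT (fun x => normc (w x))) => x; exact: normc_fourier.
have [Cw HCw] := Mw.
have Igfw : Cintg (fun x => g x * fourier w x).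
  by apply: (CintgM_bounded (C := Cw) Ig) => //; exact: Cmeas_fourier.
apply: (@le_trans _ _ (Rintegral (leb R) setT (fun x => normc (g x * fourier w x)))%:E).
  rewrite lee_fin; apply: le_trans (ler_norm _) _.
  by apply: le_trans (Re_le_normc _) _; exact: normc_Cintegral.
rewrite (intg_integralE (Cintg_normc Igfw)).
apply: le_trans (schur_heat c0 (Cmeas_normc mg) (fun x => normc_ge0 (g x))).
apply: ge0_le_integral => //.
- by move=> x _; rewrite lee_fin normc_ge0.
- by apply/measurable_EFinP; exact: Cmeas_normc (Cintg_meas Igfw).
- apply: (@measurable_tonelli _ (fun p => normc (g p.1) * normc (g p.2) * heat c (p.2 - p.1))).
  + apply: measurable_funM; last exact: measurable_heat_diff.
    apply: measurable_funM.
      exact: (measurable_fst_comp (Cmeas_normc mg)).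
    exact: (measurable_snd_comp (Cmeas_normc mg)).
  + by move=> p; rewrite (mulr_ge0 (mulr_ge0 (normc_ge0 _) (normc_ge0 _)) (heat_ge0 _ _)).
- move=> x _; rewrite ComplexField.Normc.normcM EFinM.
  apply: (@le_trans _ _ ((normc (g x))%:E * \int[leb R]_y (normc (g y) * heat c (y - x))%:E)%E).
    by rewrite -(intg_integralE (Igh x)) -EFinM lee_fin ler_wpM2l ?normc_ge0.
  rewrite -ge0_integralZl//; last 3 first.
  - by apply/measurable_EFinP; exact: intg_meas (Igh x).
  - by move=> y _; rewrite lee_fin (mulr_ge0 (normc_ge0 _) (heat_ge0 _ _)).
  - by rewrite lee_fin normc_ge0.
  by under eq_integral do rewrite -EFinM mulrA.
Qed.

Lemma gaussian_cvg1 (xi : R) : gaussian n.+1%:R^-1 xi @[n --> \oo] --> (1 : R).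
Proof.
have L0 : - (pi * n.+1%:R^-1 * xi ^+ 2) @[n --> \oo] --> (0 : R).
  rewrite -[X in _ --> X](_ : - (pi * 0 * xi ^+ 2) = 0); last first.
    by rewrite mulr0 mul0r oppr0.
  apply: cvgN; apply: cvgM; last exact: cvg_cst.
  by apply: cvgM; [exact: cvg_cst|exact: cvg_harmonic].
by rewrite -[X in _ --> X]expR0; apply: continuous_cvg L0; exact: continuous_expR.
Qed.

(** Half of Plancherel's identity, by monotone convergence as the Gaussian factor
    increases to one. *)
Theorem bessel g : Cintg g ->
  (\int[leb R]_xi (abs2 (fourier g xi))%:E <= \int[leb R]_x (abs2 (g x))%:E)%E.
Proof.
move=> Ig; have mgh := Cmeas_fourier Ig.
pose F n xi := (abs2 (fourier g xi) * gaussian n.+1%:R^-1 xi)%:E.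
have mF n : measurable_fun setT (F n).
  apply/measurable_EFinP; apply: measurable_funM; first exact: Cmeas_abs2.
  exact: measurable_gaussian.
have H : (\int[leb R]_xi F n xi @[n --> \oo] --> \int[leb R]_xi (abs2 (fourier g xi))%:E)%E.
  have L xi : F n xi @[n --> \oo] --> (abs2 (fourier g xi))%:E.
    apply: cvg_EFin; first exact: nearW.
    rewrite -[X in _ --> X]mulr1; apply: cvgM; first exact: cvg_cst.
    exact: gaussian_cvg1.
  have -> : (fun xi => (abs2 (fourier g xi))%:E) = (fun xi => limn (F ^~ xi)).
    by apply/funext => xi; apply/esym/cvg_lim.
  apply: cvg_monotone_convergence => //.
  - by move=> n xi _; rewrite lee_fin mulr_ge0 ?abs2_ge0 ?gaussian_ge0.
  - move=> xi _ m n mn; rewrite lee_fin ler_wpM2l ?abs2_ge0// ler_expR lerN2.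
    rewrite ler_wpM2r ?sqr_ge0// ler_wpM2l ?pi_ge0//.
    by rewrite lef_pV2 ?posrE// ler_nat.
apply: (cvge_le _ H).
by apply: nearW => n; apply: bessel_gauss.
Qed.

End Bessel.

(** * Fourier inversion *)

Section Inversion.
Variable R : realType.

Lemma Rintegral_heat_shift (c x : R) : 0 < c ->
  Rintegral (leb R) setT (fun y => heat c (y - x)) = 1.
Proof. by move=> c0; rewrite /Rintegral integral_heat_shift. Qed.

Lemma intg_heat_shift (c x : R) : 0 < c -> intg (fun y => heat c (y - x)).
Proof. by move=> c0; exact: (intg_shift (- x) (intg_heat c0)). Qed.

Lemma measurable_heat_shift (c x : R) : measurable_fun setT (fun y : R => heat c (y - x)).
Proof.
by apply: measurableT_comp; [exact: measurable_heat|exact: measurable_funB].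
Qed.

(** Splitting the Gaussian exponent in two halves: away from the origin one half
    gives the small factor, the other one a heat kernel for the double time. *)
Lemma heat_tail (c r t : R) : 0 < c -> 0 < r -> r <= `|t| ->
  heat c t <= 2 * Num.sqrt 2 * c / (pi * r ^+ 2) * heat (2 * c) t.
Proof.
move=> c0 r0 rt; have p0 := pi_gt0 R.
have r2t : r ^+ 2 <= t ^+ 2.
  rewrite -[t ^+ 2](real_normK (num_real t)) ler_pXn2r// nnegrE.
  exact: ltW.
pose z := pi * (2 * c)^-1 * t ^+ 2.
have z0 : 0 < z.
  have t20 : 0 < t ^+ 2 by exact: lt_le_trans (exprn_gt0 2 r0) r2t.
  have c1 : 0 < (2 * c)^-1 by rewrite invr_gt0 mulr_gt0.
  exact: mulr_gt0 (mulr_gt0 p0 c1) t20.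
have E1 : gaussian c^-1 t = expR (- z) * gaussian (2 * c)^-1 t.
  rewrite /gaussian -expRD /z; congr expR.
  by move: (pi : R) => p; field; rewrite (gt_eqF c0).
have E2 : expR (- z) <= 2 * c / (pi * r ^+ 2).
  rewrite expRN -[leRHS]invrK lef_pV2 ?posrE ?expR_gt0//; last first.
    by rewrite invr_gt0 divr_gt0 ?mulr_gt0 ?exprn_gt0.
  rewrite (le_trans _ (expR_ge1Dx _))// ler_wpDl// invf_div /z.
  rewrite [leRHS]mulrAC ler_wpM2r//; last by rewrite ler_pM2l.
  by rewrite invr_ge0 mulr_ge0// ltW.
have s20 : Num.sqrt (2 : R) != 0 by rewrite gt_eqF// sqrtr_gt0.
have E3 : (Num.sqrt c)^-1 = Num.sqrt 2 * (Num.sqrt (2 * c))^-1.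
  by rewrite sqrtrM// invfM mulrA mulfV// mul1r.
rewrite /heat E1 E3.
have := gaussian_ge0 (2 * c)^-1 t; set G := gaussian _ _ => G0.
have : 0 <= (Num.sqrt (2 * c))^-1 by rewrite invr_ge0 sqrtr_ge0.
move: (_^-1) => w w0.
have -> : 2 * Num.sqrt 2 * c / (pi * r ^+ 2) * (w * G) =
  Num.sqrt 2 * w * (2 * c / (pi * r ^+ 2) * G) by ring.
by rewrite ler_wpM2l ?mulr_ge0 ?sqrtr_ge0// ler_wpM2r.
Qed.

(** The ball of radius [r] contributes the error [eta], and [heat_tail] bounds the
    contribution of its complement. *)
Lemma heat_approx (u : R -> R) (x eta r c : R) : intg u ->
  0 < eta -> 0 < r -> 0 < c -> (forall y, `|y - x| < r -> `|u y - u x| <= eta) ->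
  `|Rintegral (leb R) setT (fun y => u y * heat c (y - x)) - u x| <=
  eta + 2 * Num.sqrt 2 * c / (pi * r ^+ 2) *
    ((Num.sqrt (2 * c))^-1 * Rintegral (leb R) setT (fun y => `|u y|) + `|u x|).
Proof.
move=> Iu e0 r0 c0 ue; have c20 : 0 < 2 * c by rewrite mulr_gt0.
set A := 2 * _ * _ / _; have A0 : 0 <= A.
  by rewrite /A divr_ge0 ?mulr_ge0 ?sqrtr_ge0 ?pi_ge0 ?ltW// exprn_gt0.
have Iuh : intg (fun y => u y * heat c (y - x)).
  apply: (intgM_bounded (C := (Num.sqrt c)^-1) Iu (measurable_heat_shift c x)).
  by move=> y; rewrite ger0_norm ?heat_ge0// heat_le.
have Ich : intg (fun y => u x * heat c (y - x)) by exact: intgZ (intg_heat_shift x c0).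
have E : Rintegral (leb R) setT (fun y => u y * heat c (y - x)) - u x =
    Rintegral (leb R) setT (fun y => u y * heat c (y - x) - u x * heat c (y - x)).
  rewrite RintegralB// RintegralZl//; last exact: intg_heat_shift.
  by rewrite Rintegral_heat_shift// mulr1.
have Id := intgB Iuh Ich.
rewrite E; apply: le_trans (le_normr_Rintegral _ Id) _ => //.
pose F1 y : R := eta * heat c (y - x).
pose F2 y : R := A * (Num.sqrt (2 * c))^-1 * `|u y|.
pose F3 y : R := A * `|u x| * heat (2 * c) (y - x).
have I1 : intg F1 by exact: intgZ (intg_heat_shift x c0).
have I2 : intg F2 by exact: intgZ (intg_norm Iu).
have I3 : intg F3 by exact: intgZ (intg_heat_shift x c20).
apply: (@le_trans _ _ (Rintegral (leb R) setT (fun y => F1 y + (F2 y + F3 y)))).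
  apply: le_Rintegral => //.
  - exact: intg_norm.
  - exact: intgD I1 (intgD I2 I3).
  move=> y _; rewrite -mulrBl normrM (ger0_norm (heat_ge0 _ _)).
  have h0 := heat_ge0 c (y - x); have h20 := heat_ge0 (2 * c) (y - x).
  have s0 : 0 <= (Num.sqrt (2 * c))^-1 by rewrite invr_ge0 sqrtr_ge0.
  case: (ltP `|y - x| r) => yr.
    rewrite (@le_trans _ _ (F1 y))//; first by rewrite ler_wpM2r// ue.
    rewrite lerDl addr_ge0//; first exact: mulr_ge0 (mulr_ge0 A0 s0) (normr_ge0 _).
    exact: mulr_ge0 (mulr_ge0 A0 (normr_ge0 _)) h20.
  rewrite (@le_trans _ _ (F2 y + F3 y))//; last first.
    by rewrite lerDr; exact: mulr_ge0 (ltW e0) h0.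
  have ht := heat_tail c0 r0 yr; rewrite -/A in ht.
  apply: (@le_trans _ _ ((`|u y| + `|u x|) * (A * heat (2 * c) (y - x)))).
    by apply: ler_pM => //; exact: ler_normB.
  rewrite mulrDl lerD//; last by rewrite /F3 le_eqVlt; apply/orP; left; apply/eqP; ring.
  rewrite /F2 mulrC ler_wpM2r// ler_wpM2l// heat_le//.
rewrite RintegralD//; last exact: intgD I2 I3.
have -> : Rintegral (leb R) setT F1 = eta.
  by rewrite RintegralZl ?Rintegral_heat_shift ?mulr1//; exact: intg_heat_shift.
have R2 : Rintegral (leb R) setT F2 =
    A * (Num.sqrt (2 * c))^-1 * Rintegral (leb R) setT (fun y => `|u y|).
  by rewrite RintegralZl//; exact: intg_norm.
have R3 : Rintegral (leb R) setT F3 = A * `|u x|.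
  by rewrite RintegralZl ?Rintegral_heat_shift ?mulr1//; exact: intg_heat_shift.
by rewrite RintegralD// R2 R3 lerD2l mulrDr mulrA.
Qed.

Lemma heat_cvg (u : R -> R) (x : R) : intg u -> {for x, continuous u} ->
  Rintegral (leb R) setT (fun y => u y * heat n.+1%:R^-1 (y - x)) @[n --> \oo] --> u x.
Proof.
move=> Iu cu; apply/cvgrPdist_le => e e0.
have e20 : 0 < e / 2 by rewrite divr_gt0.
have /cvgrPdist_le/(_ _ e20) := cu.
move=> [r /= r0 ru].
have ur y : `|y - x| < r -> `|u y - u x| <= e / 2.
  by move=> yr; rewrite distrC; apply: ru; rewrite /= distrC.
set Iabs := Rintegral (leb R) setT (fun y => `|u y|).
pose Q (c : R) : R := 2 * Num.sqrt 2 * c / (pi * r ^+ 2) *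
    ((Num.sqrt (2 * c))^-1 * Iabs + `|u x|).
have QE c : 0 < c -> Q c = (2 / (pi * r ^+ 2)) * Iabs * Num.sqrt c +
    (2 * Num.sqrt 2 * `|u x| / (pi * r ^+ 2)) * c.
  move=> c0; rewrite /Q sqrtrM// invfM.
  have s2 : Num.sqrt (2 : R) != 0 by rewrite gt_eqF// sqrtr_gt0.
  have sc : Num.sqrt c != 0 by rewrite gt_eqF// sqrtr_gt0.
  rewrite -{1 4}(sqr_sqrtr (ltW c0)).
  move: (Num.sqrt 2) s2 (Num.sqrt c) sc (pi : R) (pi_gt0 R) => s s0 t t0 p p0.
  by field; rewrite (gt_eqF r0) (gt_eqF p0) t0.
have Qcvg : Q n.+1%:R^-1 @[n --> \oo] --> (0 : R).
  have -> : (fun n => Q n.+1%:R^-1) = (fun n => (2 / (pi * r ^+ 2)) * Iabs *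
      Num.sqrt n.+1%:R^-1 + (2 * Num.sqrt 2 * `|u x| / (pi * r ^+ 2)) * n.+1%:R^-1).
    by apply/funext => n; rewrite QE// invr_gt0.
  rewrite -[X in _ --> X](_ : (2 / (pi * r ^+ 2)) * Iabs * Num.sqrt 0 +
    (2 * Num.sqrt 2 * `|u x| / (pi * r ^+ 2)) * 0 = 0); last first.
    by rewrite sqrtr0 !mulr0 addr0.
  apply: cvgD; (apply: cvgM; first exact: cvg_cst); last exact: cvg_harmonic.
  by apply: continuous_cvg; [exact: sqrt_continuous|exact: cvg_harmonic].
have /cvgrPdist_le/(_ _ e20) := Qcvg.
apply: filterS => n; rewrite sub0r normrN => Qn.
rewrite distrC; have c0 : 0 < n.+1%:R^-1 :> R by rewrite invr_gt0.
apply: le_trans (heat_approx Iu e20 r0 c0 ur) _.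
rewrite [leRHS](splitr e) lerD2l; apply: le_trans Qn; exact: ler_norm.
Qed.

Lemma gauss_damping_cvg (v : R -> R) : intg v ->
  Rintegral (leb R) setT (fun y => v y * gaussian n.+1%:R^-1 y) @[n --> \oo] -->
  Rintegral (leb R) setT v.
Proof.
move=> Iv.
have Ivn n : intg (fun y => v y * gaussian n.+1%:R^-1 y).
  apply: (intgM_bounded (C := 1) Iv); first exact: measurable_gaussian.
  by move=> y; rewrite ger0_norm ?gaussian_ge0// gaussian_le1// invr_ge0.
apply: fine_cvg; rewrite (intg_integralE Iv).
apply: (@dominated_cvg _ _ _ (leb R) setT _
  (fun n y => (v y * gaussian n.+1%:R^-1 y)%:E) (EFin \o v) (fun y => `|v y|%:E)) => //.
- by move=> n; apply/measurable_EFinP; exact: intg_meas (Ivn n).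
- move=> y _; apply: cvg_EFin; first exact: nearW.
  rewrite -[X in _ --> X]mulr1; apply: cvgM; first exact: cvg_cst.
  exact: gaussian_cvg1.
- exact: intg_norm.
- move=> n y _; rewrite lee_fin normrM ler_piMr// ger0_norm ?gaussian_ge0//.
  by rewrite gaussian_le1// invr_ge0.
Qed.

(** Both sides of [gauss_inversion] converge when the Gaussian factor tends to one.
    The conjugations express the inverse transform through the direct one. *)
Theorem fourier_inversion (g : R -> R[i]) (x : R) : Cintg g -> Cintg (fourier g) ->
  continuous (fun x => Re (g x)) -> continuous (fun x => Im (g x)) ->
  fourier (fun xi => conjc (fourier g xi)) x = conjc (g x).
Proof.
move=> Ig Igh cr ci.
pose E xi := fourier g xi * expi (2 * pi * xi * x).
have mph : measurable_fun setT (fun xi : R => 2 * pi * xi * x).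
  by apply: measurable_funM => //; apply: measurable_funM.
have IE : Cintg E by exact: Cintg_phase.
have -> : fourier (fun xi => conjc (fourier g xi)) x = conjc (Cintegral E).
  rewrite -CintegralJ//; apply: eq_Cintegral => xi.
  by rewrite Cconj_mul expiJ.
congr conjc.
have K n : Cintegral (fun xi => E xi * (gaussian n.+1%:R^-1 xi)%:C) =
    Cintegral (fun y => g y * (heat n.+1%:R^-1 (y - x))%:C).
  rewrite -gauss_inversion ?invr_gt0//; apply: eq_Cintegral => xi.
  by rewrite /E mulrAC mulrA.
have [gr gi] := Ig; have [Er Ei] := IE.
have ReMr (z : R[i]) (t : R) : Re (z * t%:C) = Re z * t.
  by rewrite CReM /= mulr0 subr0.
have ImMr (z : R[i]) (t : R) : Im (z * t%:C) = Im z * t.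
  by rewrite CImM /= mulr0 add0r.
apply: complexP.
- have KR n : Rintegral (leb R) setT (fun xi => Re (E xi) * gaussian n.+1%:R^-1 xi) =
      Rintegral (leb R) setT (fun y => Re (g y) * heat n.+1%:R^-1 (y - x)).
    have h : Rintegral (leb R) setT (fun xi => Re (E xi * (gaussian n.+1%:R^-1 xi)%:C)) =
        Rintegral (leb R) setT (fun y => Re (g y * (heat n.+1%:R^-1 (y - x))%:C)).
      by have := K n; rewrite /Cintegral => -[].
    by under eq_Rintegral do rewrite -ReMr; rewrite h; apply: eq_Rintegral => y _; rewrite ReMr.
  have := gauss_damping_cvg Er; under eq_fun do rewrite KR.
  by move=> h; apply: (cvg_unique _ h); last exact: (heat_cvg (u := fun x => Re (g x)) gr (cr x)).
- have KI n : Rintegral (leb R) setT (fun xi => Im (E xi) * gaussian n.+1%:R^-1 xi) =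
      Rintegral (leb R) setT (fun y => Im (g y) * heat n.+1%:R^-1 (y - x)).
    have h : Rintegral (leb R) setT (fun xi => Im (E xi * (gaussian n.+1%:R^-1 xi)%:C)) =
        Rintegral (leb R) setT (fun y => Im (g y * (heat n.+1%:R^-1 (y - x))%:C)).
      by have := K n; rewrite /Cintegral => -[].
    by under eq_Rintegral do rewrite -ImMr; rewrite h; apply: eq_Rintegral => y _; rewrite ImMr.
  have := gauss_damping_cvg Ei; under eq_fun do rewrite KI.
  by move=> h; apply: (cvg_unique _ h); last exact: (heat_cvg (u := fun x => Im (g x)) gi (ci x)).
Qed.

End Inversion.

(** * A finite difference Wirtinger inequality on one gap *)

Section Wirtinger.
Variable R : realType.

(** Half-open, so that consecutive gaps tile the line. *)
Definition ind (p q x : R) : R := (p <= x < q)%R%:R.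

Lemma ind_ge0 p q x : 0 <= ind p q x.
Proof. exact: ler0n. Qed.

Lemma indE p q : ind p q = \1_(`[p, q[%classic).
Proof.
by apply/funext => x; rewrite indicE /ind; congr (_%:R); rewrite mem_setE in_itv.
Qed.

Lemma intg_ind p q : intg (ind p q).
Proof. rewrite indE; exact: integrable_indic_itv. Qed.

Lemma Rintegral_ind p q : p <= q -> Rintegral (leb R) setT (ind p q) = q - p.
Proof.
move=> pq; rewrite indE /Rintegral integral_indic//.
apply: (congr1 fine (_ : _ = (q - p)%:E)).
rewrite setIT; apply: etrans (lebesgue_measure_itv _) _ => /=.
rewrite lte_fin; case: ltP => [_|qp]; first by rewrite -EFinB.
by have -> : p = q; [apply/eqP; rewrite eq_le pq|rewrite subrr].
Qed.

Lemma ind_cat p q r x : p <= q -> q <= r -> ind p r x = ind p q x + ind q r x.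
Proof.
move=> pq qr; rewrite /ind; case: (ltP x q) => xq.
  by rewrite andbT (lt_le_trans xq qr) andbT andFb addr0.
by rewrite (le_trans pq xq) andbF add0r.
Qed.

Lemma intg_continuous_ind (f : R -> R) p q : continuous f -> intg (fun x => f x * ind p q x).
Proof.
move=> cf.
have h1 : (leb R).-integrable `[p, q]%classic (EFin \o f).
  apply: continuous_compact_integrable; first exact: segment_compact.
  exact: continuous_subspaceT.
have h2 : (leb R).-integrable `[p, q[%classic (EFin \o f).
  by apply: integrableS h1 => //; apply: subset_itvl; rewrite bnd_simp.
move: h2 => /integrable_mkcond -/(_ (measurable_itv _)).
apply: eq_integrable => // x _; rewrite /= indE patchE indicE.
by case: ifP; rewrite ?mulr1 ?mulr0.
Qed.

(** The difference of the two sides is [(a' * u - a * u') ^+ 2 / (u * u')]. *)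
Lemma picone (a a' u u' : R) : 0 < u -> 0 < u' ->
  (u' - u) * (a' ^+ 2 / u' - a ^+ 2 / u) <= (a' - a) ^+ 2.
Proof.
move=> u0 u'0; rewrite -subr_ge0.
have -> : (a' - a) ^+ 2 - (u' - u) * (a' ^+ 2 / u' - a ^+ 2 / u) =
  (a' * u - a * u') ^+ 2 / (u * u').
  by field; rewrite (gt_eqF u0) (gt_eqF u'0).
by rewrite divr_ge0 ?sqr_ge0// ltW// mulr_gt0.
Qed.

Lemma sin_ge_interior (e t : R) : 0 <= e -> e <= t -> t <= pi - e -> sin e <= sin t.
Proof.
move=> e0 et tpe; have p0 := pi_gt0 R.
have key s : e <= s -> s <= pi / 2 -> sin e <= sin s.
  move=> es sp; move: es; rewrite le_eqVlt => /predU1P[->//|es].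
  by apply/ltW; rewrite ltr_sin ?in_itv/= //; apply/andP; split; lra.
case: (leP t (pi / 2)) => tp; first exact: key.
have -> : sin t = sin (pi - t).
  by rewrite sinB sinpi cospi mul0r sub0r mulN1r opprK.
by apply: key; lra.
Qed.

Lemma sin_mvt (s t : R) : s < t -> exists2 c, s < c < t & sin t - sin s = cos c * (t - s).
Proof.
move=> st; have [|c] := @MVT R sin cos s t st (fun x _ => is_derive_sin x).
  by apply: continuous_subspaceT; exact: continuous_sin.
by rewrite in_itv/= => cst h; exists c.
Qed.

Lemma sin_lipschitz (s d : R) : 0 <= d -> `|sin (s + d) - sin s| <= d.
Proof.
rewrite le_eqVlt => /predU1P[<-|d0]; first by rewrite addr0 subrr normr0.
have [|c _ ->] := @sin_mvt s (s + d); first by rewrite ltrDl.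
by rewrite addrAC subrr add0r normrM (ger0_norm (ltW d0)) ler_piMl ?cos_max// ltW.
Qed.

Lemma cos_quadratic (k s : R) : 0 < k -> 0 < s ->
  \forall d \near (0 : R)^'+, (k ^+ 2 - s) * d ^+ 2 <= 2 * (1 - cos (k * d)).
Proof.
move=> k0 s0.
have cc : {for 0, continuous (fun c : R => k ^+ 2 * cos c ^+ 2)}.
  apply: cvgM; first exact: cvg_cst.
  by under eq_fun do rewrite expr2; apply: cvgM; exact: continuous_cos.
have /cvgrPdist_lt/(_ _ s0)[r /= r0 hr] := cc.
near=> d.
have d0 : 0 < d by near: d; exact: nbhs_right_gt.
have dr : k * d / 2 < r.
  rewrite -ltr_pdivlMr ?invr_gt0// -ltr_pdivlMl//.
  by near: d; apply: nbhs_right_lt; rewrite !mulr_gt0 ?invr_gt0 ?divr_gt0.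
have y0 : 0 < k * d / 2 by rewrite !mulr_gt0.
have [c /andP[c0 cy]] := sin_mvt y0; rewrite sin0 !subr0 => sE.
have -> : 2 * (1 - cos (k * d)) = (2 * sin (k * d / 2)) ^+ 2.
  have kd : k * d = (k * d / 2) *+ 2 by rewrite -mulr_natr; field.
  rewrite [in cos _]kd cos_mulr2n; have := cos2Dsin2 (k * d / 2).
  by move: (cos _) (sin _) => C S h; rewrite exprMn -[S ^+ 2](addKr (C ^+ 2)) h; ring.
rewrite sE.
have := hr c; rewrite /= sub0r normrN (gtr0_norm c0) cos0 expr1n mulr1 => /(_ (lt_trans cy dr)).
rewrite ltr_norml => /andP[_ h].
have -> : (2 * (cos c * (k * d / 2))) ^+ 2 = k ^+ 2 * cos c ^+ 2 * d ^+ 2 by field.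
by rewrite ler_wpM2r ?sqr_ge0//; lra.
Unshelve. all: by end_near. Qed.

Section Interval.
Variables (a : R -> R) (p q k : R).
Hypotheses (ca : continuous a) (ap : a p = 0) (aq : a q = 0) (pq : p < q)
  (k0 : 0 < k) (kpi : k * (q - p) < pi).

(* The slack [pi - k * (q - p)] is divided equally between the two ends, which
   keeps [u], a solution of u'' = - k^2 u, positive on the closed gap. *)
Let e0 := (pi - k * (q - p)) / 2.
Let u x := sin (k * (x - p) + e0).
Let u0 := sin e0.

Let e0_gt0 : 0 < e0. Proof. by rewrite divr_gt0// subr_gt0. Qed.

Let u0_gt0 : 0 < u0.
Proof.
rewrite /u0 sin_gt0_pi// e0_gt0/= /e0.
have h : 0 < k * (q - p) by rewrite mulr_gt0// subr_gt0.
have p0 := pi_gt0 R; lra.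
Qed.

Let u_ge x : p <= x -> x <= q -> u0 <= u x.
Proof.
move=> px xq; apply: sin_ge_interior; first exact: ltW.
  by rewrite lerDr mulr_ge0 ?subr_ge0// ltW.
have : k * (x - p) <= k * (q - p) by rewrite ler_pM2l// lerD2r.
by rewrite /e0; lra.
Qed.

Let cu : continuous u.
Proof.
move=> x; apply: continuous_comp; last exact: continuous_sin.
apply: cvgD; last exact: cvg_cst.
by apply: cvgM; [exact: cvg_cst|apply: cvgB; [exact: cvg_id|exact: cvg_cst]].
Qed.

(* The maximum extends the quotient [a ^+ 2 / u] continuously beyond the gap. *)
Let E x := a x ^+ 2 / Num.max (u x) u0.

Let maxu_gt0 x : 0 < Num.max (u x) u0.
Proof. by rewrite lt_max u0_gt0 orbT. Qed.

Let cE : continuous E.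
Proof.
move=> x; apply: cvgM.
  by under eq_fun do rewrite expr2; apply: cvgM; exact: ca.
apply: cvgV; first by rewrite gt_eqF.
by apply: continuous_max; [exact: cu|exact: cvg_cst].
Qed.

Let E_ge0 x : 0 <= E x.
Proof. by rewrite divr_ge0 ?sqr_ge0// ltW. Qed.

Let EE x : p <= x -> x <= q -> E x = a x ^+ 2 / u x.
Proof. by move=> px xq; rewrite /E max_l// u_ge. Qed.

Let Ep : E p = 0. Proof. by rewrite /E ap expr0n mul0r. Qed.
Let Eq : E q = 0. Proof. by rewrite /E aq expr0n mul0r. Qed.

Let u_lip x d : 0 <= d -> `|u (x + d) - u x| <= k * d.
Proof.
move=> d0; have -> : u (x + d) = sin (k * (x - p) + e0 + k * d).
  by rewrite /u; congr sin; ring.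
by apply: sin_lipschitz; rewrite mulr_ge0// ltW.
Qed.

(** Picone's inequality when [x] and [x + d] are both in the gap. Otherwise only
    one term survives on the left, near an end point, where [E] is small. *)
Let pointwise d eta x : 0 < d -> d < q - p -> 0 <= eta ->
  (forall y, `|y - p| <= d -> E y <= eta) -> (forall y, `|y - q| <= d -> E y <= eta) ->
  (u (x + d) - u x) * (E (x + d) * ind p q (x + d)) -
  (u (x + d) - u x) * (E x * ind p q x) <=
  (a (x + d) - a x) ^+ 2 * ind p q x +
    k * d * eta * (ind (p - d) p x + ind (q - d) q x).
Proof.
move=> d0 dq eta0 Hp Hq.
have := u_lip x (ltW d0); rewrite ler_norml => /andP[l1 l2].
have kde : 0 <= k * d * eta by rewrite !mulr_ge0// ltW.
have ux := E_ge0 x; have ux' := E_ge0 (x + d).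
rewrite /ind.
case: (ltP x (p - d)) => [xp1|px1].
  have -> : (p <= x + d) = false by lra.
  have -> : (p <= x) = false by lra.
  have -> : (q - d <= x) = false by lra.
  by rewrite /= !mulr0 subr0 addr0 mulr0 add0r.
case: (ltP x p) => [xp|px].
  have -> : (p <= x + d) by lra.
  have -> : (x + d < q) by lra.
  have -> : (q - d <= x) = false by lra.
  rewrite /= !mulr0 subr0 add0r mulr1 addr0 mulr1.
  apply: (@le_trans _ _ (k * d * E (x + d))); first by rewrite ler_wpM2r.
  by rewrite ler_wpM2l ?mulr_ge0 ?(ltW k0) ?(ltW d0)// Hp// ler_norml; lra.
have -> : (p <= x + d) by lra.
case: (ltP x (q - d)) => [xq|qx].
  have -> : (x + d < q) by lra.
  have -> : (x < q) by lra.
  rewrite /= !mulr1 addr0 mulr0 addr0 -mulrBr !EE; try lra.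
  by apply: picone; apply: (lt_le_trans u0_gt0); apply: u_ge; lra.
have -> : (x + d < q) = false by lra.
case: (ltP x q) => [xq|qx'].
  rewrite /= !mulr0 sub0r !mulr1 add0r mulr1.
  apply: (@le_trans _ _ (k * d * E x)).
    by rewrite -mulNr ler_wpM2r//; lra.
  apply: (@le_trans _ _ (k * d * eta)); last by rewrite lerDr sqr_ge0.
  by rewrite ler_wpM2l ?mulr_ge0 ?(ltW k0) ?(ltW d0)// Hq// ler_norml; lra.
by rewrite /= !mulr0 subr0 addr0 mulr0 add0r.
Qed.

(** In the integral of [pointwise] over the line, a translation by [d] collects
    the factor [2 * u x - u (x + d) - u (x - d)], which equals
    [2 * (1 - cos (k * d)) * u x] and cancels the denominator of [E]. Finite
    differences stand in for the derivative of [a] because [fourier_increment]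
    controls them without any differentiability. *)
Lemma gap_difference eta : 0 < eta -> \forall d \near (0 : R)^'+,
  2 * (1 - cos (k * d)) * Rintegral (leb R) setT (fun x => a x ^+ 2 * ind p q x) <=
  Rintegral (leb R) setT (fun x => (a (x + d) - a x) ^+ 2 * ind p q x) +
  eta * d ^+ 2.
Proof.
move=> eta0; pose eta' := eta / (2 * k).
have k20 : 0 < 2 * k by rewrite mulr_gt0.
have eta'0 : 0 < eta' by rewrite divr_gt0.
have small z : E z = 0 -> exists2 r, 0 < r & forall y, `|y - z| < r -> E y <= eta'.
  move=> Ez; have /cvgrPdist_le/(_ _ eta'0)[r /= r0 hr] := cE (x := z).
  exists r => // y yz; have := hr y; rewrite /= distrC Ez sub0r normrN => /(_ yz).
  by move=> h; apply: le_trans h; exact: ler_norm.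
have [rp rp0 hp] := small p Ep; have [rq rq0 hq] := small q Eq.
near=> d.
have d0 : 0 < d by near: d; exact: nbhs_right_gt.
have dq : d < q - p by near: d; apply: nbhs_right_lt; rewrite subr_gt0.
have dp : d < rp by near: d; exact: nbhs_right_lt.
have dq' : d < rq by near: d; exact: nbhs_right_lt.
have cshift (f : R -> R) b : continuous f -> continuous (fun x => f (x + b)).
  move=> cf x; apply: continuous_comp; last exact: cf.
  by apply: cvgD; [exact: cvg_id|exact: cvg_cst].
pose e x := E x * ind p q x.
have Iplus : intg (fun x => (u (x + d) - u x) * e x).
  under eq_fun do rewrite /e mulrA.
  apply: intg_continuous_ind => x; apply: cvgM; last exact: cE.
  by apply: cvgB; [exact: cshift cu _|exact: cu].
have Iminus : intg (fun x => (u x - u (x - d)) * e x).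
  under eq_fun do rewrite /e mulrA.
  apply: intg_continuous_ind => x; apply: cvgM; last exact: cE.
  by apply: cvgB; [exact: cu|exact: cshift cu _].
have Ishift := intg_shift d Iminus.
have Isq : intg (fun x => (a (x + d) - a x) ^+ 2 * ind p q x).
  apply: intg_continuous_ind => x; under eq_fun do rewrite expr2.
  by apply: cvgM; apply: cvgB; [exact: cshift ca _|exact: ca|exact: cshift ca _|exact: ca].
have Iind := intgZ (k * d * eta') (intgD (intg_ind (p - d) p) (intg_ind (q - d) q)).
have E1 : (fun x => (u (x + d) - u (x + d - d)) * e (x + d)) =
    (fun x => (u (x + d) - u x) * e (x + d)).
  by apply/funext => x; rewrite addrK.
rewrite E1 in Ishift.
have L : 2 * (1 - cos (k * d)) * Rintegral (leb R) setT (fun x => a x ^+ 2 * ind p q x) =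
  Rintegral (leb R) setT (fun x => (u (x + d) - u x) * e (x + d) - (u (x + d) - u x) * e x).
  rewrite RintegralB//.
  have -> : Rintegral (leb R) setT (fun x => (u (x + d) - u x) * e (x + d)) =
      Rintegral (leb R) setT (fun x => (u x - u (x - d)) * e x).
    by rewrite -[RHS](Rintegral_shift d Iminus) E1.
  rewrite -RintegralB// -RintegralZl//; last first.
    by apply: intg_continuous_ind => x; under eq_fun do rewrite expr2; apply: cvgM; exact: ca.
  apply: eq_Rintegral => x _; rewrite -mulrBl /e /ind.
  case: (boolP (p <= x < q)) => [/andP[px xq]|_]; last by rewrite !mulr0.
  rewrite !mulr1 EE//; last exact: ltW.
  have ux0 : u x != 0 by rewrite gt_eqF// (lt_le_trans u0_gt0)// u_ge// ltW.
  have -> : u x - u (x - d) - (u (x + d) - u x) = 2 * (1 - cos (k * d)) * u x.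
    rewrite /u (_ : k * (x - d - p) + e0 = k * (x - p) + e0 - k * d); last by ring.
    rewrite (_ : k * (x + d - p) + e0 = k * (x - p) + e0 + k * d); last by ring.
    move: (k * (x - p) + e0) => A; rewrite sinB sinD; ring.
  by field.
rewrite L.
apply: (@le_trans _ _ (Rintegral (leb R) setT (fun x => (a (x + d) - a x) ^+ 2 * ind p q x +
    k * d * eta' * (ind (p - d) p x + ind (q - d) q x)))).
  apply: le_Rintegral => //.
  - exact: intgB.
  - exact: intgD.
  move=> x _; apply: pointwise => //; first exact: ltW.
  - by move=> y yp; apply: hp; exact: le_lt_trans dp.
  - by move=> y yq; apply: hq; exact: le_lt_trans dq'.
rewrite RintegralD// RintegralZl//; last by apply: intgD; exact: intg_ind.
rewrite RintegralD//; [|exact: intg_ind|exact: intg_ind].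
rewrite !Rintegral_ind; [|by rewrite gerBl ltW|by rewrite gerBl ltW].
rewrite lerD2l /eta' le_eqVlt; apply/orP; left; apply/eqP.
by field; rewrite gt_eqF.
Unshelve. all: by end_near. Qed.

End Interval.

End Wirtinger.

(** * Wirtinger's inequality for a function with many zeros *)

Section GapWirtinger.
Variable R : realType.

Lemma continuous_shiftR (f : R -> R) b : continuous f -> continuous (fun x => f (x + b)).
Proof.
move=> cf x; apply: continuous_comp; last exact: cf.
by apply: cvgD; [exact: cvg_id|exact: cvg_cst].
Qed.

Lemma continuous_sqr (f : R -> R) : continuous f -> continuous (fun x => f x ^+ 2).
Proof. by move=> cf x; under eq_fun do rewrite expr2; apply: cvgM; exact: cf. Qed.

Lemma continuous_increment (f : R -> R) b : continuous f ->
  continuous (fun x => (f (x + b) - f x) ^+ 2).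
Proof.
move=> cf; apply: continuous_sqr => x.
by apply: cvgB; [exact: continuous_shiftR|exact: cf].
Qed.

(** This is [gap_difference] with [k] slightly below [pi / (q - p)], combined with
    the expansion of the cosine at the origin. *)
Lemma gap_wirtinger (a : R -> R) p q eps : continuous a -> a p = 0 -> a q = 0 ->
  p < q -> 0 < eps -> \forall d \near (0 : R)^'+,
  (pi / (q - p)) ^+ 2 * Rintegral (leb R) setT (fun x => a x ^+ 2 * ind p q x) <=
  d ^- 2 * Rintegral (leb R) setT (fun x => (a (x + d) - a x) ^+ 2 * ind p q x) + eps.
Proof.
move=> ca ap aq pq e0; set I := Rintegral _ _ _; set P := pi / (q - p).
have qp0 : 0 < q - p by rewrite subr_gt0.
have P0 : 0 < P by rewrite divr_gt0// pi_gt0.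
have I0 : 0 <= I by apply: Rintegral_ge0 => x _; rewrite mulr_ge0 ?sqr_ge0// ind_ge0.
have I10 : 0 < I + 1 by rewrite ltr_wpDl.
pose D := 8 * P ^+ 2 * (I + 1).
have P20 : 0 < P ^+ 2 by rewrite exprn_gt0.
have D0 : 0 < D by rewrite (mulr_gt0 (mulr_gt0 _ P20) I10).
pose t := eps / (eps + D).
have eD0 : 0 < eps + D by rewrite addr_gt0.
have t0 : 0 < t by rewrite divr_gt0.
have t1 : t < 1 by rewrite ltr_pdivrMr// mul1r ltrDl.
have tD : t * D <= eps.
  by rewrite /t mulrAC ler_pdivrMr// ler_pM2l// lerDr ltW.
pose s := eps / (4 * (I + 1)).
have s0 : 0 < s by rewrite divr_gt0// mulr_gt0.
have sE : s * (4 * (I + 1)) = eps by rewrite /s divfK// gt_eqF// mulr_gt0.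
pose k := P * (1 - t).
have k0 : 0 < k by rewrite mulr_gt0// subr_gt0.
have kpi : k * (q - p) < pi.
  rewrite /k mulrAC /P divfK ?gt_eqF// gtr_pMr ?pi_gt0//; lra.
have key : P ^+ 2 * I - eps / 2 <= (k ^+ 2 - s) * I.
  have -> : k ^+ 2 = P ^+ 2 - 2 * t * P ^+ 2 + (t * P) ^+ 2 by rewrite /k; ring.
  have h1 : 2 * t * P ^+ 2 * I <= eps / 4.
    have : t * D = 4 * (2 * t * P ^+ 2 * I + 2 * t * P ^+ 2) by rewrite /D; ring.
    have : 0 <= 2 * t * P ^+ 2 by rewrite mulr_ge0 ?(ltW P20)// mulr_ge0// ltW.
    by move: tD; lra.
  have h2 : s * I <= eps / 4.
    have : s * (4 * (I + 1)) = 4 * (s * I) + 4 * s by ring.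
    by move: s0 sE; lra.
  have h3 : 0 <= (t * P) ^+ 2 * I by rewrite mulr_ge0 ?sqr_ge0.
  rewrite !mulrBl !mulrDl mulNr; lra.
have e20 : 0 < eps / 2 by rewrite divr_gt0.
near=> d.
have d0 : 0 < d by near: d; exact: nbhs_right_gt.
have A : (k ^+ 2 - s) * d ^+ 2 <= 2 * (1 - cos (k * d)).
  by near: d; exact: cos_quadratic.
have B : 2 * (1 - cos (k * d)) * I <=
    Rintegral (leb R) setT (fun x => (a (x + d) - a x) ^+ 2 * ind p q x) + eps / 2 * d ^+ 2.
  by near: d; exact: gap_difference.
set J := Rintegral _ _ _ in B *.
have d20 : 0 < d ^+ 2 by rewrite exprn_gt0.
have C : (k ^+ 2 - s) * I <= d ^- 2 * J + eps / 2.
  rewrite -(ler_pM2r d20) [leRHS]mulrDl (_ : d ^- 2 * J * d ^+ 2 = J); last first.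
    by field; rewrite gt_eqF.
  by apply: le_trans B; rewrite mulrAC ler_wpM2r.
by move: key C; lra.
Unshelve. all: by end_near. Qed.

End GapWirtinger.

Section Wirtinger.
Variable R : realType.

Lemma abs2_expi_sub1 (t : R) : abs2 (expi t - 1) <= t ^+ 2.
Proof.
have -> : abs2 (expi t - 1 : R[i]) = (2 * sin (t / 2)) ^+ 2.
  rewrite abs2E !RIE /= oppr0 addr0.
  have kd : t = (t / 2) *+ 2 by rewrite -mulr_natr; field.
  have e : (cos t - 1) ^+ 2 + sin t ^+ 2 = 2 - 2 * cos t.
    by rewrite sqrrB -[sin t ^+ 2](addKr (cos t ^+ 2)) cos2Dsin2; ring.
  rewrite e [in cos _]kd cos_mulr2n; have := cos2Dsin2 (t / 2).
  by move: (cos _) (sin _) => C S h; rewrite exprMn -[S ^+ 2](addKr (C ^+ 2)) h; ring.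
have h : `|sin (t / 2)| <= `|t / 2|.
  have pos (s : R) : 0 <= s -> `|sin s| <= s.
    by move=> s0; have := sin_lipschitz 0 s0; rewrite add0r sin0 subr0.
  case: (leP 0 (t / 2)) => t0; first by rewrite [leRHS]ger0_norm// pos.
  by rewrite -normrN -sinN [leRHS]ltr0_norm// pos// oppr_ge0 ltW.
rewrite exprMn -(real_normK (num_real (sin _))).
have -> : t ^+ 2 = 2 ^+ 2 * `|t / 2| ^+ 2 by rewrite real_normK ?num_real//; field.
by rewrite ler_pM2l// ler_pXn2r ?nnegrE ?normr_ge0.
Qed.

(** The increment is the transform of [g] times a difference of phases of modulus
    at most [2 * pi * `|x| * d], to which Bessel's inequality applies. *)
Lemma fourier_increment (g : R -> R[i]) (d : R) : 0 < d -> Cintg g ->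
  (\int[leb R]_x (abs2 (fourier g (x + d) - fourier g x))%:E <=
   (4 * pi ^+ 2 * d ^+ 2)%:E * \int[leb R]_x (x ^+ 2 * abs2 (g x))%:E)%E.
Proof.
move=> d0 Ig; pose e t : R[i] := expi (- (2 * pi * t * d)) - 1.
have me : Cmeasurable e.
  apply: CmeasB; last exact: Cmeas_cst.
  by apply: Cmeas_expi; exact: measurable_phase.
have Ige : Cintg (fun t => g t * e t).
  apply: (CintgM_bounded (C := 3) Ig) => // t.
  rewrite /e (le_trans (normc_le _))// !RIE /= subr0 (_ : 3 = 2 + 1); last by ring.
  apply: lerD; last exact: sin_max.
  by rewrite (le_trans (ler_normB _ _))// normr1 lerD// cos_max.
have E x : fourier g (x + d) - fourier g x = fourier (fun t => g t * e t) x.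
  rewrite !fourierE -CintegralB; [|exact: fourier_Cintg|exact: fourier_Cintg].
  apply: eq_Cintegral => t; rewrite /e mulrBr mulrBl mulr1 -[g t * _ * _]mulrA -expiD.
  by congr (_ * expi _ - _); ring.
under eq_integral do rewrite E.
apply: le_trans (bessel Ige) _.
have mg := Cmeas_abs2 (Cintg_meas Ig).
rewrite -ge0_integralZl//; last 3 first.
- by apply/measurable_EFinP; apply: measurable_funM => //; exact: measurable_funX.
- by move=> x _; rewrite lee_fin mulr_ge0 ?sqr_ge0 ?abs2_ge0.
- by rewrite lee_fin mulr_ge0 ?sqr_ge0// mulr_ge0 ?sqr_ge0.
apply: ge0_le_integral => //.
- by move=> x _; rewrite lee_fin abs2_ge0.
- by apply/measurable_EFinP; exact: Cmeas_abs2 (Cintg_meas Ige).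
- apply/measurable_EFinP; apply: measurable_funM => //.
  by apply: measurable_funM => //; exact: measurable_funX.
- move=> x _; rewrite -EFinM lee_fin abs2M.
  have -> : 4 * pi ^+ 2 * d ^+ 2 * (x ^+ 2 * abs2 (g x)) =
    abs2 (g x) * (- (2 * pi * x * d)) ^+ 2 by ring.
  by rewrite ler_wpM2l ?abs2_ge0// abs2_expi_sub1.
Qed.

Section Chain.
Variables (m : R -> R[i]) (V : R -> R).
Hypotheses (cr : continuous (fun x => Re (m x))) (ci : continuous (fun x => Im (m x)))
  (cV : continuous V) (V0 : forall x, 0 <= V x).

Let lhs p q := Rintegral (leb R) setT (fun x => V x ^+ 2 * abs2 (m x) * ind p q x).
Let rhs d p q := Rintegral (leb R) setT (fun x => abs2 (m (x + d) - m x) * ind p q x).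

Let cabs : continuous (fun x => abs2 (m x)).
Proof.
rewrite (_ : (fun x => _) = fun x => Re (m x) ^+ 2 + Im (m x) ^+ 2); last first.
  by apply/funext => x; rewrite abs2E.
by move=> x; apply: cvgD; [exact: (continuous_sqr cr)|exact: (continuous_sqr ci)].
Qed.

Lemma abs2_increment d x : abs2 (m (x + d) - m x) =
  (Re (m (x + d)) - Re (m x)) ^+ 2 + (Im (m (x + d)) - Im (m x)) ^+ 2.
Proof. by rewrite abs2E !RIE. Qed.

Lemma continuous_abs2_increment d : continuous (fun x => abs2 (m (x + d) - m x)).
Proof.
rewrite (funext (abs2_increment d)) => x.
by apply: cvgD; [exact: (continuous_increment cr)|exact: (continuous_increment ci)].
Qed.

Let cVabs : continuous (fun x => V x ^+ 2 * abs2 (m x)).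
Proof. by move=> x; apply: cvgM; [exact: continuous_sqr|exact: cabs]. Qed.

Lemma intg_Vabs p q : intg (fun x => V x ^+ 2 * abs2 (m x) * ind p q x).
Proof. exact: intg_continuous_ind. Qed.

(** In this form the inequality is additive in the interval [[p, q[], and a finite
    number of intervals can share one step [d]. *)
Definition wirtinger_on p q := forall eps, 0 < eps -> \forall d \near (0 : R)^'+,
  4 * pi ^+ 2 * lhs p q <= d ^- 2 * rhs d p q + eps.

(** The bound [V <= 1 / (2 * (q - p))] on the gap turns the constant [pi / (q - p)]
    of [gap_wirtinger] into [2 * pi * V]. *)
Lemma wirtinger_on_gap p q : p < q -> m p = 0 -> m q = 0 ->
  (forall x, p <= x -> x <= q -> V x * (q - p) <= 1 / 2) -> wirtinger_on p q.
Proof.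
move=> pq mp mq HV eps e0.
have e20 : 0 < eps / 2 by rewrite divr_gt0.
have Rp : Re (m p) = 0 by rewrite mp. have Rq : Re (m q) = 0 by rewrite mq.
have Ip : Im (m p) = 0 by rewrite mp. have Iq : Im (m q) = 0 by rewrite mq.
have qp0 : 0 < q - p by rewrite subr_gt0.
have I1 (f : R -> R) : continuous f -> intg (fun x => f x ^+ 2 * ind p q x).
  by move=> cf; apply: intg_continuous_ind; exact: continuous_sqr.
have I2 (f : R -> R) d : continuous f -> intg (fun x => (f (x + d) - f x) ^+ 2 * ind p q x).
  by move=> cf; apply: intg_continuous_ind; exact: continuous_increment.
have L : 4 * pi ^+ 2 * lhs p q <= (pi / (q - p)) ^+ 2 *
    (Rintegral (leb R) setT (fun x => Re (m x) ^+ 2 * ind p q x) +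
     Rintegral (leb R) setT (fun x => Im (m x) ^+ 2 * ind p q x)).
  rewrite -RintegralD//; [|exact: (I1 _ cr)|exact: (I1 _ ci)].
  rewrite /lhs -[leLHS]RintegralZl//; last exact: intg_Vabs.
  rewrite -[leRHS]RintegralZl//; last exact: intgD (I1 _ cr) (I1 _ ci).
  apply: le_Rintegral => //.
  - exact: intgZ (intg_Vabs _ _).
  - exact: intgZ (intgD (I1 _ cr) (I1 _ ci)).
  move=> x _; rewrite -mulrDl -abs2E /ind.
  case: (boolP (p <= x < q)) => [/andP[px xq]|_]; last by rewrite !mulr0.
  rewrite !mulr1 mulrA ler_wpM2r ?abs2_ge0//.
  have h := HV x px (ltW xq).
  have hv : V x <= (2 * (q - p))^-1.
    by rewrite -(ler_pM2r qp0) invfM mulfVK ?gt_eqF//; move: h; rewrite div1r.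
  rewrite expr_div_n.
  have -> : pi ^+ 2 / (q - p) ^+ 2 = 4 * pi ^+ 2 * ((2 * (q - p))^-1) ^+ 2.
    by move: (pi : R) => P; field; rewrite gt_eqF.
  apply: ler_wpM2l; first by rewrite mulr_ge0// sqr_ge0.
  rewrite ler_pXn2r ?nnegrE// invr_ge0 mulr_ge0// ltW//.
near=> d.
have A : (pi / (q - p)) ^+ 2 * Rintegral (leb R) setT (fun x => Re (m x) ^+ 2 * ind p q x) <=
  d ^- 2 * Rintegral (leb R) setT
    (fun x => (Re (m (x + d)) - Re (m x)) ^+ 2 * ind p q x) + eps / 2.
  by near: d; exact: (gap_wirtinger cr Rp Rq pq e20).
have B : (pi / (q - p)) ^+ 2 * Rintegral (leb R) setT (fun x => Im (m x) ^+ 2 * ind p q x) <=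
  d ^- 2 * Rintegral (leb R) setT
    (fun x => (Im (m (x + d)) - Im (m x)) ^+ 2 * ind p q x) + eps / 2.
  by near: d; exact: (gap_wirtinger ci Ip Iq pq e20).
have E : rhs d p q =
    Rintegral (leb R) setT (fun x => (Re (m (x + d)) - Re (m x)) ^+ 2 * ind p q x) +
    Rintegral (leb R) setT (fun x => (Im (m (x + d)) - Im (m x)) ^+ 2 * ind p q x).
  rewrite -RintegralD//; [|exact: (I2 _ _ cr)|exact: (I2 _ _ ci)].
  by apply: eq_Rintegral => x _; rewrite abs2_increment mulrDl.
apply: le_trans L _; rewrite E !mulrDr.
by move: A B; lra.
Unshelve. all: by end_near. Qed.

Lemma wirtinger_on_cat p q r : p <= q -> q <= r ->
  wirtinger_on p q -> wirtinger_on q r -> wirtinger_on p r.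
Proof.
move=> pq qr W1 W2 eps e0; have e20 : 0 < eps / 2 by rewrite divr_gt0.
near=> d.
have A : 4 * pi ^+ 2 * lhs p q <= d ^- 2 * rhs d p q + eps / 2 by near: d; exact: W1.
have B : 4 * pi ^+ 2 * lhs q r <= d ^- 2 * rhs d q r + eps / 2 by near: d; exact: W2.
have -> : lhs p r = lhs p q + lhs q r.
  rewrite /lhs -RintegralD//; [|exact: intg_Vabs|exact: intg_Vabs].
  by apply: eq_Rintegral => x _; rewrite (ind_cat _ pq qr) mulrDr.
have -> : rhs d p r = rhs d p q + rhs d q r.
  rewrite /rhs -RintegralD//; try (by apply: intg_continuous_ind; exact: continuous_abs2_increment).
  by apply: eq_Rintegral => x _; rewrite (ind_cat _ pq qr) mulrDr.
by rewrite !mulrDr; lra.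
Unshelve. all: by end_near. Qed.

Lemma wirtinger_on_nil p : wirtinger_on p p.
Proof.
move=> eps e0; near=> d.
have i0 x : ind p p x = 0 by rewrite /ind; case: leP.
have -> : lhs p p = 0.
  rewrite /lhs; under eq_Rintegral do rewrite i0 mulr0.
  by rewrite /Rintegral integral0.
rewrite mulr0 addr_ge0//; last exact: ltW.
rewrite mulr_ge0 ?invr_ge0 ?sqr_ge0//.
by apply: Rintegral_ge0 => x _; rewrite mulr_ge0 ?abs2_ge0 ?ind_ge0.
Unshelve. all: by end_near. Qed.

End Chain.

Lemma bi_infinite_mono (l : int -> R) : bi_infinite_increasing l ->
  forall (i : int) (n : nat), l i <= l (i + n%:Z).
Proof.
move=> [l1 _ _] i; elim=> [|n IH]; first by rewrite addr0.
by rewrite (le_trans IH)// -addn1 PoszD addrA ltW.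
Qed.

(** The inequalities of the gaps in [[l i, l (i + n)[] add up, and
    [fourier_increment] bounds the right-hand side of the sum, the factors
    [4 * pi ^+ 2] and [d ^+ 2] cancelling. The intervals exhaust the line. *)
Theorem wirtinger (g : R -> R[i]) (V : R -> R) (l : int -> R) : Cintg g ->
  bi_infinite_increasing l -> (forall j, fourier g (l j) = 0) ->
  continuous V -> (forall x, 0 <= V x) ->
  (forall j x, l j <= x -> x <= l (j + 1) -> V x * (l (j + 1) - l j) <= 1 / 2) ->
  (\int[leb R]_x (V x ^+ 2 * abs2 (fourier g x))%:E <=
   \int[leb R]_x (x ^+ 2 * abs2 (g x))%:E)%E.
Proof.
move=> Ig Hl gl cV V0 HV.
have cr := continuous_fourier_Re Ig; have ci := continuous_fourier_Im Ig.
have [l1 ly lNy] := Hl.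
have W i n : wirtinger_on (fourier g) V (l i) (l (i + n%:Z)).
  elim: n => [|n IH]; first by rewrite addr0; exact: wirtinger_on_nil.
  apply: (wirtinger_on_cat cr ci cV) IH _; first exact: bi_infinite_mono.
    by rewrite -addn1 PoszD addrA ltW.
  rewrite -addn1 PoszD addrA; apply: wirtinger_on_gap => //.
  by move=> x; exact: HV.
set B := (X in (_ <= X)%E).
have B0 : (0 <= B)%E.
  by apply: integral_ge0 => x _; rewrite lee_fin mulr_ge0 ?sqr_ge0 ?abs2_ge0.
case: (ltP B +oo%E) => [Bfin|]; last by rewrite leye_eq => /eqP ->; exact: leey.
have Bn : B \is a fin_num by rewrite ge0_fin_numE.
have mV : measurable_fun setT (fun x => V x ^+ 2 * abs2 (fourier g x)).
  apply: measurable_funM; last exact: Cmeas_abs2 (Cmeas_fourier Ig).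
  by apply: measurable_funX; exact: continuous_measurable_fun.
have bnd i n : (\int[leb R]_(x in `[l i, l (i + n%:Z)%R[%classic)
    (V x ^+ 2 * abs2 (fourier g x))%:E <= B)%E.
  have IV := intg_Vabs cr ci cV (l i) (l (i + n%:Z)).
  have -> : (\int[leb R]_(x in `[l i, l (i + n%:Z)%R[%classic)
    (V x ^+ 2 * abs2 (fourier g x))%:E)%E =
    (Rintegral (leb R) setT (fun x => V x ^+ 2 * abs2 (fourier g x) *
      ind (l i) (l (i + n%:Z)) x))%:E.
    rewrite (intg_integralE IV) integral_mkcond; apply: eq_integral => x _.
    by rewrite indE patchE indicE; case: ifP; rewrite ?mulr1 ?mulr0.
  rewrite -(fineK Bn) lee_fin; apply/ler_addgt0Pr => e e0.
  have p0 := pi_gt0 R.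
  have p20 : 0 < pi ^+ 2 :> R by rewrite exprn_gt0.
  have pe0 : 0 < 4 * pi ^+ 2 * e by rewrite mulr_gt0// mulr_gt0.
  have [d [d0 Hd]] := filter_ex (filterI (nbhs_right_gt 0) (W i n _ pe0)).
  have d20 : 0 < d ^+ 2 by rewrite exprn_gt0.
  have inc := fourier_increment d0 Ig.
  have Iinc : intg (fun x => abs2 (fourier g (x + d) - fourier g x) *
      ind (l i) (l (i + n%:Z)) x).
    exact/intg_continuous_ind/continuous_abs2_increment.
  have J : Rintegral (leb R) setT (fun x => abs2 (fourier g (x + d) - fourier g x) *
      ind (l i) (l (i + n%:Z)) x) <= 4 * pi ^+ 2 * d ^+ 2 * fine B.
    rewrite -lee_fin (intg_integralE Iinc) EFinM fineK//; apply: le_trans inc.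
    apply: ge0_le_integral => //.
    - by move=> x _; rewrite lee_fin mulr_ge0 ?abs2_ge0 ?ind_ge0.
    - by apply/measurable_EFinP; exact: intg_meas Iinc.
    - apply/measurable_EFinP; apply: Cmeas_abs2; apply: CmeasB.
        have [hr hi] := Cmeas_fourier Ig.
        by split; [apply: measurableT_comp hr _|apply: measurableT_comp hi _];
          exact: (measurable_translation d).
      exact: Cmeas_fourier.
    - move=> x _; rewrite lee_fin ler_piMr ?abs2_ge0// /ind.
      by case: (_ <= _ < _).
  rewrite -(ler_pM2l (mulr_gt0 (ltr0n R 4 : 0 < 4) p20)) mulrDr.
  apply: le_trans Hd _; rewrite lerD2r -(ler_pM2l d20) mulrA mulfV ?gt_eqF// mul1r.
  by apply: le_trans J _; rewrite le_eqVlt; apply/orP; left; apply/eqP; ring.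
pose F (n : nat) : set R := `[l (- n%:Z), l (- n%:Z + (n + n)%:Z)[%classic.
have FE n : - n%:Z + (n + n)%:Z = n%:Z :> int by rewrite PoszD addKr.
have FT : \bigcup_n F n = setT.
  rewrite -subTset => x _.
  have /cvgryPgt/(_ x) hy := ly; have /cvgrNyPle/(_ x) hNy := lNy.
  have [n [h1 h2]] := filter_ex (filterI hy hNy).
  by exists n => //; rewrite /F /= in_itv /= FE h1 h2.
have mono (i j : int) : i <= j -> l i <= l j.
  move=> ij; have := bi_infinite_mono Hl i `|j - i|%N.
  by rewrite (_ : i + `|j - i|%N%:Z = j)//; lia.
have nd : nondecreasing_seq F.
  move=> n n' nn'; apply/subsetPset => x; rewrite /F /= !in_itv/= !FE => /andP[h1 h2].
  rewrite (le_trans _ h1) ?(lt_le_trans h2)//; apply: mono; lia.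
have mF n : measurable (F n) by exact: measurable_itv.
have mFf n : measurable_fun (F n) (fun x => (V x ^+ 2 * abs2 (fourier g x))%:E).
  by apply: measurable_funTS; exact/measurable_EFinP.
have f0 n x : F n x -> (0 <= (V x ^+ 2 * abs2 (fourier g x))%:E)%E.
  by move=> _; rewrite lee_fin mulr_ge0 ?sqr_ge0 ?abs2_ge0.
have := @ge0_nondecreasing_set_cvg_integral _ (measurableTypeR R) R F _
  (lebesgue_measure : measure _ R) nd mF mFf f0.
rewrite FT => H; apply: (cvge_le _ H).
by apply: nearW => n; exact: bnd.
Qed.

End Wirtinger.

(** * Convex profiles *)

Section Profile.
Variable R : realType.

(** A convex function [s] with its inverse [t]; [s'] is a choice of slopes, [p] a
    lower bound for them and [c] their exponential rate of growth. *)
Record profile (s s' t : R -> R) (c p : R) : Prop := Profile {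
  profile0 : s 0 = 0;
  profile_tangent : forall x b : R, 0 <= x -> 0 <= b -> s b + s' b * (x - b) <= s x;
  profile_slope_gt0 : 0 < p;
  profile_slope : forall b : R, 0 <= b -> p <= s' b;
  profile_rate : 0 <= c;
  profile_growth : forall y b : R, 0 <= y -> y <= b -> s' b <= s' y * expR (c * (b - y));
  profile_continuous : forall d : R, 0 <= d -> continuous (fun x : R => s (`|x| + d));
  profile_inv_ge0 : forall y : R, 0 <= y -> 0 <= t y;
  profile_inv : forall y : R, 0 <= y -> s (t y) = y }.

Lemma expR_ge_id (x : R) : x <= expR x.
Proof. by apply: le_trans (expR_ge1Dx x); rewrite lerDr. Qed.

Lemma expR_ge_sqr (x : R) : 0 <= x -> x ^+ 2 <= 4 * expR x.
Proof.
move=> x0; have h := expR_ge1Dx (x / 2).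
have -> : expR x = expR (x / 2) ^+ 2 by rewrite expr2 -expRD -splitr.
by have : 0 <= expR (x / 2) by [exact: expR_ge0]; nra.
Qed.

Variables (s s' t : R -> R) (c p : R).
Hypothesis P : profile s s' t c p.

Let s0 := profile0 P.
Let tan := profile_tangent P.
Let p0 := profile_slope_gt0 P.
Let slope := profile_slope P.
Let c0 := profile_rate P.
Let growth := profile_growth P.
Let t0 := profile_inv_ge0 P.
Let tK := profile_inv P.

Lemma slope_ge0 b : 0 <= b -> 0 <= s' b.
Proof. by move=> b0; exact: le_trans (ltW p0) (slope b0). Qed.

Lemma profile_mono x y : 0 <= x -> x <= y -> s x <= s y.
Proof.
move=> x0 xy; have := tan (le_trans x0 xy) x0; apply: le_trans.
by rewrite lerDl mulr_ge0 ?subr_ge0// slope_ge0.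
Qed.

Lemma profile_ge0 x : 0 <= x -> 0 <= s x.
Proof. by move=> x0; rewrite -s0; exact: profile_mono. Qed.

Lemma profile_inv_lip y z : 0 <= y -> y <= z -> p * (t z - t y) <= z - y.
Proof.
move=> y0 yz; have z0 := le_trans y0 yz.
have := tan (t0 z0) (t0 y0); rewrite !tK// => h.
case: (leP (t y) (t z)) => tyz.
  apply: (@le_trans _ _ (s' (t y) * (t z - t y))); last by lra.
  by rewrite ler_wpM2r ?subr_ge0// slope// t0.
by rewrite (@le_trans _ _ 0) ?subr_ge0// nmulr_lle0 ?subr_lt0// ltW.
Qed.

Lemma profile_inv_mono y z : 0 <= y -> y <= z -> t y <= t z.
Proof.
move=> y0 yz; have z0 := le_trans y0 yz; rewrite leNgt; apply/negP => tzy.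
have := tan (t0 y0) (t0 z0); rewrite !tK// => h.
have : 0 < s' (t z) * (t y - t z).
  by rewrite mulr_gt0 ?subr_gt0// (lt_le_trans p0)// slope// t0.
by lra.
Qed.

Lemma profile_inv_gt0 y : 0 < y -> 0 < t y.
Proof.
move=> y0; rewrite lt_def t0 ?ltW// andbT; apply/eqP => ty.
by have := tK (ltW y0); rewrite ty s0 => y00; rewrite -y00 ltxx in y0.
Qed.

Lemma profile_inv_continuous d : 0 <= d -> continuous (fun x : R => t (`|x| + d)).
Proof.
move=> d0 x; apply/cvgrPdist_le => e e0.
have pe0 : 0 < p * e by exact: mulr_gt0.
have Hz : \forall z \near x, `|x - z| <= p * e by exists (p * e) => // w /ltW.
near=> z.
have lip (y y' : R) : 0 <= y -> 0 <= y' -> `|t y - t y'| <= p^-1 * `|y - y'|.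
  wlog : y y' / y <= y'.
    move=> H y0 y'0; case: (leP y y') => yy'; first exact: H.
    by rewrite distrC [X in _ * X]distrC; apply: H => //; exact: ltW.
  move=> yy' y0 y'0; rewrite ler_pdivlMl//.
  rewrite distrC [X in _ <= X]distrC !ger0_norm ?subr_ge0 ?profile_inv_mono//.
  exact: profile_inv_lip.
have zx : `|x - z| <= p * e.
  by near: z.
apply: le_trans (lip _ _ _ _) _; try by rewrite addr_ge0.
rewrite ler_pdivrMl//; apply: le_trans zx.
by rewrite opprD addrACA subrr addr0 ler_dist_dist.
Unshelve. all: by end_near. Qed.

(** The tangent at [x + r] and the growth of the slopes give
    [s (x + r) <= s x + s' x * r * expR (c * r)]; the polynomial factors of the square
    are absorbed by one more exponential. *)
Lemma profile_shift x r : 0 <= x -> 0 <= r ->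
  s (x + r) ^+ 2 <= s x ^+ 2 +
    4 * (s x * s' x + s' x ^+ 2) * expR ((2 * c + 1) * r).
Proof.
move=> x0 r0; have xr0 : 0 <= x + r by rewrite addr_ge0.
have h1 := tan x0 xr0; have xxr : x <= x + r by rewrite lerDl.
have h2 : s' (x + r) <= s' x * expR (c * r).
  by have := growth x0 xxr; rewrite addrAC subrr add0r.
have sx := profile_ge0 x0; have s'x := slope_ge0 x0.
have sxr := profile_ge0 xr0.
set e := expR (c * r) in h2; have e1 : 1 <= e.
  by rewrite /e -expR0 ler_expR mulr_ge0.
have ub : s (x + r) <= s x + s' x * (r * e).
  have : r * s' (x + r) <= r * (s' x * e) by rewrite ler_wpM2l.
  move: h1; rewrite (_ : x - (x + r) = - r); last by ring.
  lra.
have re0 : 0 <= r * e by rewrite mulr_ge0// (le_trans ler01).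
have E : expR ((2 * c + 1) * r) = e ^+ 2 * expR r.
  by rewrite /e expr2 -!expRD; congr expR; ring.
have er : r * e <= e ^+ 2 * expR r.
  rewrite mulrC expr2 -mulrA ler_wpM2l ?(le_trans ler01)//.
  apply: le_trans (expR_ge_id r) _; rewrite ler_peMl ?expR_ge0//.
have er2 : (r * e) ^+ 2 <= 4 * (e ^+ 2 * expR r).
  rewrite exprMn [leRHS]mulrCA [leLHS]mulrC ler_wpM2l ?sqr_ge0//.
  exact: expR_ge_sqr.
rewrite E; set G := e ^+ 2 * expR r in er er2 *.
apply: (@le_trans _ _ ((s x + s' x * (r * e)) ^+ 2)).
  by rewrite ler_pXn2r ?nnegrE// addr_ge0// mulr_ge0.
have G0 : 0 <= G by exact: le_trans re0 er.
have a1 : s x * s' x * (r * e) <= s x * s' x * G by rewrite ler_wpM2l// mulr_ge0.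
have a2 : s' x ^+ 2 * (r * e) ^+ 2 <= s' x ^+ 2 * (4 * G) by rewrite ler_wpM2l// sqr_ge0.
have a3 : 0 <= s x * s' x * G by rewrite mulr_ge0// mulr_ge0.
by rewrite sqrrD exprMn; lra.
Qed.

(** The square of a nonnegative convex function vanishing at the origin is a
    convex function of the square of the variable. *)
Lemma profile_sqr_tangent x b : 0 <= x -> 0 < b ->
  s b ^+ 2 + s b * s' b / b * x ^+ 2 <= s x ^+ 2 + s b * s' b / b * b ^+ 2.
Proof.
move=> x0 b0; have tx := tan x0 (ltW b0); have sx := profile_ge0 x0.
have sb := profile_ge0 (ltW b0); have s'b := slope_ge0 (ltW b0).
have qb : s b <= s' b * b.
  by have := tan (lexx 0) (ltW b0); rewrite s0 sub0r; lra.
have s'b0 : 0 < s' b by rewrite (lt_le_trans p0)// slope// ltW.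
move: (s b) (s' b) (s x) tx sx sb s'b qb s'b0 => q k y tx y0 q0 k0 qkb k00.
rewrite -subr_ge0.
have -> : y ^+ 2 + q * k / b * b ^+ 2 - (q ^+ 2 + q * k / b * x ^+ 2) =
   (y ^+ 2 - (q ^+ 2 + q * (k * (x - b)) * 2 + q * (k * (x - b) ^+ 2) / b)) .
  by field; rewrite gt_eqF.
have h : q * (k * (x - b) ^+ 2) / b <= k ^+ 2 * (x - b) ^+ 2.
  rewrite ler_pdivrMr//.
  have -> : k ^+ 2 * (x - b) ^+ 2 * b = (k * b) * (k * (x - b) ^+ 2) by ring.
  by rewrite ler_wpM2r// mulr_ge0// sqr_ge0.
case: (leP 0 (q + k * (x - b))) => hs.
  have : (q + k * (x - b)) ^+ 2 <= y ^+ 2 by rewrite ler_pXn2r ?nnegrE.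
  rewrite sqrrD exprMn; lra.
(* On this branch the tangent is negative at [x], so it cannot be squared; but then
   [x < b - q / k], and the right-hand side is itself nonpositive. *)
have kx : k * x < k * b - q by lra.
have -> : q ^+ 2 + q * (k * (x - b)) * 2 + q * (k * (x - b) ^+ 2) / b =
  q / b * (q * b + k * x ^+ 2 - k * b ^+ 2) by field; rewrite gt_eqF.
have kxx : k * x ^+ 2 <= (k * b - q) * x by rewrite expr2 mulrA ler_wpM2r// ltW.
have xb : x <= b by nra.
have : q / b * (q * b + k * x ^+ 2 - k * b ^+ 2) <= 0.
  rewrite mulr_ge0_le0 ?divr_ge0 ?(ltW b0)//; nra.
have := sqr_ge0 y; lra.
Qed.

(** The expression [A ^+ 2 + B * (t X ^+ 2 - t A ^+ 2)] is the tangent at [A] of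
    [X ^+ 2] as a function of [t X ^+ 2]; it lies below [X ^+ 2] by convexity. The
    lemma bounds the deficit: the growth of the slopes limits it to an exponential
    in [`|xi - a|], with a factor that is only linear in [X]. *)
Lemma profile_bracket (kap : R) (a xi d A X B : R) : 0 < d -> c / p + 1 <= kap ->
  A = `|a| + d -> X = `|xi| + d -> B = s (t A) * s' (t A) / t A ->
  X ^+ 2 + B * t A ^+ 2 <=
  A ^+ 2 + B * t X ^+ 2 + (4 * X + 12) * expR (kap * `|xi - a|).
Proof.
move=> d0 hk AE XE BE'; set r := `|xi - a|.
have A0 : 0 < A by rewrite AE ltr_wpDl.
have X0 : 0 < X by rewrite XE ltr_wpDl.
have b0 := profile_inv_gt0 A0; have y0 := profile_inv_gt0 X0.
have r0 : 0 <= r by exact: normr_ge0.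
have rXA : `|X - A| <= r by rewrite XE AE opprD addrACA subrr addr0 ler_dist_dist.
set e := expR (c / p * r).
have e1 : 1 <= e by rewrite /e -expR0 ler_expR !mulr_ge0// invr_ge0 ltW.
have BE : B = A * s' (t A) / t A by rewrite BE' tK// ltW.
have s'A := slope_ge0 (ltW b0); have s'X := slope_ge0 (ltW y0).
have B0 : 0 <= B by rewrite BE divr_ge0 ?(ltW b0)// mulr_ge0 ?(ltW A0).
have er : r * e <= expR (kap * r).
  apply: (@le_trans _ _ (expR r * e)).
    by rewrite ler_wpM2r ?expR_ge_id// expR_ge0.
  by rewrite -expRD ler_expR -[X in X + _]mul1r -mulrDl ler_wpM2r// addrC.
have er2 : r ^+ 2 * e <= 4 * expR (kap * r).
  apply: (@le_trans _ _ (4 * expR r * e)).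
    by rewrite ler_wpM2r ?expR_ge_sqr// expR_ge0.
  rewrite -mulrA ler_wpM2l// -expRD ler_expR -[X in X + _]mul1r -mulrDl.
  by rewrite ler_wpM2r// addrC.
have main : B * t A ^+ 2 - B * t X ^+ 2 <= 2 * A * r * e.
  have rhs0 : 0 <= 2 * A * r * e.
    by rewrite !mulr_ge0 ?(ltW A0)// (le_trans ler01).
  case: (leP A X) => AX.
    rewrite -mulrBr (le_trans _ rhs0)// mulr_ge0_le0// subr_le0.
    by rewrite ler_pXn2r ?nnegrE ?(ltW b0) ?(ltW y0)// profile_inv_mono// ltW.
  have XA := ltW AX.
  have yb : t X <= t A by rewrite profile_inv_mono// ltW.
  have tl := tan (ltW b0) (ltW y0); rewrite (tK (ltW A0)) (tK (ltW X0)) in tl.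
  have AXr : A - X <= r by have := rXA; rewrite distrC ger0_norm ?subr_ge0.
  have lip := profile_inv_lip (ltW X0) XA.
  have g := growth (ltW y0) yb.
  have eb : expR (c * (t A - t X)) <= e.
    rewrite ler_expR -mulrA ler_wpM2l// ler_pdivlMl//.
    exact: le_trans lip AXr.
  have k1 : s' (t A) * (t A - t X) <= r * e.
    apply: (@le_trans _ _ (s' (t X) * (t A - t X) * e)).
      rewrite mulrAC; apply: ler_wpM2r; first by rewrite subr_ge0.
      by apply: le_trans g _; rewrite ler_wpM2l.
    apply: ler_wpM2r; first exact: expR_ge0.
    by move: tl AXr; lra.
  have -> : B * t A ^+ 2 - B * t X ^+ 2 =
      A * (s' (t A) * (t A - t X)) * ((t A + t X) / t A).
    by rewrite BE; field; rewrite gt_eqF.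
  have q2 : (t A + t X) / t A <= 2 by rewrite ler_pdivrMr//; lra.
  have u0 : 0 <= A * (s' (t A) * (t A - t X)).
    by rewrite mulr_ge0 ?(ltW A0)// mulr_ge0// subr_ge0.
  apply: (@le_trans _ _ (A * (s' (t A) * (t A - t X)) * 2)); first by rewrite ler_wpM2l.
  rewrite mulrC -!mulrA ler_wpM2l// ler_wpM2l// ltW//.
have Ab : A <= X + r by have := rXA; rewrite ler_distl => /andP[]; lra.
have m2 : 2 * A * r * e <= 2 * X * (r * e) + 2 * (r ^+ 2 * e).
  have : A * (r * e) <= (X + r) * (r * e).
    by rewrite ler_wpM2r// mulr_ge0// (le_trans ler01).
  lra.
have m3 : X ^+ 2 - A ^+ 2 <= 2 * X * (r * e) + r ^+ 2 * e.
  have XA' : X - A <= r by exact: le_trans (ler_norm _) rXA.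
  have re : r <= r * e by rewrite ler_peMr.
  have re2 : r ^+ 2 <= r ^+ 2 * e by rewrite ler_peMr ?sqr_ge0.
  have : X ^+ 2 - A ^+ 2 <= 2 * X * r + r ^+ 2.
    case: (leP X A) => XA.
      have : X ^+ 2 <= A ^+ 2 by rewrite ler_pXn2r ?nnegrE ?(ltW X0) ?(ltW A0).
      have : 0 <= X * r by rewrite mulr_ge0// ltW.
      by have := sqr_ge0 r; lra.
    have : 0 <= (X - A) * (X + A) by rewrite mulr_ge0 ?subr_ge0 ?(ltW XA)// addr_ge0// ltW.
    have : (X - A) * (X + A) <= r * (X + A).
      by rewrite ler_wpM2r// addr_ge0// ltW.
    have : r * A <= r * (X + r) by rewrite ler_wpM2l.
    lra.
  have : X * r <= X * (r * e) by rewrite ler_wpM2l// ltW.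
  lra.
have f1 : X * (r * e) <= X * expR (kap * r) by rewrite ler_wpM2l// ltW.
by move: main m2 m3 f1 er2; lra.
Qed.

End Profile.

(** * Gaussian wave packets *)

Section Window.
Variable R : realType.

(** Its own Fourier transform, and of square integral one. *)
Definition chi (t : R) := Num.sqrt (Num.sqrt 2) * gaussian 1 t.

Definition gam : R -> R := heat 2^-1.

Lemma chi_ge0 t : 0 <= chi t.
Proof. by rewrite mulr_ge0 ?sqrtr_ge0 ?gaussian_ge0. Qed.

Lemma chi_sqr t : chi t ^+ 2 = gam t.
Proof.
rewrite /chi /gam /heat exprMn sqr_sqrtr ?sqrtr_ge0// sqrtrV// !invrK.
congr (_ * _); rewrite expr2 /gaussian -expRD; congr expR; ring.
Qed.

Lemma continuous_chi : continuous chi.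
Proof. by move=> x; apply: cvgM; [exact: cvg_cst|exact: continuous_gaussian]. Qed.

Lemma measurable_chi : measurable_fun setT chi.
Proof. by apply: continuous_measurable_fun; exact: continuous_chi. Qed.

Lemma intg_chi : intg chi.
Proof. by apply: intgZ; apply: intg_gaussian. Qed.

Lemma chi_le t : chi t <= Num.sqrt (Num.sqrt 2).
Proof. by rewrite /chi ler_piMr ?sqrtr_ge0// gaussian_le1. Qed.

Lemma fourier_chi y : fourier (fun t => (chi t)%:C) y = (chi y)%:C.
Proof.
rewrite fourierE /chi.
have realM (u v : R) : (u * v)%:C = u%:C * v%:C :> R[i].
  by apply: complexP; rewrite ?CReM ?CImM /= ?mulr0 ?mul0r ?subr0 ?addr0.
under eq_fun do rewrite realM -mulrA.
rewrite CintegralZ; last by apply: fourier_Cintg; apply: Cintg_real; apply: intg_gaussian.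
by rewrite -fourierE fourier_gaussian// sqrtr1 invr1 mul1r -realM.
Qed.

Lemma gam_ge0 t : 0 <= gam t. Proof. exact: heat_ge0. Qed.

Lemma inv2_gt0 : 0 < 2^-1 :> R. Proof. by rewrite invr_gt0. Qed.

(** What a weight of exponential growth can gain by being averaged over the
    window. *)
Definition moment (k : R) := Rintegral (leb R) setT (fun t => expR (k * `|t|) * gam t).

Lemma intg_moment k : intg (fun t => expR (k * `|t|) * gam t).
Proof.
rewrite /gam /heat; under eq_fun do rewrite mulrCA.
by apply: intgZ; apply: intg_exp_gaussian; rewrite invrK.
Qed.

Lemma moment_ge1 k : 0 <= k -> 1 <= moment k.
Proof.
move=> k0; have <- : Rintegral (leb R) setT gam = 1.
  by rewrite /Rintegral integral_heat// inv2_gt0.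
apply: le_Rintegral => //.
- exact: intg_heat inv2_gt0.
- exact: intg_moment.
- move=> t _; rewrite ler_peMl ?gam_ge0// -expR0 ler_expR mulr_ge0//.
Qed.

Lemma integral_moment k x :
  (\int[leb R]_y (expR (k * `|y - x|) * gam (y - x))%:E = (moment k)%:E)%E.
Proof.
rewrite (@ge0_integral_shift _ (- x) (fun y => (expR (k * `|y|) * gam y)%:E)).
- by rewrite /moment (intg_integralE (intg_moment k)).
- by apply/measurable_EFinP; exact: intg_meas (intg_moment k).
- by move=> y; rewrite lee_fin mulr_ge0 ?expR_ge0 ?gam_ge0.
Qed.

Lemma measurable_gam_diff : measurable_fun setT (fun p : R * R => gam (p.2 - p.1)).
Proof. exact: measurable_heat_diff. Qed.

Lemma gam_sym x y : gam (x - y) = gam (y - x).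
Proof. by rewrite /gam -heatN opprB. Qed.

End Window.

Section Packet.
Variables (R : realType) (f : R -> R[i]).
Hypotheses (If : Cintg f) (Ih : Cintg (fourier f)).
Hypotheses (cr : continuous (fun x => Re (f x))) (ci : continuous (fun x => Im (f x))).

Definition packet (a xi : R) : R[i] := (chi (xi - a))%:C * fourier f xi.

(** The conjugate of the inverse transform of the packet; the conjugation leaves
    only the direct transform in the definition. *)
Definition dual_packet (a : R) : R -> R[i] := fourier (fun xi => conjc (packet a xi)).

Lemma Cmeas_chi_shift a : Cmeasurable (fun xi : R => (chi (xi - a))%:C).
Proof.
apply: Cmeas_real; apply: measurableT_comp; first exact: measurable_chi.
exact: measurable_funB.
Qed.

Lemma Cintg_chi_shift a : Cintg (fun xi : R => (chi (xi - a))%:C).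
Proof. apply: Cintg_real; exact: (intg_shift (- a) (@intg_chi R)). Qed.

Lemma Cintg_packet a : Cintg (packet a).
Proof.
rewrite /packet; under eq_fun do rewrite mulrC.
apply: (CintgM_bounded (C := Num.sqrt (Num.sqrt 2)) Ih); first exact: Cmeas_chi_shift.
by move=> xi; rewrite normc_real ger0_norm ?chi_ge0// chi_le.
Qed.

Lemma Cintg_window x : Cintg (fun y => f y * (chi (y - x))%:C).
Proof.
apply: (CintgM_bounded (C := Num.sqrt (Num.sqrt 2)) If); first exact: Cmeas_chi_shift.
by move=> xi; rewrite normc_real ger0_norm ?chi_ge0// chi_le.
Qed.

(** Up to a phase and conjugation, the dual packet is, as a function of its centre [a],
    the Fourier transform of a windowed [f]. *)
Lemma dual_packetE a x : dual_packet a x =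
  conjc (expi (2 * pi * a * x) * fourier (fun y => f y * (chi (y - x))%:C) a).
Proof.
have mph (b : R) : measurable_fun setT (fun xi : R => 2 * pi * xi * b).
  by apply: measurable_funM => //; apply: measurable_funM.
have Iw : Cintg (fun xi => (chi (xi - a))%:C * expi (2 * pi * xi * x)).
  by apply: Cintg_phase => //; exact: Cintg_chi_shift.
have -> : dual_packet a x =
    conjc (Cintegral (fun xi => fourier f xi * ((chi (xi - a))%:C * expi (2 * pi * xi * x)))).
  rewrite -CintegralJ; last first.
    rewrite (_ : (fun xi => _) = fun xi => packet a xi * expi (2 * pi * xi * x)).
      by apply: Cintg_phase => //; exact: Cintg_packet.
    by apply/funext => xi; rewrite /packet mulrA (mulrC (fourier _ _)).
  apply: eq_Cintegral => xi; rewrite /packet !Cconj_mul expiJ mulrA.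
  by rewrite (mulrC (conjc (fourier _ _))).
congr conjc; rewrite fourier_multiplication// fourierE -CintegralZ; last first.
  by apply: fourier_Cintg; exact: Cintg_window.
apply: eq_Cintegral => y.
rewrite (fourier_translate_modulate _ _ _ (Cintg_real (@intg_chi R))) fourier_chi.
rewrite (_ : - (2 * pi * a * (y - x)) = 2 * pi * a * x + - (2 * pi * y * a)); last by ring.
rewrite expiD; move: (expi _) (expi _) (f y) (_%:C) => e e' z w.
ring.
Qed.

Lemma abs2_dual_packet a x :
  abs2 (dual_packet a x) = abs2 (fourier (fun y => f y * (chi (y - x))%:C) a).
Proof.
rewrite dual_packetE abs2_conj abs2M [X in X * _](_ : _ = 1) ?mul1r//.
by rewrite /abs2 normc_expi expr1n.
Qed.

(** Bessel's inequality in the variable [a], by [dual_packetE]. *)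
Lemma dual_packet_marginal x :
  (\int[leb R]_a (abs2 (dual_packet a x))%:E <=
   \int[leb R]_y (abs2 (f y) * gam (y - x))%:E)%E.
Proof.
under eq_integral do rewrite abs2_dual_packet.
apply: le_trans (bessel (Cintg_window x)) _.
rewrite le_eqVlt; apply/orP; left; apply/eqP; apply: eq_integral => y _.
by rewrite abs2M -chi_sqr /abs2 normc_real real_normK ?num_real.
Qed.

Lemma Cmeas_dual_packet a : Cmeasurable (dual_packet a).
Proof. by apply: Cmeas_fourier; apply: CintgJ; exact: Cintg_packet. Qed.

(** By [dual_packetE], the modulus is at most the convolution of [normc \o f] with
    [chi]. *)
Lemma Cintg_dual_packet a : Cintg (dual_packet a).
Proof.
have mq := Cmeas_dual_packet a.
have mnf : measurable_fun setT (fun y => normc (f y)) := Cmeas_normc (Cintg_meas If).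
pose k (p : R * R) := normc (f p.2) * chi (p.2 - p.1).
have mk : measurable_fun setT k.
  apply: measurable_funM; first exact: (measurable_snd_comp mnf).
  apply: measurableT_comp; first exact: measurable_chi.
  by apply: measurable_funB; [exact: measurable_snd|exact: measurable_fst].
have k0 p : 0 <= k p by rewrite mulr_ge0 ?normc_ge0 ?chi_ge0.
have Ichi y : (\int[leb R]_x (chi (y - x))%:E = (Rintegral (leb R) setT (@chi R))%:E)%E.
  rewrite (intg_integralE (@intg_chi R)).
  transitivity (\int[leb R]_x (chi (x + - y)%R)%:E)%E.
    by apply: eq_integral => x _; rewrite /chi -gaussianN opprB.
  apply: (@ge0_integral_shift _ (- y) (fun x => (chi x)%:E)).
  - by apply/measurable_EFinP; exact: measurable_chi.
  - by move=> x; rewrite lee_fin chi_ge0.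
have fin : (\int[leb R]_x (normc (dual_packet a x))%:E < +oo)%E.
  apply: (@le_lt_trans _ _ (\int[leb R]_x \int[leb R]_y (k (x, y))%:E)%E).
    apply: ge0_le_integral => //.
    - by move=> x _; rewrite lee_fin normc_ge0.
    - by apply/measurable_EFinP; exact: Cmeas_normc.
    - exact: measurable_tonelli.
    - move=> x _; rewrite dual_packetE Cnormc_conj ComplexField.Normc.normcM normc_expi mul1r.
      have := normc_fourier a (Cintg_window x); rewrite -lee_fin => h.
      apply: le_trans h _; rewrite (intg_integralE (Cintg_normc (Cintg_window x))).
      rewrite le_eqVlt; apply/orP; left; apply/eqP; apply: eq_integral => y _.
      by rewrite ComplexField.Normc.normcM normc_real (ger0_norm (chi_ge0 _)).
  rewrite tonelli//.
  have -> : (\int[leb R]_y \int[leb R]_x (k (x, y))%:E =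
     \int[leb R]_y ((Rintegral (leb R) setT (@chi R))%:E * (normc (f y))%:E))%E.
    apply: eq_integral => y _; rewrite /k /=; under eq_integral do rewrite EFinM.
    rewrite ge0_integralZl//; last 3 first.
    - apply/measurable_EFinP; apply: measurableT_comp; first exact: measurable_chi.
      exact: measurable_funB.
    - by move=> x _; rewrite lee_fin chi_ge0.
    - by rewrite lee_fin normc_ge0.
    by rewrite Ichi muleC.
  have c0 : 0 <= Rintegral (leb R) setT (@chi R).
    by apply: Rintegral_ge0 => x _; exact: chi_ge0.
  rewrite ge0_integralZl//; last 2 first.
  - exact/measurable_EFinP.
  - by move=> x _; rewrite lee_fin normc_ge0.
  rewrite -(intg_integralE (Cintg_normc If)) -EFinM ltry//.
apply: (Cintg_dom mq _ (fun x => lexx _)).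
by apply: ge0_intgE => //; [exact: Cmeas_normc|move=> x; exact: normc_ge0].
Qed.

Lemma fourier_dual_packet a xi : fourier (fun x => conjc (dual_packet a x)) xi = packet a xi.
Proof.
have ch := continuous_fourier_Re If; have ch' := continuous_fourier_Im If.
have cchi : continuous (fun xi : R => chi (xi - a)).
  by apply: continuous_shiftR; exact: continuous_chi.
have E := fourier_inversion (g := fun xi => conjc (packet a xi)) xi.
rewrite /dual_packet E ?Cconj_conj//.
- by apply: CintgJ; exact: Cintg_packet.
- exact: Cintg_dual_packet.
- rewrite (_ : (fun x => _) = fun x => chi (x - a) * Re (fourier f x)).
    by move=> x; apply: cvgM; [exact: cchi|exact: ch].
  by apply/funext => x; rewrite /packet !RIE /= mul0r subr0.
- rewrite (_ : (fun x => _) = fun x => - (chi (x - a) * Im (fourier f x))).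
    by move=> x; apply: cvgN; apply: cvgM; [exact: cchi|exact: ch'].
  by apply/funext => x; rewrite /packet !RIE /= mul0r addr0.
Qed.

Lemma abs2_packet a xi : abs2 (packet a xi) = gam (xi - a) * abs2 (fourier f xi).
Proof. by rewrite abs2M -chi_sqr /abs2 normc_real real_normK ?num_real. Qed.

(** Each of the two functions is the transform of the conjugate of the other, so
    Bessel's inequality applies in both directions. *)
Lemma packet_norm a :
  (\int[leb R]_x (abs2 (dual_packet a x))%:E = \int[leb R]_xi (abs2 (packet a xi))%:E)%E.
Proof.
apply/eqP; rewrite eq_le; apply/andP; split.
- have := bessel (CintgJ (Cintg_packet a)).
  by under [X in (_ <= X)%E]eq_integral do rewrite abs2_conj.
- have := bessel (CintgJ (Cintg_dual_packet a)).
  rewrite (funext (fourier_dual_packet a)).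
  by under [X in (_ <= X)%E]eq_integral do rewrite abs2_conj.
Qed.

End Packet.

(** * Uniqueness for a profile *)

Section ParametricMeasurability.
Variable R : realType.

Lemma measurable_Rintegral_param (k : (R * R) * R -> R) : measurable_fun setT k ->
  measurable_fun setT (fun z => Rintegral (leb R) setT (fun y => k (z, y))).
Proof.
move=> mk; rewrite /Rintegral.
apply: measurableT_comp; first exact: fine_measurable.
pose K (q : (R * R) * R) := (k q)%:E.
have mK : measurable_fun setT K by exact/measurable_EFinP.
rewrite (_ : (fun z => _) = (fun z => \int[leb R]_y (K^\+ (z, y)) - \int[leb R]_y (K^\- (z, y)))%E).
  apply: emeasurable_funB.
  - apply: (@measurable_fun_fubini_tonelli_F _ _ (R * R)%type _ _ (leb R) (K^\+)%E) => //.
    exact: measurable_funepos.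
  - apply: (@measurable_fun_fubini_tonelli_F _ _ (R * R)%type _ _ (leb R) (K^\-)%E) => //.
    exact: measurable_funeneg.
apply/funext => z; rewrite integralE.
by congr (_ - _)%E; apply: eq_integral => y _; rewrite ?funeposE ?funenegE.
Qed.

(** Joint measurability comes from [abs2_dual_packet], which writes the modulus
    through an integral depending on the parameters [a] and [x]. *)
Lemma measurable_dual_packet (f : R -> R[i]) : Cintg f -> Cintg (fourier f) ->
  measurable_fun setT (fun p : R * R => abs2 (dual_packet f p.1 p.2)).
Proof.
move=> If Ih.
pose T := ((R * R) * R)%type.
have mfst : measurable_fun setT (fun z : T => z.1).
  exact: measurable_fst.
have m1 : measurable_fun setT (fun z : T => z.1.1).
  by apply: measurableT_comp mfst.
have m2 : measurable_fun setT (fun z : T => z.1.2).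
  by apply: measurableT_comp mfst.
have m3 : measurable_fun setT (fun z : T => z.2).
  exact: measurable_snd.
have [fr fi] := Cintg_meas If.
pose F (z : T) := f z.2 * (chi (z.2 - z.1.2))%:C * expi (- (2 * pi * z.2 * z.1.1)).
have mchi : measurable_fun setT (fun z : T => chi (z.2 - z.1.2)).
  by apply: measurableT_comp; [exact: measurable_chi|exact: measurable_funB].
have mph : measurable_fun setT (fun z : T => - (2 * pi * z.2 * z.1.1)).
  by apply: measurableT_comp => //; apply: measurable_funM => //; apply: measurable_funM.
have mc : measurable_fun setT (fun z : T => cos (- (2 * pi * z.2 * z.1.1))).
  by apply: measurableT_comp mph; apply: continuous_measurable_fun; exact: continuous_cos.
have ms : measurable_fun setT (fun z : T => sin (- (2 * pi * z.2 * z.1.1))).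
  by apply: measurableT_comp mph; apply: continuous_measurable_fun; exact: continuous_sin.
have mfr : measurable_fun setT (fun z : T => Re (f z.2)) by exact: measurableT_comp fr m3.
have mfi : measurable_fun setT (fun z : T => Im (f z.2)) by exact: measurableT_comp fi m3.
have mr : measurable_fun setT (fun z => Re (F z)).
  rewrite (_ : (fun z => _) = fun z : T =>
    Re (f z.2) * chi (z.2 - z.1.2) * cos (- (2 * pi * z.2 * z.1.1)) -
    Im (f z.2) * chi (z.2 - z.1.2) * sin (- (2 * pi * z.2 * z.1.1))).
    by apply: measurable_funB; apply: measurable_funM => //; apply: measurable_funM.
  by apply/funext => z; rewrite /F !RIE /= !mulr0 subr0 add0r.
have mi : measurable_fun setT (fun z => Im (F z)).
  rewrite (_ : (fun z => _) = fun z : T =>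
    Re (f z.2) * chi (z.2 - z.1.2) * sin (- (2 * pi * z.2 * z.1.1)) +
    Im (f z.2) * chi (z.2 - z.1.2) * cos (- (2 * pi * z.2 * z.1.1))).
    by apply: measurable_funD; apply: measurable_funM => //; apply: measurable_funM.
  by apply/funext => z; rewrite /F !RIE /= !mulr0 subr0 add0r.
rewrite (_ : (fun p : R * R => _) = fun p : R * R =>
  Rintegral (leb R) setT (fun y => Re (F (p, y))) ^+ 2 +
  Rintegral (leb R) setT (fun y => Im (F (p, y))) ^+ 2).
  apply: measurable_funD; apply: measurable_funX.
  - exact: (measurable_Rintegral_param mr).
  - exact: (measurable_Rintegral_param mi).
by apply/funext => -[a x]; rewrite abs2_dual_packet// abs2E.
Qed.

Lemma ge0_integralZ (u : R -> R) (x : R) : measurable_fun setT u ->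
  (forall z, 0 <= u z) -> 0 <= x ->
  (\int[leb R]_z (x * u z)%:E = x%:E * \int[leb R]_z (u z)%:E)%E.
Proof.
move=> mu u0 x0; under eq_integral do rewrite EFinM.
rewrite ge0_integralZl//; last by move=> z _; rewrite lee_fin.
exact/measurable_EFinP.
Qed.

Lemma ge0_integral_lin (u v : R -> R) (x y : R) : measurable_fun setT u ->
  measurable_fun setT v -> (forall z, 0 <= u z) -> (forall z, 0 <= v z) ->
  0 <= x -> 0 <= y ->
  (\int[leb R]_z (x * u z + y * v z)%:E =
   x%:E * \int[leb R]_z (u z)%:E + y%:E * \int[leb R]_z (v z)%:E)%E.
Proof.
move=> mu mv u0 v0 x0 y0; under eq_integral do rewrite EFinD.
rewrite ge0_integralD//; last 4 first.
- by move=> z _; rewrite lee_fin mulr_ge0.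
- by apply/measurable_EFinP; apply: measurable_funM.
- by move=> z _; rewrite lee_fin mulr_ge0.
- by apply/measurable_EFinP; apply: measurable_funM.
by rewrite !ge0_integralZ.
Qed.

End ParametricMeasurability.

Section Core.
Variables (R : realType) (s s' t : R -> R) (c p : R).
Hypothesis P : profile s s' t c p.

Let kap := 2 * c + c / p + 1.
Let N := moment kap.
(** The factor 8 lets [(`|xi| + d) ^+ 2] exceed [xi ^+ 2] by more than the losses
    [N * (4 * (`|xi| + d) + 12)] of [packet_energy], and [s (`|y| + d) ^+ 2] dominate
    the average in [weight_average]. *)
Definition core_shift := 8 * moment (2 * c + c / p + 1).
Let d := core_shift.

Let c0 := profile_rate P.
Let p0 := profile_slope_gt0 P.
Let cp0 : 0 <= c / p. Proof. by rewrite divr_ge0// ltW. Qed.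
Let kap0 : 0 <= kap. Proof. by rewrite /kap !addr_ge0// mulr_ge0. Qed.
Let N1 : 1 <= N. Proof. exact: moment_ge1. Qed.
Lemma core_shift_gt0 : 0 < core_shift.
Proof. by rewrite /core_shift -/kap -/N mulr_gt0// (lt_le_trans _ N1). Qed.
Let d0 : 0 < d := core_shift_gt0.
Let dE : d = 8 * N. Proof. by []. Qed.

Let mS d' : 0 <= d' -> measurable_fun setT (fun x : R => s (`|x| + d')).
Proof. by move=> h; apply: continuous_measurable_fun; exact: (profile_continuous P). Qed.

Let mS0 : measurable_fun setT (fun x : R => s `|x|).
Proof. by have := mS (lexx 0); under eq_fun do rewrite addr0. Qed.

(** Averaging the growing weight over the window costs no more than a fixed
    shift of its argument. *)
Lemma weight_average y :
  (\int[leb R]_x (s `|x| ^+ 2 * gam (y - x))%:E <= (s (`|y| + d) ^+ 2)%:E)%E.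
Proof.
set Y := `|y|; have Y0 : 0 <= Y by exact: normr_ge0.
have sY := profile_ge0 P Y0; have s'Y := slope_ge0 P Y0.
pose K := 4 * (s Y * s' Y + s' Y ^+ 2).
have K0 : 0 <= K by rewrite mulr_ge0// addr_ge0 ?sqr_ge0// mulr_ge0.
have mg : measurable_fun setT (fun x : R => gam (x - y)).
  by apply: measurableT_comp; [exact: measurable_heat|exact: measurable_funB].
have mm : measurable_fun setT (fun x : R => expR (kap * `|x - y|) * gam (x - y)).
  exact: intg_meas (intg_shift (- y) (intg_moment kap)).
apply: (@le_trans _ _ (\int[leb R]_x ((s Y ^+ 2)%:E * (gam (x - y))%:E +
   K%:E * (expR (kap * `|x - y|) * gam (x - y))%:E))%E).
  apply: ge0_le_integral => //.
  - by move=> x _; rewrite lee_fin mulr_ge0 ?sqr_ge0 ?gam_ge0.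
  - apply/measurable_EFinP; apply: measurable_funM; first exact: measurable_funX.
    by under eq_fun do rewrite gam_sym.
  - by apply: emeasurable_funD; apply/measurable_EFinP; apply: measurable_funM.
  - move=> x _; rewrite -!EFinM -EFinD lee_fin gam_sym [X in _ <= _ + X]mulrA -mulrDl.
    rewrite ler_wpM2r ?gam_ge0//.
    have := profile_shift P Y0 (normr_ge0 (x - y)); rewrite -/K => h.
    apply: (@le_trans _ _ (s (Y + `|x - y|) ^+ 2)).
      rewrite ler_pXn2r ?nnegrE ?(profile_ge0 P)// ?addr_ge0//.
      apply: (profile_mono P) => //.
      by rewrite -{1}[x](subrK y) addrC ler_normD.
    apply: le_trans h _; rewrite lerD2l ler_wpM2l// ler_expR ler_wpM2r//.
    by rewrite /kap -addrA [c / p + 1]addrC addrA lerDl.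
rewrite ge0_integralD//; last 4 first.
- by move=> x _; rewrite -EFinM lee_fin mulr_ge0 ?sqr_ge0 ?gam_ge0.
- by apply/measurable_EFinP; apply: measurable_funM.
- by move=> x _; rewrite -EFinM lee_fin mulr_ge0// mulr_ge0 ?expR_ge0 ?gam_ge0.
- by apply/measurable_EFinP; apply: measurable_funM.
rewrite ge0_integralZl//; last 3 first.
- exact/measurable_EFinP.
- by move=> x _; rewrite lee_fin gam_ge0.
- by rewrite lee_fin sqr_ge0.
rewrite ge0_integralZl//; last 2 first.
- exact/measurable_EFinP.
- by move=> x _; rewrite lee_fin mulr_ge0 ?expR_ge0 ?gam_ge0.
rewrite integral_moment integral_heat_shift ?inv2_gt0// mule1 -EFinM -EFinD lee_fin.
rewrite -/N.
have Yd0 : 0 <= Y + d by rewrite addr_ge0// ltW.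
have := profile_tangent P Yd0 Y0; rewrite addrAC subrr add0r => h.
apply: (@le_trans _ _ ((s Y + s' Y * d) ^+ 2)); last first.
  rewrite ler_pXn2r ?nnegrE ?(profile_ge0 P)//.
  by rewrite addr_ge0// mulr_ge0// ltW.
have a1 : 0 <= s Y * s' Y * N by rewrite mulr_ge0 ?mulr_ge0// (le_trans ler01).
have NN : N <= N ^+ 2 by rewrite expr2 ler_peMl// (le_trans ler01).
have a2 : s' Y ^+ 2 * N <= s' Y ^+ 2 * N ^+ 2 by rewrite ler_wpM2l ?sqr_ge0.
have a3 : 0 <= s' Y ^+ 2 * N by rewrite mulr_ge0 ?sqr_ge0// (le_trans ler01).
by rewrite dE /K sqrrD !exprMn; lra.
Qed.

Variable f : R -> R[i].
Hypotheses (If : Cintg f) (Ih : Cintg (fourier f)).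
Hypotheses (cr : continuous (fun x => Re (f x))) (ci : continuous (fun x => Im (f x))).
Variables (l m : int -> R).
Hypotheses (Hl : bi_infinite_increasing l) (Hm : bi_infinite_increasing m).
Hypotheses (fl : forall j, f (l j) = 0) (fm : forall j, fourier f (m j) = 0).
Hypothesis gapl : forall j x, l j <= x -> x <= l (j + 1) ->
  s (`|x| + d) * (l (j + 1) - l j) <= 1 / 2.
Hypothesis gapm : forall j x, m j <= x -> x <= m (j + 1) ->
  t (`|x| + d) * (m (j + 1) - m j) <= 1 / 2.
Hypothesis Hfin : (\int[leb R]_xi ((1 + xi ^+ 2) * abs2 (fourier f xi))%:E < +oo)%E.

Let H := (\int[leb R]_xi (xi ^+ 2 * abs2 (fourier f xi))%:E)%E.

Let mh : measurable_fun setT (fun xi => abs2 (fourier f xi)).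
Proof. exact: Cmeas_abs2 (Cmeas_fourier If). Qed.

Let mf : measurable_fun setT (fun x => abs2 (f x)).
Proof. exact: Cmeas_abs2 (Cintg_meas If). Qed.

(** Wirtinger's inequality for [f], seen as the conjugate of the transform of
    [conjc (fourier f)]. *)
Lemma weighted_f : (\int[leb R]_x (s (`|x| + d) ^+ 2 * abs2 (f x))%:E <= H)%E.
Proof.
have E x : fourier (fun xi => conjc (fourier f xi)) x = conjc (f x).
  exact: fourier_inversion.
have W := wirtinger (g := fun xi => conjc (fourier f xi)) (V := fun x => s (`|x| + d))
  (CintgJ Ih) Hl.
rewrite (funext E) in W.
have {}W := W _ (profile_continuous P (ltW d0)) _ gapl.
under eq_integral do rewrite -abs2_conj.
apply: le_trans (W _ _) _.
- by move=> j; rewrite fl; apply: complexP; rewrite /= ?oppr0.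
- by move=> x; apply: (profile_ge0 P); rewrite addr_ge0// ltW.
- by under eq_integral do rewrite abs2_conj.
Qed.

Lemma intg_abs2h : intg (fun xi => abs2 (fourier f xi)).
Proof.
have mX : measurable_fun setT (fun xi : R => (1 + xi ^+ 2) * abs2 (fourier f xi)).
  apply: measurable_funM => //; apply: measurable_funD => //; exact: measurable_funX.
have h : intg (fun xi => (1 + xi ^+ 2) * abs2 (fourier f xi)).
  by apply: ge0_intgE => // xi; rewrite mulr_ge0 ?abs2_ge0// addr_ge0 ?sqr_ge0.
apply: (intg_dom _ h) => // xi; rewrite ger0_norm ?abs2_ge0//.
by rewrite ler_peMl ?abs2_ge0// lerDl sqr_ge0.
Qed.

(** The tangent inequality for [s ^+ 2] bounds the integral of [s ^+ 2] below by one
    of [x ^+ 2]; as the packet has the zeros of [fourier f], Wirtinger's inequality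
    replaces [x ^+ 2] by the square of [t (`|xi| + d)], and [profile_bracket] leads
    back to [(`|xi| + d) ^+ 2]. The identity [packet_norm] matches the constant
    terms on the two sides of the transform. *)
Lemma packet_energy a :
  (\int[leb R]_xi ((`|xi| + d) ^+ 2 * abs2 (packet f a xi))%:E <=
   \int[leb R]_x (s `|x| ^+ 2 * abs2 (dual_packet f a x))%:E +
   \int[leb R]_xi ((4 * (`|xi| + d) + 12) * expR (kap * `|xi - a|) *
     abs2 (packet f a xi))%:E)%E.
Proof.
pose A := `|a| + d; have A0 : 0 < A by rewrite ltr_wpDl.
have b0 := profile_inv_gt0 P A0; set b := t A in b0.
have sb : s b = A by rewrite /b (profile_inv P)// ltW.
(* The slope at [b ^+ 2] of [s ^+ 2] as a function of the square of the variable. *)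
pose B := s b * s' b / b.
have B0 : 0 <= B.
  by rewrite /B sb divr_ge0 ?(ltW b0)// mulr_ge0 ?(ltW A0)// (slope_ge0 P)// ltW.
have Iw := Cintg_packet Ih a; have Iq := Cintg_dual_packet If Ih a.
pose w xi := abs2 (packet f a xi). pose q x := abs2 (dual_packet f a x).
have mw : measurable_fun setT w by exact: Cmeas_abs2 (Cintg_meas Iw).
have mq : measurable_fun setT q by exact: Cmeas_abs2 (Cintg_meas Iq).
have w0 xi : 0 <= w xi by exact: abs2_ge0. have q0 x : 0 <= q x by exact: abs2_ge0.
have Ew := packet_norm If Ih a; rewrite -/w in Ew.
set n := (\int[leb R]_xi (w xi)%:E)%E in Ew.
have n0 : (0 <= n)%E by apply: integral_ge0 => xi _; rewrite lee_fin.
have nfin : n \is a fin_num.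
  apply: integrable_fin_num => //; rewrite -/(intg w) /w.
  under eq_fun do rewrite abs2_packet mulrC.
  apply: (intgM_bounded (C := (Num.sqrt 2^-1)^-1) intg_abs2h).
    by apply: measurableT_comp; [exact: measurable_heat|exact: measurable_funB].
  by move=> xi; rewrite ger0_norm ?gam_ge0// heat_le// inv2_gt0.
have mt : measurable_fun setT (fun xi : R => t (`|xi| + d)).
  by apply: continuous_measurable_fun; apply: (profile_inv_continuous P); exact: ltW.
have Wm : (\int[leb R]_xi (t (`|xi| + d) ^+ 2 * w xi)%:E <=
    \int[leb R]_x (x ^+ 2 * q x)%:E)%E.
  have W := wirtinger (g := fun x => conjc (dual_packet f a x))
    (V := fun x => t (`|x| + d)) (CintgJ Iq) Hm.
  rewrite (funext (fourier_dual_packet If Ih a)) in W.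
  have {}W := W _ (profile_inv_continuous P (ltW d0)) _ gapm.
  apply: le_trans (W _ _) _.
  - by move=> j; rewrite /packet fm mulr0.
  - by move=> x; apply: (profile_inv_ge0 P); rewrite addr_ge0// ltW.
  - by under eq_integral do rewrite abs2_conj.
have mx2 : measurable_fun setT (fun x : R => x ^+ 2 * q x).
  by apply: measurable_funM => //; exact: measurable_funX.
have ms2 : measurable_fun setT (fun x : R => s `|x| ^+ 2 * q x).
  by apply: measurable_funM => //; exact: measurable_funX.
have mt2 : measurable_fun setT (fun xi : R => t (`|xi| + d) ^+ 2 * w xi).
  by apply: measurable_funM => //; exact: measurable_funX.
have mX2 : measurable_fun setT (fun xi : R => (`|xi| + d) ^+ 2 * w xi).
  by apply: measurable_funM => //; apply: measurable_funX; apply: measurable_funD.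
pose L xi := (4 * (`|xi| + d) + 12) * expR (kap * `|xi - a|) * w xi.
have X0 xi : 0 <= 4 * (`|xi| + d) + 12.
  by rewrite addr_ge0// mulr_ge0// addr_ge0// ltW.
have L0 xi : 0 <= L xi by apply: mulr_ge0 => //; apply: mulr_ge0 => //; exact: expR_ge0.
have mL : measurable_fun setT L.
  apply: measurable_funM => //; apply: measurable_funM.
    by apply: measurable_funD => //; apply: measurable_funM => //; apply: measurable_funD.
  apply: measurableT_comp => //; apply: measurable_funM => //.
  by apply: measurableT_comp => //; exact: measurable_funB.
have Bb0 : 0 <= B * b ^+ 2 by rewrite mulr_ge0// sqr_ge0.
have x2q0 x : 0 <= x ^+ 2 * q x by rewrite mulr_ge0 ?sqr_ge0.
have s2q0 x : 0 <= s `|x| ^+ 2 * q x by rewrite mulr_ge0 ?sqr_ge0.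
have t2w0 xi : 0 <= t (`|xi| + d) ^+ 2 * w xi by rewrite mulr_ge0 ?sqr_ge0.
have X2w0 xi : 0 <= (`|xi| + d) ^+ 2 * w xi by rewrite mulr_ge0 ?sqr_ge0.
have S1 : ((A ^+ 2)%:E * n + B%:E * \int[leb R]_x (x ^+ 2 * q x)%:E <=
    \int[leb R]_x (s `|x| ^+ 2 * q x)%:E + (B * b ^+ 2)%:E * n)%E.
  rewrite -Ew -ge0_integral_lin ?sqr_ge0// -[X in (_ <= X + _)%E]mul1e.
  rewrite -ge0_integral_lin//; apply: ge0_le_integral => //.
  - by move=> x _; rewrite lee_fin addr_ge0// mulr_ge0 ?sqr_ge0.
  - by apply/measurable_EFinP; apply: measurable_funD; apply: measurable_funM.
  - by apply/measurable_EFinP; apply: measurable_funD; apply: measurable_funM.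
  - move=> x _; rewrite lee_fin mul1r mulrA -!mulrDl ler_wpM2r ?abs2_ge0//.
    have := profile_sqr_tangent P (normr_ge0 x) b0.
    by rewrite real_normK ?num_real// -/B ?sb.
have S2 : (\int[leb R]_xi ((`|xi| + d) ^+ 2 * w xi)%:E + (B * b ^+ 2)%:E * n <=
    (A ^+ 2)%:E * n + B%:E * \int[leb R]_xi (t (`|xi| + d) ^+ 2 * w xi)%:E +
    \int[leb R]_xi (L xi)%:E)%E.
  rewrite -ge0_integral_lin ?sqr_ge0// -[X in (X + _ <= _)%E]mul1e.
  rewrite -ge0_integral_lin// -ge0_integralD//; last 4 first.
  - by move=> x _; rewrite lee_fin addr_ge0// mulr_ge0 ?sqr_ge0.
  - by apply/measurable_EFinP; apply: measurable_funD; apply: measurable_funM.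
  - by move=> x _; rewrite lee_fin.
  - exact/measurable_EFinP.
  apply: ge0_le_integral => //.
  - by move=> x _; rewrite lee_fin addr_ge0// mulr_ge0 ?sqr_ge0.
  - by apply/measurable_EFinP; apply: measurable_funD; apply: measurable_funM.
  - apply/measurable_EFinP; apply: measurable_funD => //.
    by apply: measurable_funD; apply: measurable_funM.
  - move=> xi _; rewrite -EFinD lee_fin mul1r [B * (_ * _)]mulrA /L -!mulrDl ler_wpM2r ?abs2_ge0//.
    apply: (profile_bracket (c := c) (p := p) P d0) => //.
    by rewrite /kap -addrA lerDr mulr_ge0.
have Bnfin : ((B * b ^+ 2)%:E * n)%E \is a fin_num by rewrite fin_numM.
rewrite -(leeD2rE _ _ Bnfin).
change (\int[leb R]_xi ((`|xi| + d) ^+ 2 * w xi)%:E + (B * b ^+ 2)%:E * n <=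
  \int[leb R]_x (s `|x| ^+ 2 * q x)%:E + \int[leb R]_xi (L xi)%:E + (B * b ^+ 2)%:E * n)%E.
apply: (le_trans S2); rewrite addeAC; apply: leeD => //.
apply: le_trans S1; apply: leeD => //.
by apply: lee_pmul => //; apply: integral_ge0 => xi _; rewrite lee_fin.
Qed.

Let X (xi : R) := `|xi| + d.

Let X_ge0 xi : 0 <= X xi.
Proof. by rewrite addr_ge0// ltW. Qed.

Let mX : measurable_fun setT X.
Proof. by apply: measurable_funD. Qed.

Let W (xi : R) := 4 * X xi + 12.

Let W_ge0 xi : 0 <= W xi.
Proof. by rewrite addr_ge0// mulr_ge0. Qed.

Let mW : measurable_fun setT W.
Proof. by apply: measurable_funD => //; apply: measurable_funM. Qed.

Let h2 (xi : R) := abs2 (fourier f xi).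

Let h2_ge0 xi : 0 <= h2 xi. Proof. exact: abs2_ge0. Qed.

Let gam_shift_int y : (\int[leb R]_x (gam (y - x))%:E = 1)%E.
Proof.
rewrite -[RHS](integral_heat_shift y (inv2_gt0 R)).
by apply: eq_integral => x _; rewrite gam_sym.
Qed.

Let mgamd : measurable_fun setT (fun q : R * R => gam (q.2 - q.1)).
Proof. exact: measurable_gam_diff. Qed.

(** Integrating over [a] first leaves the weight [s ^+ 2] averaged over the window
    against [abs2 \o f]; [weight_average] and [weighted_f] conclude. *)
Lemma total_dual :
  (\int[leb R]_a \int[leb R]_x (s `|x| ^+ 2 * abs2 (dual_packet f a x))%:E <= H)%E.
Proof.
pose k (q : R * R) := s `|q.2| ^+ 2 * abs2 (dual_packet f q.1 q.2).
have mk : measurable_fun setT k.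
  apply: measurable_funM; last exact: measurable_dual_packet.
  by apply: measurable_funX; exact: (measurable_snd_comp mS0).
have k0 q : 0 <= k q by rewrite mulr_ge0 ?sqr_ge0 ?abs2_ge0.
pose k' (q : R * R) := s `|q.1| ^+ 2 * (abs2 (f q.2) * gam (q.2 - q.1)).
have mk' : measurable_fun setT k'.
  apply: measurable_funM.
    by apply: measurable_funX; exact: (measurable_fst_comp mS0).
  by apply: measurable_funM => //; exact: (measurable_snd_comp mf).
have k'0 q : 0 <= k' q by rewrite mulr_ge0 ?sqr_ge0// mulr_ge0 ?abs2_ge0 ?gam_ge0.
rewrite (tonelli mk k0) /=.
apply: (@le_trans _ _ (\int[leb R]_x \int[leb R]_y (k' (x, y))%:E)%E).
  apply: ge0_le_integral => //.
  - by move=> x _; apply: integral_ge0 => a _; rewrite lee_fin.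
  - apply: (@measurable_fun_fubini_tonelli_G _ _ _ _ _ (leb R) (fun q => (k q)%:E)) => //.
    exact/measurable_EFinP.
  - exact: measurable_tonelli.
  - move=> x _; rewrite /k /k' /= !ge0_integralZ ?sqr_ge0//.
    + apply: lee_pmul => //; [by rewrite lee_fin sqr_ge0|..].
        by apply: integral_ge0 => a _; rewrite lee_fin abs2_ge0.
      exact: dual_packet_marginal.
    + apply: measurable_funM => //.
      by apply: measurableT_comp; [exact: measurable_heat|exact: measurable_funB].
    + by move=> y; rewrite mulr_ge0 ?abs2_ge0 ?gam_ge0.
    + exact: (measurable_slice_l x (measurable_dual_packet If Ih)).
    + by move=> a; exact: abs2_ge0.
rewrite (tonelli mk' k'0) /=; apply: le_trans weighted_f.
apply: ge0_le_integral => //.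
- by move=> y _; apply: integral_ge0 => x _; rewrite lee_fin.
- apply: (@measurable_fun_fubini_tonelli_G _ _ _ _ _ (leb R) (fun q => (k' q)%:E)) => //.
  exact/measurable_EFinP.
- apply/measurable_EFinP; apply: measurable_funM => //; apply: measurable_funX.
  exact: mS (ltW d0).
- move=> y _; rewrite /k' /=; under eq_integral do rewrite mulrCA.
  rewrite ge0_integralZ ?abs2_ge0//.
  + rewrite [leRHS]EFinM [leRHS]muleC; apply: lee_pmul => //.
    * by rewrite lee_fin abs2_ge0.
    * by apply: integral_ge0 => x _; rewrite lee_fin mulr_ge0 ?sqr_ge0 ?gam_ge0.
    * exact: weight_average.
  + apply: measurable_funM; first exact: measurable_funX.
    by apply: measurableT_comp; [exact: measurable_heat|exact: measurable_funB].
  + by move=> x; rewrite mulr_ge0 ?sqr_ge0 ?gam_ge0.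
Qed.

Lemma total_packet :
  (\int[leb R]_a \int[leb R]_xi (X xi ^+ 2 * abs2 (packet f a xi))%:E =
   \int[leb R]_xi (X xi ^+ 2 * h2 xi)%:E)%E.
Proof.
pose k (q : R * R) := X q.2 ^+ 2 * h2 q.2 * gam (q.2 - q.1).
have mk : measurable_fun setT k.
  apply: measurable_funM => //; apply: measurable_funM; last exact: (measurable_snd_comp mh).
  by apply: measurable_funX; exact: (measurable_snd_comp mX).
have k0 q : 0 <= k q by rewrite mulr_ge0 ?gam_ge0// mulr_ge0 ?sqr_ge0.
transitivity (\int[leb R]_a \int[leb R]_xi (k (a, xi))%:E)%E.
  apply: eq_integral => a _; apply: eq_integral => xi _.
  by rewrite abs2_packet /k /h2 /=; congr EFin; ring.
rewrite (tonelli mk k0) /=; apply: eq_integral => xi _; rewrite /k /=.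
have Xh0 : 0 <= X xi ^+ 2 * h2 xi by rewrite mulr_ge0 ?sqr_ge0.
rewrite ge0_integralZ//.
- by rewrite gam_shift_int mule1.
- by apply: measurableT_comp; [exact: measurable_heat|exact: measurable_funB].
- by move=> a; exact: gam_ge0.
Qed.

Lemma total_loss :
  (\int[leb R]_a \int[leb R]_xi (W xi * expR (kap * `|xi - a|) * abs2 (packet f a xi))%:E =
   N%:E * \int[leb R]_xi (W xi * h2 xi)%:E)%E.
Proof.
pose k (q : R * R) := W q.2 * h2 q.2 * (expR (kap * `|q.2 - q.1|) * gam (q.2 - q.1)).
have me : measurable_fun setT (fun u : R => expR (kap * `|u|) * gam u).
  exact: intg_meas (intg_moment kap).
have mk : measurable_fun setT k.
  apply: measurable_funM.
    by apply: measurable_funM; [exact: (measurable_snd_comp mW)|exact: (measurable_snd_comp mh)].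
  apply: (measurableT_comp me).
  by apply: measurable_funB; [exact: measurable_snd|exact: measurable_fst].
have e0 u : 0 <= expR (kap * `|u|) * gam u by rewrite mulr_ge0 ?expR_ge0 ?gam_ge0.
have k0 q : 0 <= k q by rewrite mulr_ge0// mulr_ge0.
transitivity (\int[leb R]_a \int[leb R]_xi (k (a, xi))%:E)%E.
  apply: eq_integral => a _; apply: eq_integral => xi _.
  by rewrite abs2_packet /k /h2 /=; congr EFin; ring.
rewrite (tonelli mk k0) /= -ge0_integralZ//; last 3 first.
- exact: measurable_funM.
- by move=> xi; rewrite mulr_ge0.
- exact: le_trans N1.
apply: eq_integral => xi _; rewrite /k /=.
have Wh0 : 0 <= W xi * h2 xi by rewrite mulr_ge0.
rewrite ge0_integralZ//.
- rewrite [X in (_ * X)%E](_ : _ = N%:E); first by rewrite -EFinM mulrC.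
  rewrite -(integral_moment kap xi); apply: eq_integral => a _.
  by rewrite gam_sym distrC.
by apply: (measurableT_comp me); exact: measurable_funB.
Qed.

(** The integral of [X ^+ 2 * h2] is bounded above by summing [packet_energy] over
    [a], and below by the choice of [d]; the two bounds differ by the integral of
    [h2]. *)
Lemma core_integral : (\int[leb R]_xi (h2 xi)%:E = 0)%E.
Proof.
pose V := (\int[leb R]_xi (W xi * h2 xi)%:E)%E.
have mX2h : measurable_fun setT (fun xi => X xi ^+ 2 * h2 xi).
  by apply: measurable_funM => //; exact: measurable_funX.
have mWh : measurable_fun setT (fun xi => W xi * h2 xi) by exact: measurable_funM.
have mxh : measurable_fun setT (fun xi : R => xi ^+ 2 * h2 xi).
  by apply: measurable_funM => //; exact: measurable_funX.
have X2h0 xi : 0 <= X xi ^+ 2 * h2 xi by rewrite mulr_ge0 ?sqr_ge0.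
have Wh0 xi : 0 <= W xi * h2 xi by rewrite mulr_ge0.
have xh0 (xi : R) : 0 <= xi ^+ 2 * h2 xi by rewrite mulr_ge0 ?sqr_ge0.
have N0 : 0 <= N by exact: le_trans N1.
have up : (\int[leb R]_xi (X xi ^+ 2 * h2 xi)%:E <= H + N%:E * V)%E.
  rewrite -total_packet -total_loss.
  have mP : measurable_fun setT (fun q : R * R => X q.2 ^+ 2 * abs2 (packet f q.1 q.2)).
    under eq_fun do rewrite abs2_packet.
    apply: measurable_funM.
      by apply: measurable_funX; exact: (measurable_snd_comp mX).
    by apply: measurable_funM => //; exact: (measurable_snd_comp mh).
  have mQ : measurable_fun setT (fun q : R * R => s `|q.2| ^+ 2 * abs2 (dual_packet f q.1 q.2)).
    apply: measurable_funM; last exact: measurable_dual_packet.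
    by apply: measurable_funX; exact: (measurable_snd_comp mS0).
  have mL : measurable_fun setT (fun q : R * R =>
      W q.2 * expR (kap * `|q.2 - q.1|) * abs2 (packet f q.1 q.2)).
    under eq_fun do rewrite abs2_packet.
    apply: measurable_funM; last first.
      by apply: measurable_funM => //; exact: (measurable_snd_comp mh).
    apply: measurable_funM; first exact: (measurable_snd_comp mW).
    apply: (measurableT_comp (@measurable_expabs R kap)).
    by apply: measurable_funB; [exact: measurable_snd|exact: measurable_fst].
  have P0 q : 0 <= X q.2 ^+ 2 * abs2 (packet f q.1 q.2).
    by rewrite mulr_ge0 ?sqr_ge0 ?abs2_ge0.
  have Q0 (q : R * R) : 0 <= s `|q.2| ^+ 2 * abs2 (dual_packet f q.1 q.2).
    by rewrite mulr_ge0 ?sqr_ge0 ?abs2_ge0.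
  have L0 (q : R * R) : 0 <= W q.2 * expR (kap * `|q.2 - q.1|) * abs2 (packet f q.1 q.2).
    by rewrite mulr_ge0 ?abs2_ge0// mulr_ge0 ?expR_ge0.
  have mIP := measurable_tonelli mP P0; have mIQ := measurable_tonelli mQ Q0.
  have mIL := measurable_tonelli mL L0.
  have iQ a : (0 <= \int[leb R]_x (s `|x| ^+ 2 * abs2 (dual_packet f a x))%:E)%E.
    by apply: integral_ge0 => x _; rewrite lee_fin; exact: (Q0 (a, x)).
  have iL a : (0 <= \int[leb R]_xi (W xi * expR (kap * `|xi - a|) * abs2 (packet f a xi))%:E)%E.
    by apply: integral_ge0 => x _; rewrite lee_fin; exact: (L0 (a, x)).
  apply: (@le_trans _ _ (\int[leb R]_a (\int[leb R]_x (s `|x| ^+ 2 * abs2 (dual_packet f a x))%:E +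
     \int[leb R]_xi (W xi * expR (kap * `|xi - a|) * abs2 (packet f a xi))%:E))%E).
    apply: ge0_le_integral => //.
    - by move=> a _; apply: integral_ge0 => x _; rewrite lee_fin; exact: (P0 (a, x)).
    - exact: emeasurable_funD.
    - by move=> a _; exact: packet_energy.
  rewrite ge0_integralD//; apply: leeD => //; exact: total_dual.
have low : (H + N%:E * V + \int[leb R]_xi (h2 xi)%:E <=
    \int[leb R]_xi (X xi ^+ 2 * h2 xi)%:E)%E.
  rewrite -[H]mul1e -ge0_integral_lin// -ge0_integralD//; last 4 first.
  - by move=> xi _; rewrite lee_fin addr_ge0// mulr_ge0.
  - by apply/measurable_EFinP; apply: measurable_funD; apply: measurable_funM.
  - by move=> xi _; rewrite lee_fin.
  - exact/measurable_EFinP.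
  apply: ge0_le_integral => //.
  - by move=> xi _; rewrite lee_fin addr_ge0// addr_ge0// mulr_ge0.
  - apply/measurable_EFinP; apply: measurable_funD => //.
    by apply: measurable_funD; apply: measurable_funM.
  - exact/measurable_EFinP.
  - move=> xi _; rewrite -EFinD lee_fin.
    rewrite [leLHS](_ : _ = (xi ^+ 2 + N * W xi + 1) * h2 xi); last by rewrite /h2; ring.
    rewrite ler_wpM2r// /W /X -[xi ^+ 2](real_normK (num_real xi)) dE.
    have := normr_ge0 xi; move: `|xi| => z z0.
    have : 0 <= z * N by rewrite mulr_ge0.
    have : N <= N ^+ 2 by rewrite expr2 ler_peMl.
    by move: N1; lra.
have m1h : measurable_fun setT (fun xi : R => (1 + xi ^+ 2) * h2 xi).
  by apply: measurable_funM => //; apply: measurable_funD => //; exact: measurable_funX.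
have I1 : intg (fun xi => (1 + xi ^+ 2) * h2 xi).
  by apply: ge0_intgE => // xi; rewrite mulr_ge0// addr_ge0 ?sqr_ge0.
have Hf : H \is a fin_num.
  apply: integrable_fin_num => //; apply: (intg_dom mxh I1) => xi.
  by rewrite ger0_norm// ler_wpM2r// lerDr.
have Vf : V \is a fin_num.
  apply: integrable_fin_num => //; apply: (intg_dom mWh (intgZ (4 * d + 16) I1)) => xi.
  rewrite ger0_norm// mulrA ler_wpM2r// /W /X -[xi ^+ 2](real_normK (num_real xi)).
  have := normr_ge0 xi; move: `|xi| => z z0.
  have dz : 0 <= d * z ^+ 2 by rewrite mulr_ge0 ?sqr_ge0// ltW.
  by have := sqr_ge0 (z - 1); rewrite sqrrB1; have := sqr_ge0 z; lra.
have HV : (H + N%:E * V)%E \is a fin_num by rewrite fin_numD Hf fin_numM.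
have h : (\int[leb R]_xi (h2 xi)%:E <= 0)%E
  by rewrite -(leeD2lE _ _ HV) adde0; exact: le_trans low up.
apply/eqP; rewrite eq_le h/=.
by apply: integral_ge0 => xi _; rewrite lee_fin.
Qed.

Theorem core_zero x : f x = 0.
Proof.
have ae0 : ae_eq (leb R) setT (fun xi => (h2 xi)%:E) (cst 0%E).
  apply/ae_eq_integral_abs => //; first exact/measurable_EFinP.
  by under eq_integral do rewrite gee0_abs ?lee_fin//; exact: core_integral.
have I0 : Rintegral (leb R) setT (fun xi => normc (conjc (fourier f xi))) = 0.
  have mn : measurable_fun setT (fun xi => (normc (conjc (fourier f xi)))%:E).
    by apply/measurable_EFinP; exact: Cmeas_normc (CmeasJ (Cintg_meas Ih)).
  have Z : (\int[leb R]_xi `|(normc (conjc (fourier f xi)))%:E| = 0)%E.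
    apply/ae_eq_integral_abs => //.
    apply: filterS ae0 => xi h _.
    have [e] : (abs2 (fourier f xi))%:E = 0%E := h Logic.I.
    by rewrite Cnormc_conj (abs2_eq0 e) ComplexField.Normc.normc0.
  have {}Z : (\int[leb R]_xi (normc (conjc (fourier f xi)))%:E = 0)%E.
    by rewrite -[RHS]Z; apply: eq_integral => xi _; rewrite gee0_abs// lee_fin normc_ge0.
  by rewrite /Rintegral Z.
have := normc_fourier x (CintgJ Ih); rewrite I0 fourier_inversion// Cnormc_conj => h.
apply: ComplexField.Normc.eq0_normc; apply/eqP.
by rewrite eq_le h normc_ge0.
Qed.

End Core.

(** * Admissible functions *)

Section Admissible.
Variables (R : realType) (S T : R -> R).
Hypotheses (aS : subexp_admissible S) (iT : left_cont_inverse S T).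

Let S_ge0 x : 0 <= x -> 0 <= S x.
Proof. by have [h _ _ _ _] := aS; exact: h. Qed.

Let S_mono x y : 0 <= x -> x <= y -> S x <= S y.
Proof.
have [_ _ _ h _] := aS => x0 xy; apply: h => //; rewrite in_itv/= andbT//.
exact: le_trans xy.
Qed.

Let S_convex (th x y : R) : 0 <= th -> th <= 1 -> 0 <= x -> 0 <= y ->
  S (th * x + (1 - th) * y) <= th * S x + (1 - th) * S y.
Proof.
move=> h0 h1 x0 y0; have [_ _ h _ _] := aS.
have := h (Itv01 h0 h1) x y; rewrite !inE /= !in_itv/= !andbT => /(_ x0 y0).
by [].
Qed.

Let S_unbounded y : exists2 x, 0 <= x & y <= S x.
Proof.
case: (leP 0 y) => y0; last by exists 0; rewrite // (le_trans (ltW y0))// S_ge0.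
have : (ereal_inf [set x%:E | x in [set x | (0 <= x)%R /\ (y <= S x)%R]] < (T y + 1)%:E)%E.
  by rewrite -iT// lte_fin ltrDl.
by move=> /ereal_inf_lt[_ [x [x0 yx] <-] _]; exists x.
Qed.

Let T_le y x : 0 <= y -> 0 <= x -> y <= S x -> T y <= x.
Proof.
move=> y0 x0 yx; rewrite -lee_fin iT//; apply: ereal_inf_lbound.
by exists x.
Qed.

Let T_approx y z : 0 <= y -> T y < z -> exists x, [/\ 0 <= x, y <= S x & x < z].
Proof.
move=> y0 Tz.
have : (ereal_inf [set x%:E | x in [set x | (0 <= x)%R /\ (y <= S x)%R]] < z%:E)%E.
  by rewrite -iT// lte_fin.
by move=> /ereal_inf_lt[_ [x [x0 yx] <-]]; rewrite lte_fin => xz; exists x.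
Qed.

(** By convexity the difference quotients on the segment from [b] to [x] are
    bounded by that of the whole segment, hence so is their limit. *)
Lemma is_derive_from_tangent (g x b : R) : 0 <= x -> 0 <= b ->
  is_derive_from 0 S b g -> S b + g * (x - b) <= S x.
Proof.
move=> x0 b0 hg.
have [->|xb] := eqVneq x b; first by rewrite subrr mulr0 addr0.
rewrite leNgt; apply/negP => lt.
have xb0 : 0 < `|x - b| by rewrite normr_gt0 subr_eq0.
pose eps := (S b + g * (x - b) - S x) / `|x - b|.
have eps0 : 0 < eps by rewrite divr_gt0// subr_gt0.
have /cvgrPdist_lt/(_ _ eps0) := hg.
move=> [r /= r0 hr].
pose th := Num.min 1 (r / (2 * `|x - b|)).
have th0 : 0 < th by rewrite lt_min ltr01 divr_gt0// mulr_gt0.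
have th1 : th <= 1 by rewrite ge_min lexx.
have thr : th * `|x - b| < r.
  apply: (@le_lt_trans _ _ (r / (2 * `|x - b|) * `|x - b|)).
    by rewrite ler_wpM2r// ge_min lexx orbT.
  rewrite invfM mulrA mulfVK ?gt_eqF//; lra.
pose y := th * x + (1 - th) * b.
have yb : y - b = th * (x - b) by rewrite /y; ring.
have y0 : 0 <= y by rewrite addr_ge0// mulr_ge0 ?(ltW th0)// subr_ge0.
have yb0 : y != b.
  by rewrite -subr_eq0 yb mulf_eq0 (gt_eqF th0) subr_eq0.
have cvx := S_convex (ltW th0) th1 x0 b0; rewrite -/y in cvx.
have := hr y; rewrite /= distrC yb normrM (gtr0_norm th0) => /(_ thr yb0).
rewrite in_itv /= andbT => /(_ y0); set q := _ / _ => h2.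
have xbn : x - b != 0 by rewrite subr_eq0.
have Sq : S y - S b = q * (th * (x - b)).
  by rewrite /q mulfVK// mulf_neq0// gt_eqF.
have h3 : q * (x - b) <= S x - S b.
  by rewrite -(ler_pM2l th0); move: cvx Sq; lra.
have : (g - q) * (x - b) < eps * `|x - b|.
  by apply: le_lt_trans (ler_norm _) _; rewrite normrM ltr_pM2r.
rewrite /eps mulfVK ?gt_eqF//; lra.
Qed.

Variable g : R -> R.
Hypothesis dS : forall x, 0 <= x -> is_derive_from 0 S x (g x).

Let tangent x b : 0 <= x -> 0 <= b -> S b + g b * (x - b) <= S x.
Proof. by move=> x0 b0; exact: is_derive_from_tangent (dS b0). Qed.

Let slope_mono x y : 0 <= x -> x <= y -> g x <= g y.
Proof.
move=> x0; rewrite le_eqVlt => /predU1P[->//|xy].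
have y0 := le_trans x0 (ltW xy).
have h1 := tangent x0 y0; have h2 := tangent y0 x0.
have : (g y - g x) * (y - x) >= 0 by lra.
by rewrite pmulr_lge0 ?subr_gt0// subr_ge0.
Qed.

Let S_is_derive (z : R) : 0 < z -> is_derive z 1 S (g z).
Proof.
move=> z0; have h : h^-1 *: (S (h *: 1 + z) - S z) @[h --> 0^'] --> g z.
  apply/cvgrPdist_lt => e e0.
  have [r /= r0 hr] := (cvgrPdist_lt _ _).1 (dS (ltW z0)) _ e0.
  exists (Num.min r z); first by rewrite /= lt_min r0.
  move=> h; rewrite /= sub0r normrN lt_min => /andP[hr1 hz1] hn0.
  have := hr (h *: 1 + z); rewrite /= [h *: 1]mulr1 opprD addrCA addrN addr0.
  rewrite normrN => /(_ hr1); rewrite -subr_eq0 addrK => /(_ hn0).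
  rewrite in_itv/= andbT; have : 0 <= h + z.
    by have := ler_norm (- h); rewrite normrN; lra.
  by move=> hz /(_ hz); rewrite mulrC.
apply: DeriveDef; first by apply/cvg_ex; exists (g z).
exact: cvg_lim.
Qed.

Let S_cont (z : R) : 0 < z -> {for z, continuous S}.
Proof.
move=> z0; apply: differentiable_continuous; apply/derivable1_diffP.
by have [] := S_is_derive z0.
Qed.

Let derive_sqr (z : R) : 0 < z -> derive1 (fun t => S t ^+ 2) z = 2 * S z * g z.
Proof.
move=> z0; rewrite derive1E; have d := S_is_derive z0.
rewrite (_ : (fun t => S t ^+ 2) = S ^+ 2); last by apply/funext => y; rewrite !exprS expr0.
by rewrite derive_val /= expr1.
Qed.

(** The function [ln (F z)], with [F] the derivative of [S ^+ 2], is concave past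
    [e], so its chords beyond [e + 1] have slope at most [c], its increment on
    [[e, e + 1]]. As [S] is nondecreasing, the resulting bound on the growth of
    [S * g] passes to [g]. *)
Lemma admissible_base : exists e c : R, [/\ 0 < e, 1 <= S e, 0 < g e, 0 <= c &
  forall y r, e + 1 <= y -> 0 <= r -> g (y + r) <= g y * expR (c * r)].
Proof.
have [_ _ _ _ [[T0 [T00 _ [_ lc]]] _]] := aS.
(* Exceeding [S T0] puts [e] beyond [T0] and makes the slope at [e] positive. *)
have [e e0 Se] := S_unbounded (Num.max 1 (S T0 + 1)).
have [S1 ST] : 1 <= S e /\ S T0 + 1 <= S e.
  by move: Se; rewrite ge_max => /andP.
have Te : T0 < e.
  by rewrite ltNge; apply/negP => eT; have := S_mono e0 eT; lra.
have e00 : 0 < e by exact: lt_trans Te.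
have ge : 0 < g e.
  have := tangent (ltW T00) e0 => h.
  have : 0 < g e * (e - T0) by lra.
  by rewrite pmulr_lgt0// subr_gt0.
pose F z := 2 * S z * g z.
have Spos z : e <= z -> 1 <= S z by move=> ez; exact: le_trans S1 (S_mono e0 ez).
have gpos z : e <= z -> 0 < g z by move=> ez; exact: lt_le_trans ge (slope_mono e0 ez).
have Fpos z : e <= z -> 0 < F z.
  by move=> ez; rewrite mulr_gt0 ?gpos// mulr_gt0// (lt_le_trans ltr01)// Spos.
have chord a b b' : e <= a -> a <= b -> b <= b' -> a < b' ->
    (b' - b) * ln (F a) + (b - a) * ln (F b') <= (b' - a) * ln (F b).
  move=> ea ab bb ab'; have ba : 0 < b' - a by rewrite subr_gt0.
  pose th := (b' - b) / (b' - a).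
  have th01 : 0 <= th <= 1.
    by rewrite divr_ge0 ?subr_ge0// ?(ltW ab')//= ler_pdivrMr// mul1r lerB.
  have e1 : th * a + (1 - th) * b' = b by rewrite /th; field; rewrite gt_eqF.
  have [Ta Tb Tb'] : [/\ T0 <= a, T0 <= b & T0 <= b'].
    by split; lra.
  have [Fa Fb Fb'] : [/\ 0 < F a, 0 < F b & 0 < F b'] by split; apply: Fpos; lra.
  have := lc a b' th Ta Tb' th01; rewrite e1 !derive_sqr; try lra.
  rewrite -/(F a) -/(F b) -/(F b').
  have pa : 0 < F a `^ th by exact: powR_gt0.
  have pb : 0 < F b' `^ (1 - th) by exact: powR_gt0.
  rewrite -ler_ln ?posrE//; last exact: mulr_gt0.
  rewrite lnM ?posrE//.
  rewrite !ln_powR -(ler_pM2l ba) => h.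
  apply: le_trans h; rewrite /th le_eqVlt; apply/orP; left; apply/eqP.
  by field; rewrite gt_eqF.
pose c := ln (F (e + 1)) - ln (F e).
have c0 : 0 <= c.
  have ee : e <= e + 1 by lra.
  rewrite subr_ge0 ler_ln ?posrE ?Fpos//.
  rewrite ler_pM ?mulr_ge0 ?(ltW ge)//; first lra.
    by rewrite ler_pM2l// S_mono.
  exact: slope_mono.
exists e, c; split => // y r ey r0.
have ey' : e <= y by lra.
have eyr : e <= y + r by lra.
have h1 : ln (F y) - ln (F e) <= (y - e) * c.
  have /chord : e <= e by []; move=> /(_ (e + 1) y).
  rewrite /c; have -> : e + 1 - e = 1 by ring.
  have a1 : e <= e + 1 by lra.
  have a2 : e < y by lra.
  by move=> /(_ a1 ey a2); lra.
have h2 : ln (F (y + r)) <= ln (F y) + c * r.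
  have /chord : e <= e by []; move=> /(_ y (y + r) ey').
  have a1 : y <= y + r by lra.
  have a2 : e < y + r by lra.
  move=> /(_ a1 a2) h; have ye : 0 < y - e by lra.
  have h3 : r * (ln (F y) - ln (F e)) <= r * ((y - e) * c) by rewrite ler_wpM2l.
  by rewrite -(ler_pM2l ye); lra.
have : F (y + r) <= F y * expR (c * r).
  have [Fy Fyr] : 0 < F y /\ 0 < F (y + r) by split; exact: Fpos.
  have ec := expR_gt0 (c * r).
  rewrite -ler_ln ?posrE//; last exact: mulr_gt0.
  by rewrite lnM ?posrE// expRK.
have Sy : 0 < S y by rewrite (lt_le_trans ltr01)// Spos.
have Sm : S y <= S (y + r) by apply: S_mono; lra.
rewrite /F => h.
have : S y * g (y + r) <= S (y + r) * g (y + r) by rewrite ler_wpM2r// ltW// gpos.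
move=> h'; rewrite -(ler_pM2l Sy); lra.
Qed.

Section Base.
Variables e c : R.
Hypotheses (e0 : 0 < e) (S1 : 1 <= S e) (ge0 : 0 < g e) (c0 : 0 <= c)
  (gr : forall y r, e + 1 <= y -> 0 <= r -> g (y + r) <= g y * expR (c * r)).
Let E := e + 1.

Let E0 : 0 < E. Proof. exact: addr_gt0. Qed.
Let eE : e <= E. Proof. by rewrite lerDl. Qed.

Let S1E : 1 <= S E. Proof. by apply: le_trans S1 _; exact: S_mono (ltW e0) eE. Qed.

Let gpos z : e <= z -> 0 < g z.
Proof. by move=> ez; exact: lt_le_trans ge0 (slope_mono (ltW e0) ez). Qed.

Let S_lt x : 0 <= x -> x < E -> S x < S E.
Proof.
move=> x0 xE; case: (leP x e) => xe.
  have := S_mono x0 xe; have := tangent (ltW E0) (ltW e0).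
  by rewrite /E; move: ge0; lra.
have := tangent (ltW E0) x0.
have : 0 < g x * (E - x) by rewrite mulr_gt0 ?subr_gt0// gpos// ltW.
lra.
Qed.

Let T_ge y : S E <= y -> E <= T y.
Proof.
move=> Ey; have y0 : 0 <= y by rewrite (le_trans _ Ey)// (le_trans ler01).
rewrite leNgt; apply/negP => /(T_approx y0)[x [x0 yx xE]].
by have := S_lt x0 xE; lra.
Qed.

Let TK y : S E <= y -> S (T y) = y.
Proof.
move=> Ey; have y0 : 0 <= y by rewrite (le_trans _ Ey)// (le_trans ler01).
have TE := T_ge Ey; have T0 : 0 < T y by exact: lt_le_trans TE.
apply/eqP; rewrite eq_le; apply/andP; split; rewrite leNgt; apply/negP => h.
  have gT : 0 < g (T y) by apply: gpos; move: TE; rewrite /E; lra.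
  pose r := Num.min (T y) ((S (T y) - y) / g (T y)).
  have r0 : 0 < r by rewrite lt_min T0 divr_gt0// subr_gt0.
  have rT : 0 <= T y - r by rewrite subr_ge0 ge_min lexx.
  have gr' : g (T y) * r <= S (T y) - y.
    by rewrite mulrC -ler_pdivlMr// ge_min lexx orbT.
  have : y <= S (T y - r) by have := tangent rT (ltW T0); lra.
  by move=> /(T_le y0 rT); lra.
have gT : 0 < g (T y + 1) by apply: gpos; move: TE; rewrite /E; lra.
pose r := Num.min 1 ((y - S (T y)) / g (T y + 1)).
have r0 : 0 < r by rewrite lt_min ltr01 divr_gt0// subr_gt0.
have r1 : r <= 1 by rewrite ge_min lexx.
have gr' : g (T y + 1) * r <= y - S (T y).
  by rewrite mulrC -ler_pdivlMr// ge_min lexx orbT.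
have Tr : T y < T y + r by lra.
have [x [x0 yx xT]] := T_approx y0 Tr.
have Tx := T_le y0 x0 yx.
have tg := tangent (ltW T0) x0.
have gx : g x * (x - T y) <= g (T y + 1) * (x - T y).
  by rewrite ler_wpM2r ?subr_ge0// slope_mono//; lra.
have : g (T y + 1) * (x - T y) < g (T y + 1) * r by rewrite ltr_pM2l//; lra.
lra.
Qed.

Lemma admissible_profile : profile (fun x => S (E + x) - S E)
  (fun x => g (E + x)) (fun y => T (y + S E) - E) c (g E).
Proof.
have Eb b : 0 <= b -> 0 <= E + b by move=> b0; rewrite addr_ge0// ltW.
split.
- by rewrite addr0 subrr.
- move=> x b x0 b0; have := tangent (Eb _ x0) (Eb _ b0); lra.
- by apply: gpos; rewrite /E; lra.
- by move=> b b0; rewrite slope_mono ?(ltW E0)// lerDl.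
- exact: c0.
- move=> y b y0 yb; have := @gr (E + y) (b - y).
  rewrite (_ : E + y + (b - y) = E + b); last by ring.
  by apply; rewrite ?subr_ge0// /E; lra.
- move=> d d0 x; apply: cvgB; last exact: cvg_cst.
  apply: (@continuous_comp _ _ _ (fun x : R => E + (`|x| + d)) S).
    apply: cvgD; first exact: cvg_cst.
    by apply: cvgD; [exact: norm_continuous|exact: cvg_cst].
  by apply: S_cont; rewrite ltr_wpDr// addr_ge0.
- by move=> y y0; rewrite subr_ge0 T_ge// lerDr.
- move=> y y0; rewrite (_ : E + (T (y + S E) - E) = T (y + S E)); last by ring.
  by rewrite TK ?addrK// lerDr.
Qed.

Lemma gap_conditionP (h : R -> R) (l : int -> R) (k : R) (j : int) :
  gap_condition h l k -> h (`|l j| + k) * (l (j + 1) - l j) <= 1 / 2.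
Proof.
move=> H; rewrite -lee_fin; apply: le_trans H.
by apply: ereal_sup_ubound; exists j.
Qed.

(** The hypothesis [1 <= h] forces gaps shorter than 1; the last summand of the
    shift [k + d + 1] then covers the distance from [l j] to any point of the
    gap. *)
Lemma gap_condition_near (h h' : R -> R) (l : int -> R) (k d : R) :
    bi_infinite_increasing l -> 0 <= d -> gap_condition h l (k + d + 1) ->
    (forall x, k <= x -> 1 <= h x) ->
    {in `[k, +oo[ &, {homo h : x y / x <= y}} ->
    (forall x, 0 <= x -> h' x <= h (k + x)) ->
  forall j x, l j <= x -> x <= l (j + 1) -> h' (`|x| + d) * (l (j + 1) - l j) <= 1 / 2.
Proof.
move=> [incr _ _] d0 H h1 hm hh j x lx xl.
have := gap_conditionP j H; have := incr j; rewrite -subr_gt0.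
set D := _ - l j => D0 HD; have nl := normr_ge0 (l j).
have kk : k <= `|l j| + (k + d + 1) by lra.
have Dh : D <= 1 / 2.
  by apply: le_trans HD; rewrite ler_peMl ?(ltW D0)// h1.
have xlj : `|x| <= `|l j| + 1.
  have : `|x - l j| <= 1.
    by rewrite ger0_norm ?subr_ge0//; move: Dh; rewrite /D; lra.
  by have := ler_distD 0 x (l j); have := ler_dist_dist x (l j); rewrite ler_distl => /andP[]; lra.
apply: le_trans HD; rewrite ler_wpM2r ?(ltW D0)//.
have x0 := normr_ge0 x.
apply: le_trans (hh _ _) _; first by rewrite addr_ge0.
apply: hm; rewrite ?in_itv/= ?andbT//; lra.
Qed.

Lemma base_uniqueness : exists d dt : R, forall l m : int -> R,
  bi_infinite_increasing l -> bi_infinite_increasing m ->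
  gap_condition S l dt -> gap_condition T m d ->
  forall f : R -> R[i], Cintg f -> Cintg (fourier f) ->
  continuous (fun x => Re (f x)) -> continuous (fun x => Im (f x)) ->
  (\int[leb R]_xi ((1 + xi ^+ 2) * abs2 (fourier f xi))%:E < +oo)%E ->
  (forall j, f (l j) = 0) -> (forall j, fourier f (m j) = 0) -> forall x, f x = 0.
Proof.
have P := admissible_profile.
pose d := core_shift c (g E); have d0 : 0 <= d by apply: ltW; exact: core_shift_gt0 P.
exists (S E + d + 1), (E + d + 1) => l m Hl Hm gl gm f If Ih cr ci Hfin fl fm x.
refine (core_zero P If Ih cr ci Hl Hm fl fm _ _ Hfin x).
- apply: (@gap_condition_near S (fun z => S (E + z) - S E) l E d Hl d0 gl).
  + by move=> z Ez; apply: le_trans S1E (S_mono (ltW E0) Ez).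
  + move=> y z; rewrite in_itv/= andbT => Ey _; apply: S_mono.
    exact: le_trans (ltW E0) Ey.
  + by move=> z z0; rewrite lerBlDr lerDl (le_trans ler01).
- have SE0 : 0 <= S E by rewrite (le_trans ler01).
  apply: (@gap_condition_near T (fun z => T (z + S E) - E) m (S E) d Hm d0 gm).
  + move=> y Ey; by apply: le_trans (T_ge Ey); rewrite lerDr ltW.
  + move=> y z; rewrite !in_itv/= !andbT => Ey Ez yz.
    apply: T_le; first exact: le_trans Ey.
      exact: le_trans (ltW E0) (T_ge Ez).
    by rewrite TK.
  + by move=> y y0; rewrite [S E + y]addrC lerBlDr lerDl ltW.
Qed.

End Base.

End Admissible.

Lemma admissible_uniqueness (R : realType) (S T : R -> R) :
  subexp_admissible S -> left_cont_inverse S T ->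
  exists d dt : R, forall l m : int -> R,
  bi_infinite_increasing l -> bi_infinite_increasing m ->
  gap_condition S l dt -> gap_condition T m d ->
  forall f : R -> R[i], Cintg f -> Cintg (fourier f) ->
  continuous (fun x => Re (f x)) -> continuous (fun x => Im (f x)) ->
  (\int[leb R]_xi ((1 + xi ^+ 2) * abs2 (fourier f xi))%:E < +oo)%E ->
  (forall j, f (l j) = 0) -> (forall j, fourier f (m j) = 0) -> forall x, f x = 0.
Proof.
move=> aS iT; have [_ [g [dS _]] _ _ _] := aS.
have [e [c [e0 S1 ge c0 gr]]] := admissible_base aS iT dS.
exact: (base_uniqueness aS iT dS e0 S1 ge c0 gr).
Qed.

(** * The theorem *)

Section Regularity.
Variable R : realType.

Lemma intg_inv_oneDsqr : intg (fun x : R => (1 + x ^+ 2)^-1).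
Proof.
have ge (x : R) : 0 <= (oneDsqr x)^-1 by rewrite invr_ge0 (le_trans ler01)// oneDsqr_ge1.
have cV : continuous (fun x : R => (oneDsqr x)^-1) by exact: continuous_oneDsqrV.
apply: ge0_intgE => //; first exact: continuous_measurable_fun cV.
rewrite (ge0_symfun_integralT ge cV); last by move=> x; rewrite /= /oneDsqr sqrrN.
have := @integral0y_oneDsqr R; rewrite set_itvE => ->.
by rewrite -EFinM ltry.
Qed.

(** The weight [w := 1 + x ^+ 2] and its inverse give [2 * z <= w * z ^+ 2 + w^-1],
    and [w^-1] is integrable. *)
Lemma weighted_L2_Cintg (f : R -> R[i]) : Cmeasurable f ->
  (\int[leb R]_x ((1 + x ^+ 2) * abs2 (f x))%:E < +oo)%E -> Cintg f.
Proof.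
move=> mf hf; have w0 (x : R) : 0 < 1 + x ^+ 2 by rewrite ltr_pwDl// sqr_ge0.
have mh : measurable_fun setT (fun x : R => (1 + x ^+ 2) * abs2 (f x)).
  apply: measurable_funM; last exact: Cmeas_abs2.
  by apply: measurable_funD => //; exact: measurable_funX.
have ih : intg (fun x : R => (1 + x ^+ 2) * abs2 (f x)).
  by apply: ge0_intgE => // x; rewrite mulr_ge0 ?abs2_ge0// ltW.
apply: (Cintg_dom mf (intgD ih intg_inv_oneDsqr)) => x.
rewrite /abs2; move: (normc (f x)) (normc_ge0 (f x)) => z z0.
have := w0 x; move: (1 + x ^+ 2) => w {}w0.
have wi : 0 < w^-1 by rewrite invr_gt0.
have e : w * w^-1 = 1 by rewrite divff// gt_eqF.
have : 0 <= w * (z - w^-1) ^+ 2 by rewrite mulr_ge0 ?sqr_ge0// ltW.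
have -> : w * (z - w^-1) ^+ 2 = w * z ^+ 2 - 2 * (w * w^-1) * z + (w * w^-1) * w^-1 by ring.
rewrite e; lra.
Qed.

Lemma continuous_ReIm (f : R -> R[i]) : continuous (f : R -> (R[i])^o) ->
  continuous (fun x => Re (f x)) /\ continuous (fun x => Im (f x)).
Proof.
move=> cf; have key (x e : R) : 0 < e ->
    \forall y \near x, normc (f x - f y) < e.
  move=> e0; have eC : 0 < e%:C by rewrite ltcR.
  have [r r0 hr] := (cvgrPdist_lt _ _).1 (cf x) _ eC.
  by exists r => // y xy; rewrite -ltcR; exact: hr y xy.
split=> x; apply/cvgrPdist_lt => e e0; have [r r0 hr] := key x e e0;
  exists r => // y /hr h.
- by apply: (le_lt_trans _ h); rewrite -CReN -CReD; exact: Re_le_normc.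
- by apply: (le_lt_trans _ h); rewrite -CImN -CImD; exact: Im_le_normc.
Qed.

End Regularity.
Theorem theorem1 (R : realType) (S Sinv : R -> R)
  (hS : (subexp_admissible S /\ left_cont_inverse S Sinv) \/
        (subexp_admissible Sinv /\ left_cont_inverse Sinv S)) :
  exists d dt : R,
    forall lambda mu : int -> R,
      bi_infinite_increasing lambda ->
      bi_infinite_increasing mu ->
      gap_condition S lambda dt ->
      gap_condition Sinv mu d ->
      fourier_uniqueness_pair (range lambda) (range mu).
Proof.
have reg (f : R -> R[i]) : in_H f -> continuous (f : R -> (R[i])^o) ->
    [/\ Cintg f, Cintg (fourier f), continuous (fun x => Re (f x)),
        continuous (fun x => Im (f x)) &
      (\int[leb R]_x ((1 + x ^+ 2) * abs2 (f x))%:E < +oo)%E /\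
      (\int[leb R]_xi ((1 + xi ^+ 2) * abs2 (fourier f xi))%:E < +oo)%E].
  move=> [[mf _] hH] cf; have [cr ci] := continuous_ReIm cf.
  have w (h : R -> R[i]) : (0 <= \int[leb R]_x ((1 + x ^+ 2) * abs2 (h x))%:E)%E.
    apply: integral_ge0 => x _; rewrite lee_fin mulr_ge0 ?abs2_ge0//.
    by rewrite addr_ge0// sqr_ge0.
  have h1 : (\int[leb R]_x ((1 + x ^+ 2) * abs2 (f x))%:E < +oo)%E.
    by apply: le_lt_trans hH; rewrite leeDl.
  have h2 : (\int[leb R]_xi ((1 + xi ^+ 2) * abs2 (fourier f xi))%:E < +oo)%E.
    by apply: le_lt_trans hH; rewrite leeDr.
  have If := weighted_L2_Cintg mf h1.
  by split=> //; exact: weighted_L2_Cintg (Cmeas_fourier If) h2.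
case: hS => -[aS iT]; have [d [dt U]] := admissible_uniqueness aS iT.
- exists d, dt => l m Hl Hm gl gm f /reg{}reg /reg[If Ih cr ci [_ h2]] fl fm.
  apply: (U l m Hl Hm gl gm f) => // j; first by apply: fl; exists j.
  by apply: fm; exists j.
- exists dt, d => l m Hl Hm gl gm f /reg{}reg /reg[If Ih cr ci [h1 _]] fl fm.
  (* The transform of [g] is the conjugate of [f], so [g] satisfies the hypotheses
     with the two sequences exchanged. *)
  pose g xi := conjc (fourier f xi).
  have gf x : fourier g x = conjc (f x) by exact: fourier_inversion.
  have Hg : fourier g = fun x => conjc (f x) by apply/funext.
  have g0 : forall xi, g xi = 0.
    apply: (U m l Hm Hl gm gl g (CintgJ Ih)).
    + by rewrite Hg; exact: CintgJ.
    + rewrite (_ : (fun x => Re (g x)) = fun x => Re (fourier f x)).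
        exact: continuous_fourier_Re.
      by apply/funext => x; rewrite /g CReJ.
    + rewrite (_ : (fun x => Im (g x)) = fun x => - Im (fourier f x)).
        by move=> x; apply: cvgN; exact: continuous_fourier_Im.
      by apply/funext => x; rewrite /g CImJ.
    + by rewrite Hg; under eq_integral do rewrite abs2_conj.
    + by move=> j; rewrite /g fm ?conjc0//; exists j.
    + by move=> j; rewrite Hg fl ?conjc0//; exists j.
  move=> x; rewrite -[f x]Cconj_conj -gf.
  have -> : g = fun=> 0 by apply/funext.
  rewrite /fourier; under eq_Cintegral do rewrite mul0r.
  by rewrite /Cintegral /= /Rintegral integral0 /= oppr0.
Qed.
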